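(* There exists a commutative (non-positive) DG-ring $A$ with unbounded cohomology such that the reduction functor $\mathrm{H}^0(A)\otimes^{\mathrm{L}}_A - : \mathsf{D}(A) \to \mathsf{D}(\mathrm{H}^0(A))$ and the coreduction functor $\mathrm{R}\operatorname{Hom}_A(\mathrm{H}^0(A),-) : \mathsf{D}(A) \to \mathsf{D}(\mathrm{H}^0(A))$ are both not conservative.
   Context: Gradings are cohomological. A non-positive DG-ring $A = \bigoplus_{n=-\infty}^0 A^n$ is a graded (unital, associative) ring with a differential $d : A \to A$ of degree $+1$ satisfying the graded Leibniz rule; all DG-rings here are non-positive. There is a natural map of DG-rings $A \to \mathrm{H}^0(A)$. A DG-ring $A$ is commutative if it is graded-commutative and every homogeneous element $a$ of odd degree satisfies $a^2 = 0$. $A$ has bounded cohomology if $\mathrm{H}^n(A) = 0$ for all $n \ll 0$, and unbounded cohomology otherwise. $\mathsf{D}(A)$ is the unbounded derived category of DG-modules over $A$. A functor $T$ is conservative if, for every morphism $f$ in its source, $T(f)$ being an isomorphism implies that $f$ is an isomorphism; for a triangulated functor this is equivalent to: $T(M) \cong 0$ implies $M \cong 0$ for every object $M$. *)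

(* Defs.v *)
From HB Require Import structures.
From Stdlib Require Import RelationClasses.
From mathcomp Require Import all_boot all_order all_algebra.
From mathcomp Require Import boolp.
From mathcomp Require Import generic_quotient ring_quotient.
From mathcomp Require Import freeg.
From mathcomp Require Import ring.

Set Implicit Arguments.
Unset Strict Implicit.
Unset Printing Implicit Defensive.

Import GRing.Theory Num.Theory.
Local Open Scope ring_scope.
Local Open Scope quotient_scope.

Definition sgn (V : zmodType) (i : int) (x : V) : V := x *~ ((-1 : int) ^ i).

Lemma sgnB (V : zmodType) i : zmod_morphism (@sgn V i).
Proof. by move=> x y; rewrite /sgn mulrzBl. Qed.

HB.instance Definition _ (V : zmodType) i :=
  GRing.isZmodMorphism.Build V V (@sgn V i) (@sgnB V i).

Lemma sgnD (V : zmodType) i j (x : V) : sgn (i + j) x = sgn i (sgn j x).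
Proof. by rewrite /sgn exprzDr // mulrC mulrzA. Qed.

Lemma sgnC (V : zmodType) i j (x : V) : sgn i (sgn j x) = sgn j (sgn i x).
Proof. by rewrite -!sgnD addrC. Qed.

Lemma sgnK (V : zmodType) i (x : V) : sgn i (sgn i x) = x.
Proof. by rewrite /sgn -mulrzA -exprzMl // mulrNN mulr1 exp1rz. Qed.

Lemma sgn0 (V : zmodType) (x : V) : sgn 0 x = x.
Proof. by []. Qed.

Lemma sgn1 (V : zmodType) (x : V) : sgn 1 x = - x.
Proof. by rewrite /sgn expr1z mulrN1z. Qed.

Lemma sgnS (V : zmodType) i (x : V) : sgn (i + 1) x = - sgn i x.
Proof. by rewrite sgnD sgn1 raddfN. Qed.

Lemma sgn_parity (V : zmodType) k i j (x : V) :
  i = j + (k + k) -> sgn i x = sgn j x.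
Proof. by move=> ->; rewrite sgnD sgnD sgnK. Qed.

Lemma sgn_morph (U V : zmodType) (f : U -> V) : zmod_morphism f ->
  forall i x, f (sgn i x) = sgn i (f x).
Proof.
move=> fB i x; pose F := GRing.isZmodMorphism.Build U V f fB.
pose g : {additive U -> V} := HB.pack f F.
exact: (raddfMz g).
Qed.

Lemma zmod_morph0 (U V : zmodType) (f : U -> V) : zmod_morphism f -> f 0 = 0.
Proof. by move=> fB; rewrite -[0]subr0 fB subrr. Qed.

Lemma zmod_morphN (U V : zmodType) (f : U -> V) : zmod_morphism f ->
  forall x, f (- x) = - f x.
Proof. by move=> fB x; rewrite -[- x]sub0r fB (zmod_morph0 fB) sub0r. Qed.

Lemma zmod_morphD (U V : zmodType) (f : U -> V) : zmod_morphism f ->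
  forall x y, f (x + y) = f x + f y.
Proof. by move=> fB x y; rewrite -[y]opprK fB (zmod_morphN fB) !opprK. Qed.

(* An operation landing in degree k takes an equation on degrees such as
   i + j = k as an argument, so that no transport between degrees is needed. *)

Record complex := Complex {
  piece :> int -> zmodType;
  diff : forall i j : int, i + 1 = j -> piece i -> piece j;
  diffB : forall (i j : int) (e : i + 1 = j), zmod_morphism (diff e);
  diffK : forall (i j k : int) (e : i + 1 = j) (e' : j + 1 = k) x,
    diff e' (diff e x) = 0
}.

Section Cohomology.
Variables (M : complex) (n : int).

Definition is_cocycle : pred (M n) := fun x => diff (erefl (n + 1)) x == 0.

Lemma is_cocycle_closed : zmod_closed is_cocycle.
Proof.
split=> [|x y]; rewrite !unfold_in /is_cocycle.
  by rewrite (zmod_morph0 (diffB _)).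
by rewrite diffB => /eqP -> /eqP ->; rewrite subrr.
Qed.

HB.instance Definition _ :=
  GRing.isZmodClosed.Build (M n) is_cocycle is_cocycle_closed.

Record cocycle := Cocycle { cocycle_val :> M n; _ : is_cocycle cocycle_val }.

HB.instance Definition _ := [isSub for cocycle_val].
HB.instance Definition _ := [Choice of cocycle by <:].
HB.instance Definition _ := [SubChoice_isSubZmodule of cocycle by <:].

Definition is_coboundary : pred cocycle :=
  fun z => `[< exists (i : int) (e : i + 1 = n) (y : M i), diff e y = z >].

Lemma is_coboundary_closed : zmod_closed is_coboundary.
Proof.
split=> [|x y]; rewrite !unfold_in.
  have e : n - 1 + 1 = n by rewrite subrK.
  by apply/asboolP; exists (n - 1), e, 0; rewrite (zmod_morph0 (diffB _)).
move=> /asboolP [i [e [a ax]]] /asboolP [j [e' [b bx]]].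
apply/asboolP; have ij : i = j by apply: (addIr 1); rewrite e e'.
move: e' b bx; rewrite -ij => e' b; rewrite (eq_irrelevance e' e) => bx.
by exists i, e, (a - b); rewrite diffB ax bx.
Qed.

HB.instance Definition _ :=
  GRing.isZmodClosed.Build cocycle is_coboundary is_coboundary_closed.

Definition cohomology : zmodType := 
  Quotient.quot (GRing.ZmodClosed.clone cocycle is_coboundary _).

Definition coh_class (z : cocycle) : cohomology := \pi z.

End Cohomology.

Lemma coh_classB (M : complex) n : zmod_morphism (@coh_class M n).
Proof. by move=> x y; rewrite /coh_class raddfB. Qed.

Lemma coh_class_eq (M : complex) n (x y : cocycle M n) :
  coh_class x = coh_class y <->
  exists (i : int) (e : i + 1 = n) (a : M i), diff e a = cocycle_val x - cocycle_val y.
Proof.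
split=> [/eqP|h].
  by rewrite /coh_class -Quotient.idealrBE unfold_in => /asboolP.
by apply/eqP; rewrite /coh_class -Quotient.idealrBE unfold_in; apply/asboolP.
Qed.

Lemma coh_class_surj (M : complex) n (h : cohomology M n) :
  exists z, h = coh_class z.
Proof. by exists (repr h); rewrite /coh_class reprK. Qed.

(* DG-rings are non-positive by definition. *)
Record dgring := DGRing {
  dgring_complex :> complex;
  dgone : dgring_complex 0;
  dgmul : forall i j k : int, i + j = k ->
    dgring_complex i -> dgring_complex j -> dgring_complex k;
  dgmulBl : forall (i j k : int) (e : i + j = k) b, zmod_morphism (fun a => dgmul e a b);
  dgmulBr : forall (i j k : int) (e : i + j = k) a, zmod_morphism (fun b => dgmul e a b);
  dgmulA : forall (i j k ij jk ijk : int) (e1 : i + j = ij) (e2 : ij + k = ijk)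
    (e3 : j + k = jk) (e4 : i + jk = ijk) a b c,
    dgmul e2 (dgmul e1 a b) c = dgmul e4 a (dgmul e3 b c);
  dgmul1l : forall (i : int) (e : 0 + i = i) a, dgmul e dgone a = a;
  dgmul1r : forall (i : int) (e : i + 0 = i) a, dgmul e a dgone = a;
  dgleibniz : forall (i j k i' j' k' : int) (e : i + j = k)
    (ei : i + 1 = i') (ej : j + 1 = j') (ek : k + 1 = k')
    (el : i' + j = k') (er : i + j' = k') a b,
    diff ek (dgmul e a b) =
      dgmul el (diff ei a) b + sgn i (dgmul er a (diff ej b));
  dgnonpos : forall i (a : dgring_complex i), 0 < i -> a = 0
}.

Definition dg_commutative (A : dgring) : Prop :=
  (forall (i j k : int) (e : i + j = k) (e' : j + i = k) (a : A i) (b : A j),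
     dgmul e a b = sgn (i * j) (dgmul e' b a)) /\
  (forall (i k : int) (e : i + i = k) (a : A i), odd `|i|%N -> dgmul e a a = 0).

Definition bounded_cohomology (A : dgring) : Prop :=
  exists N : int, forall n, n < N -> forall h : cohomology A n, h = 0.

Record dgring_hom (A B : dgring) := DGRingHom {
  dgr_fun :> forall n, A n -> B n;
  dgr_funB : forall n, zmod_morphism (@dgr_fun n);
  dgr_fund : forall (i j : int) (e : i + 1 = j) a,
    dgr_fun (diff e a) = diff e (dgr_fun a);
  dgr_fun1 : dgr_fun (dgone A) = dgone B;
  dgr_funM : forall (i j k : int) (e : i + j = k) a b,
    dgr_fun (dgmul e a b) = dgmul e (dgr_fun a) (dgr_fun b)
}.

Record dgmod (A : dgring) := DGMod {
  dgmod_complex :> complex;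
  dgact : forall i j k : int, i + j = k ->
    A i -> dgmod_complex j -> dgmod_complex k;
  dgactBl : forall (i j k : int) (e : i + j = k) m, zmod_morphism (fun a => dgact e a m);
  dgactBr : forall (i j k : int) (e : i + j = k) a, zmod_morphism (fun m => dgact e a m);
  dgactA : forall (i j k ij jk ijk : int) (e1 : i + j = ij) (e2 : ij + k = ijk)
    (e3 : j + k = jk) (e4 : i + jk = ijk) a b m,
    dgact e2 (dgmul e1 a b) m = dgact e4 a (dgact e3 b m);
  dgact1 : forall (i : int) (e : 0 + i = i) m, dgact e (dgone A) m = m;
  dgact_leibniz : forall (i j k i' j' k' : int) (e : i + j = k)
    (ei : i + 1 = i') (ej : j + 1 = j') (ek : k + 1 = k')
    (el : i' + j = k') (er : i + j' = k') a m,
    diff ek (dgact e a m) =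
      dgact el (diff ei a) m + sgn i (dgact er a (diff ej m))
}.

Record dghom (A : dgring) (M N : dgmod A) := DGHom {
  dgh_fun :> forall n, M n -> N n;
  dgh_funB : forall n, zmod_morphism (@dgh_fun n);
  dgh_fund : forall (i j : int) (e : i + 1 = j) m,
    dgh_fun (diff e m) = diff e (dgh_fun m);
  dgh_funZ : forall (i j k : int) (e : i + j = k) a m,
    dgh_fun (dgact e a m) = dgact e a (dgh_fun m)
}.

Section CohomologyMap.
Variables (A : dgring) (M N : dgmod A) (f : dghom M N) (n : int).

Lemma dghom_cocycle (z : cocycle M n) : is_cocycle (f n z).
Proof.
rewrite /is_cocycle -dgh_fund; case: z => z /= /eqP ->.
by rewrite (zmod_morph0 (dgh_funB f (n := _))).
Qed.

Definition cohomology_map (h : cohomology M n) : cohomology N n :=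
  coh_class (Cocycle (dghom_cocycle (repr h))).

Lemma cohomology_mapE (z : cocycle M n) :
  cohomology_map (coh_class z) = coh_class (Cocycle (dghom_cocycle z)).
Proof.
apply/coh_class_eq => /=.
have : coh_class (repr (coh_class z)) = coh_class z by rewrite /coh_class reprK.
move=> /coh_class_eq [i [e [a ea]]]; exists i, e, (f i a).
by rewrite -dgh_fund ea dgh_funB.
Qed.

End CohomologyMap.

Definition quasi_iso (A : dgring) (M N : dgmod A) (f : dghom M N) : Prop :=
  forall n, bijective (@cohomology_map A M N f n).

(* As A is non-positive, every element of A^0 is a cocycle, so H^0(A) is a
   quotient ring of A^0; it is made into a DG-ring concentrated in degree 0. *)

Section H0.
Variable A : dgring.

Lemma diff_deg0 j (e : 0 + 1 = j) (a : A 0) : diff e a = 0.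
Proof. by apply: dgnonpos; rewrite -e. Qed.

Lemma is_cocycle0 (a : A 0) : is_cocycle a.
Proof. by rewrite /is_cocycle diff_deg0. Qed.

Definition H0 : Type := cohomology A 0.
HB.instance Definition _ := GRing.Zmodule.on H0.

Definition H0_class (a : A 0) : H0 := coh_class (Cocycle (is_cocycle0 a)).

Lemma H0_classB : zmod_morphism H0_class.
Proof.
move=> a b; rewrite /H0_class -(@coh_classB A 0).
by congr coh_class; apply: val_inj.
Qed.

Lemma H0_class_surj (h : H0) : exists a, h = H0_class a.
Proof.
have [z ->] := coh_class_surj h; exists z.
by rewrite /H0_class; congr coh_class; apply: val_inj.
Qed.

Lemma H0_class_eq a b : H0_class a = H0_class b <->
  exists (i : int) (e : i + 1 = 0) (u : A i), diff e u = a - b.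
Proof. exact: coh_class_eq. Qed.

Definition mul00 : A 0 -> A 0 -> A 0 := dgmul (addr0 0).

Definition H0_one : H0 := H0_class (dgone A).
Definition H0_mul (x y : H0) : H0 :=
  H0_class (mul00 (cocycle_val (repr x)) (cocycle_val (repr y))).

Lemma H0_mulE a b : H0_mul (H0_class a) (H0_class b) = H0_class (mul00 a b).
Proof.
rewrite /H0_mul.
set a' := cocycle_val (repr (H0_class a)).
set b' := cocycle_val (repr (H0_class b)).
have : H0_class a' = H0_class a.
  rewrite -[RHS]reprK /H0_class /coh_class; congr \pi.
  exact: val_inj.
have : H0_class b' = H0_class b.
  rewrite -[RHS]reprK /H0_class /coh_class; congr \pi.
  exact: val_inj.
move=> /H0_class_eq [i [e [v ev]]] /H0_class_eq [j [e' [u eu]]].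
have ij : j = i by apply: (addIr 1); rewrite e e'.
subst j; rewrite (eq_irrelevance e' e) in eu.
apply/H0_class_eq; exists i, e.
have ei : i + 0 = i by rewrite addr0.
have e0i : 0 + i = i by rewrite add0r.
exists (dgmul ei u b' + dgmul e0i a v).
rewrite (zmod_morphD (diffB _)).
have e01 : 0 + 1 = 1 :> int by rewrite add0r.
have e1i : 1 + i = 0 by rewrite addrC.
rewrite (dgleibniz ei e e01 e (addr0 0) e) diff_deg0 eu.
rewrite (zmod_morph0 (dgmulBr _ _)) raddf0 addr0.
rewrite (dgleibniz e0i e01 e e e1i (addr0 0)) diff_deg0 ev (zmod_morph0 (dgmulBl _ _)) add0r sgn0.
by rewrite dgmulBl dgmulBr /mul00 addrA subrK.
Qed.

Lemma H0_mulA : associative H0_mul.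
Proof.
move=> x y z; have [a ->] := H0_class_surj x; have [b ->] := H0_class_surj y.
have [c ->] := H0_class_surj z; rewrite !H0_mulE; congr H0_class.
by rewrite /mul00; symmetry; apply: dgmulA.
Qed.

Lemma H0_mul1l : left_id H0_one H0_mul.
Proof.
move=> x; have [a ->] := H0_class_surj x.
by rewrite /H0_one H0_mulE /mul00 dgmul1l.
Qed.

Lemma H0_mul1r : right_id H0_one H0_mul.
Proof.
move=> x; have [a ->] := H0_class_surj x.
by rewrite /H0_one H0_mulE /mul00 dgmul1r.
Qed.

Lemma H0_mulDl : left_distributive H0_mul +%R.
Proof.
move=> x y z; have [a ->] := H0_class_surj x; have [b ->] := H0_class_surj y.
have [c ->] := H0_class_surj z.
rewrite !H0_mulE -!(zmod_morphD H0_classB) H0_mulE /mul00.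
by rewrite (zmod_morphD (dgmulBl _ c)).
Qed.

Lemma H0_mulDr : right_distributive H0_mul +%R.
Proof.
move=> x y z; have [a ->] := H0_class_surj x; have [b ->] := H0_class_surj y.
have [c ->] := H0_class_surj z.
rewrite !H0_mulE -!(zmod_morphD H0_classB) H0_mulE /mul00.
by rewrite (zmod_morphD (dgmulBr _ a)).
Qed.

HB.instance Definition _ :=
  GRing.Zmodule_isPzRing.Build H0 H0_mulA H0_mul1l H0_mul1r H0_mulDl H0_mulDr.

End H0.

Lemma unit_addA : associative (fun _ _ : unit => tt). Proof. by []. Qed.
Lemma unit_addC : commutative (fun _ _ : unit => tt). Proof. by []. Qed.
Lemma unit_add0 : left_id tt (fun _ _ : unit => tt). Proof. by case. Qed.
Lemma unit_addN : left_inverse tt (fun _ : unit => tt) (fun _ _ : unit => tt).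
Proof. by []. Qed.

HB.instance Definition _ :=
  GRing.isZmodule.Build unit unit_addA unit_addC unit_add0 unit_addN.

Section RingDG.
Variable R : pzRingType.

Definition ring_piece (n : int) : zmodType :=
  match n with Posz 0 => R : zmodType | _ => unit : zmodType end.

Definition ring_diff (i j : int) (_ : i + 1 = j) (_ : ring_piece i) :
  ring_piece j := 0.

Lemma ring_diffB i j (e : i + 1 = j) : zmod_morphism (ring_diff e).
Proof. by move=> x y; rewrite /ring_diff subr0. Qed.

Definition ring_complex : complex :=
  @Complex ring_piece ring_diff ring_diffB (fun _ _ _ _ _ _ => erefl).

Definition ring_mul (i j k : int) (_ : i + j = k) :
    ring_piece i -> ring_piece j -> ring_piece k :=
  match i, j, k with
  | Posz 0, Posz 0, Posz 0 => fun a b => a * b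
  | _, _, _ => fun _ _ => 0
  end.

Lemma ring_mulBl i j k (e : i + j = k) b : zmod_morphism (fun a => ring_mul e a b).
Proof.
move: i j k e b => [[|i]|i] [[|j]|j] [[|k]|k] //= e b x y;
  by rewrite ?subr0 // mulrBl.
Qed.

Lemma ring_mulBr i j k (e : i + j = k) a : zmod_morphism (fun b => ring_mul e a b).
Proof.
move: i j k e a => [[|i]|i] [[|j]|j] [[|k]|k] //= e a x y;
  by rewrite ?subr0 // mulrBr.
Qed.

Lemma ring_mulA i j k ij jk ijk (e1 : i + j = ij) (e2 : ij + k = ijk)
    (e3 : j + k = jk) (e4 : i + jk = ijk) a b c :
  ring_mul e2 (ring_mul e1 a b) c = ring_mul e4 a (ring_mul e3 b c).
Proof.
move: i j k ij jk ijk e1 e2 e3 e4 a b c.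
move=> [[|i]|i] [[|j]|j] [[|k]|k] [[|ij]|ij] [[|jk]|jk] [[|ijk]|ijk] //=;
  by move=> *; rewrite ?mulrA ?mulr0 ?mul0r.
Qed.

Lemma ring_mul1l i (e : 0 + i = i) a :
  @ring_mul 0 i i e (1 : R) a = a.
Proof. by move: i e a => [[|i]|i] e //= a; rewrite ?mul1r //; case: a. Qed.

Lemma ring_mul1r i (e : i + 0 = i) a :
  @ring_mul i 0 i e a (1 : R) = a.
Proof. by move: i e a => [[|i]|i] e //= a; rewrite ?mulr1 //; case: a. Qed.

Lemma ring_leibniz i j k i' j' k' (e : i + j = k)
    (ei : i + 1 = i') (ej : j + 1 = j') (ek : k + 1 = k')
    (el : i' + j = k') (er : i + j' = k') a b :
  ring_diff ek (ring_mul e a b) =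
    ring_mul el (ring_diff ei a) b + sgn i (ring_mul er a (ring_diff ej b)).
Proof.
by rewrite /ring_diff (zmod_morph0 (ring_mulBl _ _))
  (zmod_morph0 (ring_mulBr _ _)) raddf0 addr0.
Qed.

Lemma ring_nonpos i (a : ring_piece i) : 0 < i -> a = 0.
Proof. by case: i a => [[|i]|i] //= []. Qed.

Definition dgring_of_ring : dgring :=
  @DGRing ring_complex (1 : R) ring_mul ring_mulBl ring_mulBr ring_mulA
    ring_mul1l ring_mul1r ring_leibniz ring_nonpos.

End RingDG.

Section Projection.
Variable A : dgring.

Definition H0_dgring : dgring := dgring_of_ring (H0 A).

Definition H0_proj_fun (n : int) : A n -> H0_dgring n :=
  match n with Posz 0 => @H0_class A | _ => fun _ => 0 end.

Lemma H0_proj_funB n : zmod_morphism (@H0_proj_fun n).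
Proof.
case: n => [[|n]|n] x y /=; rewrite ?subr0 //.
exact: H0_classB.
Qed.

Lemma H0_proj_fund i j (e : i + 1 = j) (a : A i) :
  H0_proj_fun (diff e a) = diff e (H0_proj_fun a).
Proof.
rewrite /= /ring_diff; move: i j e a => i [[|j]|j] //= e a.
rewrite -(zmod_morph0 (@H0_classB A)); apply/H0_class_eq.
by exists i, e, a; rewrite subr0.
Qed.

Lemma H0_proj_funM i j k (e : i + j = k) (a : A i) (b : A j) :
  H0_proj_fun (dgmul e a b) = dgmul e (H0_proj_fun a) (H0_proj_fun b).
Proof.
case: (ltrP 0 i) => [i0|i0].
  by rewrite (dgnonpos a i0) (zmod_morph0 (dgmulBl _ _))
    !(zmod_morph0 (@H0_proj_funB _)) (zmod_morph0 (dgmulBl _ _)).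
case: (ltrP 0 j) => [j0|j0].
  by rewrite (dgnonpos b j0) (zmod_morph0 (dgmulBr _ _))
    !(zmod_morph0 (@H0_proj_funB _)) (zmod_morph0 (dgmulBr _ _)).
case: i j k e a b i0 j0 => [[|i]|i] [[|j]|j] [[|k]|k] e a b i0 j0 //.
by rewrite (eq_irrelevance e (addr0 0)); symmetry; apply: H0_mulE.
Qed.

Definition H0_proj : dgring_hom A H0_dgring :=
  @DGRingHom A H0_dgring H0_proj_fun H0_proj_funB H0_proj_fund erefl
    H0_proj_funM.

End Projection.

(* Morphisms are considered up to the equivalence relation [heq]. *)

Record category := Category {
  ob :> Type;
  hom : ob -> ob -> Type;
  heq : forall X Y, hom X Y -> hom X Y -> Prop;
  idm : forall X, hom X X;
  comp : forall X Y Z, hom Y Z -> hom X Y -> hom X Z;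
  heq_equiv : forall X Y, Equivalence (@heq X Y);
  comp_heq : forall X Y Z (g g' : hom Y Z) (f f' : hom X Y),
    heq g g' -> heq f f' -> heq (comp g f) (comp g' f');
  compA : forall X Y Z T (h : hom Z T) (g : hom Y Z) (f : hom X Y),
    heq (comp h (comp g f)) (comp (comp h g) f);
  comp1l : forall X Y (f : hom X Y), heq (comp (idm Y) f) f;
  comp1r : forall X Y (f : hom X Y), heq (comp f (idm X)) f
}.
Arguments idm {c} X.

Definition is_iso (C : category) (X Y : C) (f : hom X Y) : Prop :=
  exists g : hom Y X, heq (comp g f) (idm X) /\ heq (comp f g) (idm Y).

Record functor (C D : category) := Functor {
  fob :> C -> D;
  fmap : forall X Y, hom X Y -> hom (fob X) (fob Y);
  fmap_heq : forall X Y (f g : hom X Y), heq f g -> heq (fmap f) (fmap g);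
  fmap1 : forall X, heq (fmap (idm X)) (idm (fob X));
  fmap_comp : forall X Y Z (g : hom Y Z) (f : hom X Y),
    heq (fmap (comp g f)) (comp (fmap g) (fmap f))
}.

Definition conservative (C D : category) (F : functor C D) : Prop :=
  forall (X Y : C) (f : hom X Y), is_iso (fmap F f) -> is_iso f.

Section CompFunctor.
Variables (C D E : category) (G : functor D E) (F : functor C D).

Lemma comp_functor1 X : heq (fmap G (fmap F (idm X))) (idm (G (F X))).
Proof.
have [_ _ tr] := @heq_equiv E (G (F X)) (G (F X)).
exact: tr (fmap_heq G (fmap1 F X)) (fmap1 G _).
Qed.

Lemma comp_functor_comp X Y Z (g : hom Y Z) (f : hom X Y) :
  heq (fmap G (fmap F (comp g f)))
      (comp (fmap G (fmap F g)) (fmap G (fmap F f))).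
Proof.
have [_ _ tr] := @heq_equiv E (G (F X)) (G (F Z)).
exact: tr (fmap_heq G (fmap_comp F g f)) (fmap_comp G _ _).
Qed.

Definition comp_functor : functor C E :=
  @Functor C E (fun X => G (F X)) (fun X Y f => fmap G (fmap F f))
    (fun X Y f g h => fmap_heq G (fmap_heq F h))
    comp_functor1 comp_functor_comp.

End CompFunctor.

Record nat_trans (C D : category) (F G : functor C D) := NatTrans {
  ntc :> forall X : C, hom (F X) (G X);
  ntc_nat : forall X Y (f : hom X Y),
    heq (comp (ntc Y) (fmap F f)) (comp (fmap G f) (ntc X))
}.

(* The Gabriel-Zisman localization: the morphisms of C[W^-1] are the words in
   the morphisms of C and formal inverses of the elements of W, modulo the
   congruence generated by composition in C and by w^-1 w = 1, w w^-1 = 1. *)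

Section Localization.
Variables (C : category) (W : forall X Y : C, hom X Y -> Prop).

Inductive zigzag (X : C) : C -> Type :=
| ZNil : zigzag X X
| ZFwd Y Z : zigzag X Y -> hom Y Z -> zigzag X Z
| ZBwd Y Z (s : zigzag X Y) (w : hom Z Y) : W w -> zigzag X Z.

Inductive zeq (X : C) : forall Y, zigzag X Y -> zigzag X Y -> Prop :=
| ZRefl Y (s : zigzag X Y) : zeq s s
| ZSym Y (s t : zigzag X Y) : zeq s t -> zeq t s
| ZTrans Y (s t u : zigzag X Y) : zeq s t -> zeq t u -> zeq s u
| ZFwdCong Y Z (s t : zigzag X Y) (f g : hom Y Z) :
    zeq s t -> heq f g -> zeq (ZFwd s f) (ZFwd t g)
| ZBwdCong Y Z (s t : zigzag X Y) (w : hom Z Y) (Ww Ww' : W w) :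
    zeq s t -> zeq (ZBwd s Ww) (ZBwd t Ww')
| ZId Y (s : zigzag X Y) : zeq (ZFwd s (idm Y)) s
| ZComp Y Z T (s : zigzag X Y) (f : hom Y Z) (g : hom Z T) :
    zeq (ZFwd (ZFwd s f) g) (ZFwd s (comp g f))
| ZBwdFwd Y Z (s : zigzag X Y) (w : hom Z Y) (Ww : W w) :
    zeq (ZFwd (ZBwd s Ww) w) s
| ZFwdBwd Y Z (s : zigzag X Y) (w : hom Y Z) (Ww : W w) :
    zeq (ZBwd (ZFwd s w) Ww) s.

Fixpoint zcat (X Y Z : C) (s : zigzag X Y) (t : zigzag Y Z) : zigzag X Z :=
  match t with
  | ZNil => s
  | ZFwd _ _ t f => ZFwd (zcat s t) f
  | ZBwd _ _ t _ Ww => ZBwd (zcat s t) Ww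
  end.

Lemma zeq_equiv X Y : Equivalence (@zeq X Y).
Proof.
by split; [exact: ZRefl | exact: ZSym | move=> ? ? ?; exact: ZTrans].
Qed.

Lemma zcat_congl X Y Z (s s' : zigzag X Y) (t : zigzag Y Z) :
  zeq s s' -> zeq (zcat s t) (zcat s' t).
Proof.
move=> ss'; elim: t => //= [Z1 Z2 t IH f|Z1 Z2 t IH w Ww].
  by apply: ZFwdCong => //; have [r _ _] := heq_equiv Z1 Z2; apply: r.
exact: ZBwdCong.
Qed.

Lemma zcat_congr X Y Z (s : zigzag X Y) (t t' : zigzag Y Z) :
  zeq t t' -> zeq (zcat s t) (zcat s t').
Proof.
elim=> /= {Z t t'}.
- by move=> *; apply: ZRefl.
- by move=> *; apply: ZSym.
- by move=> Z t t' t'' _ + _; apply: ZTrans.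
- by move=> *; apply: ZFwdCong.
- by move=> *; apply: ZBwdCong.
- by move=> *; apply: ZId.
- by move=> *; apply: ZComp.
- by move=> *; apply: ZBwdFwd.
- by move=> *; apply: ZFwdBwd.
Qed.

Lemma zcat_cong X Y Z (t t' : zigzag Y Z) (s s' : zigzag X Y) :
  zeq t t' -> zeq s s' -> zeq (zcat s t) (zcat s' t').
Proof. by move=> ? ?; apply: ZTrans (zcat_congl _ _) (zcat_congr _ _). Qed.

Lemma zcatA X Y Z T (u : zigzag Z T) (t : zigzag Y Z) (s : zigzag X Y) :
  zeq (zcat (zcat s t) u) (zcat s (zcat t u)).
Proof.
elim: u => /= [|Z1 Z2 u IH f|Z1 Z2 u IH w Ww]; first exact: ZRefl.
  by apply: ZFwdCong => //; have [r _ _] := heq_equiv Z1 Z2; apply: r.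
exact: ZBwdCong.
Qed.

Lemma zcat_nill X Y (s : zigzag X Y) : zeq (zcat (ZNil X) s) s.
Proof.
elim: s => /= [|Z1 Z2 u IH f|Z1 Z2 u IH w Ww]; first exact: ZRefl.
  by apply: ZFwdCong => //; have [r _ _] := heq_equiv Z1 Z2; apply: r.
exact: ZBwdCong.
Qed.

Definition localization : category :=
  @Category C zigzag zeq ZNil (fun X Y Z t s => zcat s t) zeq_equiv zcat_cong
    zcatA (fun X Y s => ZRefl s) zcat_nill.

Lemma loc_functor_heq X Y (f g : hom X Y) :
  heq f g -> zeq (ZFwd (ZNil X) f) (ZFwd (ZNil X) g).
Proof. by move=> fg; apply: ZFwdCong => //; apply: ZRefl. Qed.

Definition loc_functor : functor C localization :=
  @Functor C localization (fun X => X) (fun X Y f => ZFwd (ZNil X) f)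
    loc_functor_heq (fun X => ZId (ZNil X))
    (fun X Y Z g f => ZSym (ZComp (ZNil X) f g)).

End Localization.

(* For F : C -> D and classes of weak equivalences W in C, W' in D, with
   localization functors Q and Q', the left derived functor of F is the
   terminal pair (L, eps : L Q => Q' F), and the right derived functor is the
   initial pair (R, eta : Q' F => R Q). *)

Section DerivedFunctors.
Variables (C D : category).
Variables (W : forall X Y : C, hom X Y -> Prop).
Variables (W' : forall X Y : D, hom X Y -> Prop).
Variable F : functor C D.

Local Notation Q := (loc_functor W).
Local Notation Q' := (loc_functor W').

Definition is_left_derived (L : functor (localization W) (localization W'))
    (eps : nat_trans (comp_functor L Q) (comp_functor Q' F)) : Prop :=
  forall (G : functor (localization W) (localization W'))
         (gam : nat_trans (comp_functor G Q) (comp_functor Q' F)),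
    (exists t : nat_trans G L,
       forall X : C, heq (comp (eps X) (t (Q X))) (gam X)) /\
    (forall t t' : nat_trans G L,
       (forall X : C, heq (comp (eps X) (t (Q X))) (gam X)) ->
       (forall X : C, heq (comp (eps X) (t' (Q X))) (gam X)) ->
       forall X, heq (t X) (t' X)).

Definition is_right_derived (R : functor (localization W) (localization W'))
    (eta : nat_trans (comp_functor Q' F) (comp_functor R Q)) : Prop :=
  forall (G : functor (localization W) (localization W'))
         (gam : nat_trans (comp_functor Q' F) (comp_functor G Q)),
    (exists t : nat_trans R G,
       forall X : C, heq (comp (t (Q X)) (eta X)) (gam X)) /\
    (forall t t' : nat_trans R G,
       (forall X : C, heq (comp (t (Q X)) (eta X)) (gam X)) ->
       (forall X : C, heq (comp (t' (Q X)) (eta X)) (gam X)) ->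
       forall X, heq (t X) (t' X)).

End DerivedFunctors.

Section DGModCategory.
Variable A : dgring.

Definition dghom_eq (M N : dgmod A) (f g : dghom M N) : Prop :=
  forall n x, f n x = g n x.

Lemma dghom_eq_equiv M N : Equivalence (@dghom_eq M N).
Proof.
split=> [f n x|f g fg n x|f g h fg gh n x] //.
by rewrite fg.
Qed.

Definition dghom_id (M : dgmod A) : dghom M M :=
  @DGHom A M M (fun _ x => x) (fun _ _ _ => erefl) (fun _ _ _ _ => erefl)
    (fun _ _ _ _ _ _ => erefl).

Section Comp.
Variables (M N P : dgmod A) (g : dghom N P) (f : dghom M N).

Lemma dghom_comp_subproof1 n : zmod_morphism (fun x => g n (f n x)).
Proof. by move=> x y; rewrite !dgh_funB. Qed.

Lemma dghom_comp_subproof2 i j (e : i + 1 = j) m :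
  g j (f j (diff e m)) = diff e (g i (f i m)).
Proof. by rewrite !dgh_fund. Qed.

Lemma dghom_comp_subproof3 i j k (e : i + j = k) a m :
  g k (f k (dgact e a m)) = dgact e a (g j (f j m)).
Proof. by rewrite !dgh_funZ. Qed.

Definition dghom_comp : dghom M P :=
  DGHom dghom_comp_subproof1 dghom_comp_subproof2 dghom_comp_subproof3.
End Comp.

Lemma dghom_comp_eq M N P (g g' : dghom N P) (f f' : dghom M N) :
  dghom_eq g g' -> dghom_eq f f' ->
  dghom_eq (dghom_comp g f) (dghom_comp g' f').
Proof. by move=> gg ff n x /=; rewrite ff gg. Qed.

Definition DGMod_cat : category :=
  @Category (dgmod A) (@dghom A) dghom_eq dghom_id dghom_comp dghom_eq_equiv
    dghom_comp_eq (fun _ _ _ _ _ _ _ _ _ => erefl) (fun _ _ _ _ _ => erefl)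
    (fun _ _ _ _ _ => erefl).

Definition derived_cat : category :=
  @localization DGMod_cat (@quasi_iso A).

End DGModCategory.

(* The DG-tensor product B (x)_A M along a DG-ring map f : A -> B. Its degree n
   part is the free abelian group on the symbols b (x) m, with b in B^i, m in
   M^j and i + j = n, modulo biadditivity and b f(a) (x) m = b (x) a m. *)

Section Generated.
Variables (V : zmodType) (S : V -> Prop).

Definition generated : pred V :=
  fun x => `[< forall P : V -> Prop, P 0 -> (forall y z, P y -> P z -> P (y - z)) ->
               (forall y, S y -> P y) -> P x >].

Lemma generated_closed : zmod_closed generated.
Proof.
split=> [|x y]; rewrite !unfold_in; first by apply/asboolP.
move=> /asboolP hx /asboolP hy; apply/asboolP => P P0 PB PS.
exact: (PB _ _ (hx P P0 PB PS) (hy P P0 PB PS)).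
Qed.

HB.instance Definition _ := GRing.isZmodClosed.Build V generated generated_closed.

End Generated.

Section Tensor.
Variables (A B : dgring) (f : dgring_hom A B) (M : dgmod A).

Record tsymb (n : int) := TSymb {
  ts_i : int; ts_j : int; ts_e : ts_i + ts_j = n;
  ts_b : B ts_i; ts_m : M ts_j
}.

HB.instance Definition _ n := gen_eqMixin (tsymb n).
HB.instance Definition _ n := gen_choiceMixin (tsymb n).

Definition tfree (n i j : int) (e : i + j = n) (b : B i) (m : M j) :
  {freeg (tsymb n)} := [freeg [:: (1, TSymb e b m)]].

Inductive trel (n : int) : {freeg (tsymb n)} -> Prop :=
| TRelBl i j (e : i + j = n) b b' m :
    trel (tfree e (b - b') m - (tfree e b m - tfree e b' m))
| TRelBr i j (e : i + j = n) b m m' :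
    trel (tfree e b (m - m') - (tfree e b m - tfree e b m'))
| TRelBal i j k ij jk (e1 : i + j = ij) (e2 : ij + k = n)
    (e3 : j + k = jk) (e4 : i + jk = n) (b : B i) (a : A j) (m : M k) :
    trel (tfree e2 (dgmul e1 b (f j a)) m - tfree e4 b (dgact e3 a m)).

Definition tensor (n : int) : zmodType :=
  Quotient.quot (GRing.ZmodClosed.clone {freeg (tsymb n)} (generated (@trel n)) _).

Definition tens (n i j : int) (e : i + j = n) (b : B i) (m : M j) : tensor n :=
  \pi_(tensor n) (tfree e b m).

Lemma tens_rel n (x y : {freeg (tsymb n)}) : trel (x - y) ->
  \pi_(tensor n) x = \pi y.
Proof.
move=> h; apply/eqP; rewrite -Quotient.idealrBE unfold_in.
by apply/asboolP => P _ _; apply.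
Qed.

Lemma tensBl n i j (e : i + j = n) m : zmod_morphism (fun b => tens e b m).
Proof. by move=> b b'; rewrite /tens -raddfB; apply: tens_rel; apply: TRelBl. Qed.

Lemma tensBr n i j (e : i + j = n) b : zmod_morphism (fun m => tens e b m).
Proof. by move=> m m'; rewrite /tens -raddfB; apply: tens_rel; apply: TRelBr. Qed.

Lemma tens_bal n i j k ij jk (e1 : i + j = ij) (e2 : ij + k = n)
    (e3 : j + k = jk) (e4 : i + jk = n) (b : B i) (a : A j) (m : M k) :
  tens e2 (dgmul e1 b (f j a)) m = tens e4 b (dgact e3 a m).
Proof. by apply: tens_rel; apply: TRelBal. Qed.

Lemma tensor_ind n (P : tensor n -> Prop) :
  P 0 -> (forall x y, P x -> P y -> P (x - y)) ->
  (forall (i j : int) (e : i + j = n) b m, P (tens e b m)) -> forall x, P x.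
Proof.
move=> P0 PB Pt x; rewrite -[x]reprK.
have PN y : P y -> P (- y) by rewrite -[- y]sub0r; apply: PB.
have PD y z : P y -> P z -> P (y + z).
  by move=> Py Pz; rewrite -[z]opprK; apply: PB => //; apply: PN.
have PZ y (k : int) : P y -> P (y *~ k).
  move=> Py; have PM l : P (y *+ l).
    by elim: l => [|l IH]; rewrite ?mulr0n // mulrS; apply: PD.
  by case: k => k; rewrite ?NegzE ?mulrNz -pmulrn //; apply: PN.
rewrite -(freeg_sumE (repr x)) raddf_sum /=.
apply: (big_ind P) => // -[i j e b m] _.
rewrite -[coeff _ _]intz -freegU_mulz raddfMz.
by apply: PZ; apply: (Pt _ _ e b m).
Qed.

Definition balanced n (V : zmodType)
    (g : forall i j : int, i + j = n -> B i -> M j -> V) : Prop :=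
  [/\ forall i j e m, zmod_morphism (fun b => g i j e b m),
      forall i j e b, zmod_morphism (g i j e b) &
      forall (i j k ij jk : int) (e1 : i + j = ij) (e2 : ij + k = n)
        (e3 : j + k = jk) (e4 : i + jk = n) (b : B i) (a : A j) (m : M k),
        g _ _ e2 (dgmul e1 b (f j a)) m = g _ _ e4 b (dgact e3 a m)].

Definition tlift_free n (V : zmodType)
    (g : forall i j : int, i + j = n -> B i -> M j -> V) (x : {freeg (tsymb n)}) : V :=
  fglift (fun s => g _ _ (ts_e s) (ts_b s) (ts_m s) : zmodule V) x.

Lemma tlift_freeB n (V : zmodType) g : zmod_morphism (@tlift_free n V g).
Proof.
move=> x y.
exact: (@lift_is_additive _ _ (zmodule V)
  (fun s => g _ _ (ts_e s) (ts_b s) (ts_m s)) x y).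
Qed.

Lemma tlift_freeE n (V : zmodType) g i j (e : i + j = n) b m :
  @tlift_free n V g (tfree e b m) = g i j e b m.
Proof. by rewrite /tlift_free /tfree liftU scale1r. Qed.

Definition tlift n (V : zmodType)
    (g : forall i j : int, i + j = n -> B i -> M j -> V) (x : tensor n) : V :=
  tlift_free g (repr x).

Lemma tlift_pi n (V : zmodType) g (x : {freeg (tsymb n)}) :
  @balanced n V g -> tlift g (\pi x) = tlift_free g x.
Proof.
case=> gl gr gb; rewrite /tlift.
have GB := @tlift_freeB n V g.
apply/eqP; rewrite -subr_eq0 -GB; apply/eqP.
have : generated (@trel n) (repr (\pi_(tensor n) x) - x).
  have : \pi_(tensor n) (repr (\pi_(tensor n) x)) = \pi x by rewrite reprK.
  by move=> /eqP; rewrite -Quotient.idealrBE.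
move=> /asboolP /(_ (fun y => tlift_free g y = 0)).
apply=> [|y z hy hz|y]; first exact: zmod_morph0 GB.
  by rewrite GB hy hz subr0.
case=> [i j e b b' m|i j e b m m'|i j k ij jk e1 e2 e3 e4 b a m];
  rewrite !GB !tlift_freeE.
- by rewrite gl subrr.
- by rewrite gr subrr.
- by rewrite (gb _ _ _ _ _ e1 e2 e3 e4) subrr.
Qed.

Lemma tliftE n (V : zmodType) g : @balanced n V g ->
  forall i j e b m, tlift g (@tens n i j e b m) = g i j e b m.
Proof. by move=> gbal *; rewrite /tens tlift_pi // tlift_freeE. Qed.

Lemma tliftB n (V : zmodType) g : @balanced n V g -> zmod_morphism (tlift g).
Proof.
move=> gbal x y; rewrite -[x]reprK -[y]reprK -raddfB !tlift_pi //.
exact: tlift_freeB.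
Qed.

(* The differential is d(b (x) m) = db (x) m + (-1)^|b| b (x) dm. *)

Lemma addSz_eq (i j n n' : int) : i + j = n -> n + 1 = n' -> (i + 1) + j = n'.
Proof. by move=> <- <-; rewrite addrAC. Qed.

Lemma addzS_eq (i j n n' : int) : i + j = n -> n + 1 = n' -> i + (j + 1) = n'.
Proof. by move=> <- <-; rewrite addrA. Qed.

Definition tdiff_fun n n' (en : n + 1 = n') i j (e : i + j = n) (b : B i)
    (m : M j) : tensor n' :=
  tens (addSz_eq e en) (diff erefl b) m
  + sgn i (tens (addzS_eq e en) b (diff erefl m)).

Definition tdiff n n' (en : n + 1 = n') : tensor n -> tensor n' :=
  tlift (tdiff_fun en).

Lemma tdiff_funE n n' (en : n + 1 = n') i j i' j' (e : i + j = n)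
    (ei : i + 1 = i') (ej : j + 1 = j') (el : i' + j = n') (er : i + j' = n') b m :
  tdiff_fun en e b m = tens el (diff ei b) m + sgn i (tens er b (diff ej m)).
Proof.
move: el er; case: _ / ei; case: _ / ej => el er; rewrite /tdiff_fun.
by rewrite (eq_irrelevance (addSz_eq e en) el)
  (eq_irrelevance (addzS_eq e en) er).
Qed.

Lemma tdiff_balanced n n' (en : n + 1 = n') : balanced (tdiff_fun en).
Proof.
split=> [i j e m x y|i j e b x y|i j k ij jk e1 e2 e3 e4 b a m].
- by rewrite /tdiff_fun diffB !tensBl raddfB opprD addrACA.
- by rewrite /tdiff_fun diffB !tensBr raddfB opprD addrACA.
have e1r : i + (j + 1) = ij + 1 by rewrite addrA e1.
have e3l : (j + 1) + k = jk + 1 by rewrite addrAC e3.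
have e3r : j + (k + 1) = jk + 1 by rewrite addrA e3.
have e1l : (i + 1) + j = ij + 1 by rewrite addrAC e1.
have u1 : (ij + 1) + k = n' by rewrite addrAC e2.
have u2 : ij + (k + 1) = n' by rewrite addrA e2.
have u3 : (i + 1) + jk = n' by rewrite addrAC e4.
have u4 : i + (jk + 1) = n' by rewrite addrA e4.
rewrite (tdiff_funE _ _ (erefl _) (erefl _) u1 u2).
rewrite (tdiff_funE _ _ (erefl _) (erefl _) u3 u4).
rewrite (dgleibniz e1 (erefl _) (erefl _) (erefl _) e1l e1r).
rewrite (dgact_leibniz e3 (erefl _) (erefl _) (erefl _) e3l e3r).
rewrite (zmod_morphD (tensBl _ _)) (zmod_morphD (tensBr _ _)) -dgr_fund.
rewrite (sgn_morph (tensBl _ _)) (sgn_morph (tensBr _ _)).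
rewrite (tens_bal e1l u1 e3 u3) (tens_bal e1r u1 e3l u4).
by rewrite (tens_bal e1 u2 e3r u4) raddfD -addrA -e1 sgnD.
Qed.

Lemma tdiffB n n' (en : n + 1 = n') : zmod_morphism (tdiff en).
Proof. exact: tliftB (tdiff_balanced en). Qed.

Lemma tdiffE n n' (en : n + 1 = n') i j i' j' (e : i + j = n)
    (ei : i + 1 = i') (ej : j + 1 = j') (el : i' + j = n') (er : i + j' = n') b m :
  tdiff en (tens e b m) = tens el (diff ei b) m + sgn i (tens er b (diff ej m)).
Proof. by rewrite /tdiff (tliftE (tdiff_balanced en)); apply: tdiff_funE. Qed.

Lemma tdiffK n n' n'' (e : n + 1 = n') (e' : n' + 1 = n'') x :
  tdiff e' (tdiff e x) = 0.
Proof.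
apply: (@tensor_ind n (fun x => tdiff e' (tdiff e x) = 0))
  => [|x' y hx hy|i j ij b m].
- by rewrite !(zmod_morph0 (tdiffB _)).
- by rewrite !tdiffB hx hy subrr.
have u1 : (i + 1) + j = n' by rewrite addrAC ij.
have u2 : i + (j + 1) = n' by rewrite addrA ij.
have v1 : (i + 1 + 1) + j = n'' by rewrite addrAC u1.
have v2 : (i + 1) + (j + 1) = n'' by rewrite addrA u1.
have v3 : i + (j + 1 + 1) = n'' by rewrite addrA u2.
rewrite (tdiffE e _ (erefl _) (erefl _) u1 u2) (zmod_morphD (tdiffB _)).
rewrite (sgn_morph (tdiffB _)).
rewrite (tdiffE e' _ (erefl _) (erefl _) v1 v2).
rewrite (tdiffE e' _ (erefl _) (erefl _) v2 v3) !diffK.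
rewrite (zmod_morph0 (tensBl _ _)) (zmod_morph0 (tensBr _ _)) raddf0.
by rewrite add0r addr0 sgnS addNr.
Qed.

Definition tensor_complex : complex := Complex tdiffB tdiffK.

(* B acts by b' (b (x) m) = (b' b) (x) m. *)

Lemma addA_eq (p i j q k : int) : i + j = q -> p + q = k -> (p + i) + j = k.
Proof. by move=> <- <-; rewrite addrA. Qed.

Definition tact_fun p q k (e : p + q = k) (c : B p) i j (e' : i + j = q)
    (b : B i) (m : M j) : tensor k :=
  tens (addA_eq e' e) (dgmul erefl c b) m.

Definition tact p q k (e : p + q = k) (c : B p) : tensor q -> tensor k :=
  tlift (tact_fun e c).

Lemma tact_funE p q k (e : p + q = k) c i j (e' : i + j = q) pi
    (e1 : p + i = pi) (e2 : pi + j = k) b m :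
  tact_fun e c e' b m = tens e2 (dgmul e1 c b) m.
Proof.
move: e2; case: _ / e1 => e2; rewrite /tact_fun.
by rewrite (eq_irrelevance (addA_eq e' e) e2).
Qed.

Lemma tact_balanced p q k (e : p + q = k) (c : B p) : balanced (tact_fun e c).
Proof.
split=> [i j e' m x y|i j e' b x y|i j l ij jl e1 e2 e3 e4 b a m].
- by rewrite /tact_fun dgmulBr tensBl.
- by rewrite /tact_fun tensBr.
have u1 : (p + i) + j = p + ij by rewrite -addrA e1.
have u2 : (p + ij) + l = k by rewrite -addrA e2.
have u3 : (p + i) + jl = k by rewrite -addrA e4.
rewrite (tact_funE _ _ _ (erefl _) u2) (tact_funE _ _ _ (erefl _) u3).
rewrite -(dgmulA (erefl (p + i)) u1 e1 (erefl _)).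
exact: tens_bal.
Qed.

Lemma tactBr p q k (e : p + q = k) (c : B p) : zmod_morphism (tact e c).
Proof. exact: tliftB (tact_balanced e c). Qed.

Lemma tactE p q k (e : p + q = k) c i j (e' : i + j = q) pi
    (e1 : p + i = pi) (e2 : pi + j = k) b m :
  tact e c (tens e' b m) = tens e2 (dgmul e1 c b) m.
Proof. by rewrite /tact (tliftE (tact_balanced e c)); apply: tact_funE. Qed.

Lemma tactBl p q k (e : p + q = k) x : zmod_morphism (fun c => tact e c x).
Proof.
move=> c c'; apply: (@tensor_ind q (fun x => tact e (c - c') x =
  tact e c x - tact e c' x)) => [|y z hy hz|i j e' b m].
- by rewrite !(zmod_morph0 (tactBr _ _)) subr0.
- by rewrite !tactBr hy hz !opprD addrACA.
have u : (p + i) + j = k by rewrite -addrA e'.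
by rewrite !(tactE _ _ _ (erefl _) u) dgmulBl tensBl.
Qed.

Lemma tactA i j k ij jk ijk (e1 : i + j = ij) (e2 : ij + k = ijk)
    (e3 : j + k = jk) (e4 : i + jk = ijk) a b x :
  tact e2 (dgmul e1 a b) x = tact e4 a (tact e3 b x).
Proof.
apply: (@tensor_ind k (fun x => tact e2 (dgmul e1 a b) x =
  tact e4 a (tact e3 b x))) => [|y z hy hz|p q e' c m].
- by rewrite !(zmod_morph0 (tactBr _ _)).
- by rewrite !tactBr hy hz.
have u1 : (ij + p) + q = ijk by rewrite -addrA e'.
have u2 : (j + p) + q = jk by rewrite -addrA e'.
have u3 : i + (j + p) = ij + p by rewrite addrA e1.
rewrite (tactE _ _ _ (erefl _) u1) (tactE _ _ _ (erefl _) u2).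
by rewrite (tactE _ _ _ u3 u1) (dgmulA e1 (erefl _) (erefl _) u3).
Qed.

Lemma tact1 i (e : 0 + i = i) x : tact e (dgone B) x = x.
Proof.
apply: (@tensor_ind i (fun x => tact e (dgone B) x = x)) => [|y z hy hz|p q e' b m].
- by rewrite (zmod_morph0 (tactBr _ _)).
- by rewrite tactBr hy hz.
by rewrite (tactE _ _ _ (add0r p) e') dgmul1l.
Qed.

Lemma tact_leibniz i j k i' j' k' (e : i + j = k)
    (ei : i + 1 = i') (ej : j + 1 = j') (ek : k + 1 = k')
    (el : i' + j = k') (er : i + j' = k') a x :
  tdiff ek (tact e a x) =
    tact el (diff ei a) x + sgn i (tact er a (tdiff ej x)).
Proof.
apply: (@tensor_ind j (fun x => tdiff ek (tact e a x) =
    tact el (diff ei a) x + sgn i (tact er a (tdiff ej x))))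
  => [|y z hy hz|p q e' b m].
- by rewrite !(zmod_morph0 (tactBr _ _), zmod_morph0 (tdiffB _)) raddf0 addr0.
- by rewrite !(tactBr, tdiffB) hy hz raddfB opprD addrACA.
have u1 : (i + p) + q = k by rewrite -addrA e'.
have u2 : (i + p + 1) + q = k' by rewrite addrAC u1.
have u3 : (i + p) + (q + 1) = k' by rewrite addrA u1.
have u4 : i' + p = i + p + 1 by rewrite -ei addrAC.
have u5 : i + (p + 1) = i + p + 1 by rewrite addrA.
have u6 : (p + 1) + q = j' by rewrite addrAC e'.
have u7 : p + (q + 1) = j' by rewrite addrA e'.
rewrite (tactE _ _ _ (erefl _) u1) (tdiffE _ _ (erefl _) (erefl _) u2 u3).
rewrite (tactE _ _ _ u4 u2) (tdiffE _ _ (erefl _) (erefl _) u6 u7).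
rewrite (zmod_morphD (tactBr _ _)) (sgn_morph (tactBr _ _)).
rewrite (tactE _ _ _ u5 u2) (tactE _ _ _ (erefl _) u3).
rewrite (dgleibniz (erefl _) ei (erefl _) (erefl _) u4 u5).
by rewrite (zmod_morphD (tensBl _ _)) (sgn_morph (tensBl _ _)) raddfD sgnD addrA.
Qed.

Definition tensor_dgmod : dgmod B :=
  @DGMod B tensor_complex tact tactBl tactBr tactA tact1 tact_leibniz.

End Tensor.

Section TensorFunctor.
Variables (A B : dgring) (f : dgring_hom A B).

Section Map.
Variables (M N : dgmod A) (g : dghom M N).

Definition tensor_map_fun n i j (e : i + j = n) (b : B i) (m : M j) :
  tensor f N n := tens f e b (g j m).

Definition tensor_map n : tensor f M n -> tensor f N n :=
  tlift (@tensor_map_fun n).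

Lemma tensor_map_balanced n : balanced f (@tensor_map_fun n).
Proof.
split=> [i j e m x y|i j e b x y|i j k ij jk e1 e2 e3 e4 b a m];
  rewrite /tensor_map_fun.
- exact: tensBl.
- by rewrite dgh_funB tensBr.
- by rewrite (tens_bal f e1 e2 e3 e4) dgh_funZ.
Qed.

Lemma tensor_mapB n : zmod_morphism (@tensor_map n).
Proof. exact: tliftB (@tensor_map_balanced n). Qed.

Lemma tensor_mapE n i j (e : i + j = n) (b : B i) (m : M j) :
  tensor_map (tens f e b m) = tens f e b (g j m).
Proof. exact: (tliftE (@tensor_map_balanced n)). Qed.

Lemma tensor_mapd i j (e : i + 1 = j) x :
  tensor_map (tdiff e x) = tdiff e (tensor_map x).
Proof.
apply: (@tensor_ind _ _ f M i (fun x => tensor_map (tdiff e x) =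
  tdiff e (tensor_map x))) => [|y z hy hz|p q e' b m].
- by rewrite !(zmod_morph0 (@tensor_mapB _), zmod_morph0 (tdiffB _)).
- by rewrite !(tensor_mapB, tdiffB) hy hz.
have u1 : (p + 1) + q = j by rewrite addrAC e'.
have u2 : p + (q + 1) = j by rewrite addrA e'.
rewrite (tdiffE f e _ (erefl _) (erefl _) u1 u2) (zmod_morphD (@tensor_mapB _)).
rewrite (sgn_morph (@tensor_mapB _)) !tensor_mapE dgh_fund.
by rewrite (tdiffE f e _ (erefl _) (erefl _) u1 u2).
Qed.

Lemma tensor_mapZ i j k (e : i + j = k) (c : B i) x :
  tensor_map (tact e c x) = tact e c (tensor_map x).
Proof.
apply: (@tensor_ind _ _ f M j (fun x => tensor_map (tact e c x) =
  tact e c (tensor_map x))) => [|y z hy hz|p q e' b m].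
- by rewrite !(zmod_morph0 (@tensor_mapB _), zmod_morph0 (tactBr _ _)).
- by rewrite !(tensor_mapB, tactBr) hy hz.
have u : (i + p) + q = k by rewrite -addrA e'.
by rewrite (tactE f _ _ _ (erefl _) u) !tensor_mapE (tactE f _ _ _ (erefl _) u).
Qed.

Definition tensor_dghom : dghom (tensor_dgmod f M) (tensor_dgmod f N) :=
  @DGHom B (tensor_dgmod f M) (tensor_dgmod f N) tensor_map tensor_mapB
    tensor_mapd tensor_mapZ.

End Map.

Lemma tensor_map_ext M N (g h : dghom M N) (n : int) (x : tensor f M n) :
  dghom_eq g h -> tensor_map g x = tensor_map h x.
Proof.
move=> gh; apply: (@tensor_ind _ _ f M n (fun x => tensor_map g x = tensor_map h x))
  => [|y z hy hz|p q e b m].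
- by rewrite !(zmod_morph0 (@tensor_mapB _ _ _ _)).
- by rewrite !tensor_mapB hy hz.
- by rewrite !tensor_mapE gh.
Qed.

Lemma tensor_map_id M (n : int) (x : tensor f M n) : tensor_map (dghom_id M) x = x.
Proof.
apply: (@tensor_ind _ _ f M n (fun x => tensor_map (dghom_id M) x = x))
  => [|y z hy hz|p q e b m].
- by rewrite !(zmod_morph0 (@tensor_mapB _ _ _ _)).
- by rewrite !tensor_mapB hy hz.
- by rewrite !tensor_mapE.
Qed.

Lemma tensor_map_comp M N P (h : dghom N P) (g : dghom M N) (n : int)
    (x : tensor f M n) :
  tensor_map (dghom_comp h g) x = tensor_map h (tensor_map g x).
Proof.
apply: (@tensor_ind _ _ f M n (fun x => tensor_map (dghom_comp h g) x =
  tensor_map h (tensor_map g x))) => [|y z hy hz|p q e b m].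
- by rewrite !(zmod_morph0 (@tensor_mapB _ _ _ _)).
- by rewrite !tensor_mapB hy hz.
- by rewrite !tensor_mapE.
Qed.

Definition tensor_functor : functor (DGMod_cat A) (DGMod_cat B) :=
  @Functor (DGMod_cat A) (DGMod_cat B) (tensor_dgmod f)
    (fun M N g => tensor_dghom g)
    (fun M N g h gh n x => tensor_map_ext x gh)
    (fun M n x => tensor_map_id x)
    (fun M N P h g n x => tensor_map_comp h g x).

End TensorFunctor.

(* The DG-module Hom_A(B, M) along a DG-ring map f : A -> B. A homogeneous
   element of degree n is a family of additive maps B^i -> M^(i+n) with
   phi(f(a) b) = (-1)^(n|a|) a phi(b). *)

Section Coinduction.
Variables (A B : dgring) (f : dgring_hom A B) (M : dgmod A).

Record chom (n : int) := CHom {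
  chom_fun :> forall i j : int, i + n = j -> B i -> M j;
  chom_funB : forall (i j : int) (e : i + n = j), zmod_morphism (chom_fun e);
  chom_funZ : forall (i j k l m : int) (e1 : i + j = k) (e2 : k + n = l)
    (e3 : j + n = m) (e4 : i + m = l) (a : A i) (b : B j),
    chom_fun e2 (dgmul e1 (f i a) b) = sgn (n * i) (dgact e4 a (chom_fun e3 b))
}.
Arguments chom_fun {n} c {i j} e b.

Lemma chom_ext n (x y : chom n) :
  (forall i j e b, @chom_fun n x i j e b = chom_fun y e b) -> x = y.
Proof.
case: x y => [x xB xZ] [y yB yZ] /= xy.
have exy : x = y.
  do 4 (apply: functional_extensionality_dep => ?); exact: xy.
subst y; congr CHom; exact: Prop_irrelevance.
Qed.

HB.instance Definition _ n := gen_eqMixin (chom n).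
HB.instance Definition _ n := gen_choiceMixin (chom n).

Section Zmod.
Variable n : int.

Lemma chom_zeroB i j (e : i + n = j) : zmod_morphism (fun _ : B i => 0 : M j).
Proof. by move=> x y; rewrite subr0. Qed.

Lemma chom_zeroZ (i j k l m : int) (e1 : i + j = k) (e2 : k + n = l)
    (e3 : j + n = m) (e4 : i + m = l) (a : A i) (b : B j) :
  0 = sgn (n * i) (dgact e4 a (0 : M m)).
Proof. by rewrite (zmod_morph0 (dgactBr _ _)) raddf0. Qed.

Definition chom_zero : chom n :=
  @CHom n (fun _ _ _ _ => 0) chom_zeroB chom_zeroZ.

Lemma chom_addB (x y : chom n) i j (e : i + n = j) :
  zmod_morphism (fun b => chom_fun x e b + chom_fun y e b).
Proof. by move=> b c; rewrite !chom_funB opprD addrACA. Qed.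

Lemma chom_addZ (x y : chom n) (i j k l m : int) (e1 : i + j = k) (e2 : k + n = l)
    (e3 : j + n = m) (e4 : i + m = l) (a : A i) (b : B j) :
  chom_fun x e2 (dgmul e1 (f i a) b) + chom_fun y e2 (dgmul e1 (f i a) b) =
  sgn (n * i) (dgact e4 a (chom_fun x e3 b + chom_fun y e3 b)).
Proof.
by rewrite (zmod_morphD (dgactBr _ _)) raddfD !(chom_funZ _ e1 e2 e3 e4).
Qed.

Definition chom_add (x y : chom n) : chom n :=
  CHom (chom_addB x y) (chom_addZ x y).

Lemma chom_oppB (x : chom n) i j (e : i + n = j) :
  zmod_morphism (fun b => - chom_fun x e b).
Proof. by move=> b c; rewrite !chom_funB opprD. Qed.

Lemma chom_oppZ (x : chom n) (i j k l m : int) (e1 : i + j = k) (e2 : k + n = l)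
    (e3 : j + n = m) (e4 : i + m = l) (a : A i) (b : B j) :
  - chom_fun x e2 (dgmul e1 (f i a) b) =
  sgn (n * i) (dgact e4 a (- chom_fun x e3 b)).
Proof.
by rewrite (zmod_morphN (dgactBr _ _)) raddfN !(chom_funZ _ e1 e2 e3 e4).
Qed.

Definition chom_opp (x : chom n) : chom n := CHom (chom_oppB x) (chom_oppZ x).

Lemma chom_addA : associative chom_add.
Proof. by move=> x y z; apply: chom_ext => i j e b /=; rewrite addrA. Qed.

Lemma chom_addC : commutative chom_add.
Proof. by move=> x y; apply: chom_ext => i j e b /=; rewrite addrC. Qed.

Lemma chom_add0 : left_id chom_zero chom_add.
Proof. by move=> x; apply: chom_ext => i j e b /=; rewrite add0r. Qed.

Lemma chom_addN : left_inverse chom_zero chom_opp chom_add.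
Proof. by move=> x; apply: chom_ext => i j e b /=; rewrite addNr. Qed.

HB.instance Definition _ :=
  GRing.isZmodule.Build (chom n) chom_addA chom_addC chom_add0 chom_addN.

End Zmod.

Lemma chom_subE n (x y : chom n) i j (e : i + n = j) b :
  chom_fun (x - y) e b = chom_fun x e b - chom_fun y e b.
Proof. by []. Qed.

Lemma chom_addE n (x y : chom n) i j (e : i + n = j) b :
  chom_fun (x + y) e b = chom_fun x e b + chom_fun y e b.
Proof. by []. Qed.

Lemma chom_sgnE n s (x : chom n) i j (e : i + n = j) b :
  chom_fun (sgn s x) e b = sgn s (chom_fun x e b).
Proof.
have h : zmod_morphism (fun y : chom n => chom_fun y e b) by [].
exact: (sgn_morph h).
Qed.

(* The differential is (d phi)(b) = d(phi(b)) - (-1)^|phi| phi(db). *)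

Lemma chom_eq1 (n n' i j : int) : n + 1 = n' -> i + n' = j -> (i + n) + 1 = j.
Proof. by move=> <- <-; rewrite addrA. Qed.

Lemma chom_eq2 (n n' i j : int) : n + 1 = n' -> i + n' = j -> (i + 1) + n = j.
Proof. by move=> <- <-; rewrite addrAC addrA. Qed.

Section Diff.
Variables (n n' : int) (en : n + 1 = n') (phi : chom n).

Definition cdiff_fun (i j : int) (e : i + n' = j) (b : B i) : M j :=
  diff (chom_eq1 en e) (chom_fun phi erefl b)
  - sgn n (chom_fun phi (chom_eq2 en e) (diff erefl b)).

Lemma cdiff_funE i j k l (e : i + n' = j) (e1 : i + n = k) (e2 : k + 1 = j)
    (e3 : i + 1 = l) (e4 : l + n = j) b :
  cdiff_fun e b =
    diff e2 (chom_fun phi e1 b) - sgn n (chom_fun phi e4 (diff e3 b)).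
Proof.
move: e2 e4; case: _ / e1; case: _ / e3 => e2 e4.
by rewrite /cdiff_fun (eq_irrelevance (chom_eq1 en e) e2)
  (eq_irrelevance (chom_eq2 en e) e4).
Qed.

Lemma cdiff_funB i j (e : i + n' = j) : zmod_morphism (cdiff_fun e).
Proof.
by move=> x y; rewrite /cdiff_fun !(chom_funB, diffB) raddfB !opprD addrACA.
Qed.

Lemma cdiff_funZ (i j k l m : int) (e1 : i + j = k) (e2 : k + n' = l)
    (e3 : j + n' = m) (e4 : i + m = l) (a : A i) (b : B j) :
  cdiff_fun e2 (dgmul e1 (f i a) b) =
  sgn (n' * i) (dgact e4 a (cdiff_fun e3 b)).
Proof.
have u1 : (k + n) + 1 = l by rewrite -addrA en.
have u2 : (k + 1) + n = l by rewrite addrAC u1.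
have u3 : (j + n) + 1 = m by rewrite -addrA en.
have u4 : (j + 1) + n = m by rewrite addrAC u3.
have u5 : i + (j + n) = k + n by rewrite addrA e1.
have u6 : (i + 1) + (j + n) = l by rewrite addrAC u5.
have u7 : (i + 1) + j = k + 1 by rewrite addrAC e1.
have u8 : i + (j + 1) = k + 1 by rewrite addrA e1.
rewrite (cdiff_funE _ (erefl _) u1 (erefl _) u2).
rewrite (cdiff_funE _ (erefl _) u3 (erefl _) u4).
rewrite (chom_funZ phi e1 (erefl _) (erefl _) u5) (sgn_morph (diffB _)).
rewrite (dgact_leibniz u5 (erefl _) u3 u1 u6 e4).
rewrite (dgleibniz e1 (erefl _) (erefl _) (erefl _) u7 u8) -dgr_fund.
rewrite (zmod_morphD (chom_funB phi _)) (sgn_morph (chom_funB phi _)).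
rewrite (chom_funZ phi u7 u2 (erefl _) u6) (chom_funZ phi u8 u2 u4 e4).
rewrite dgactBr (sgn_morph (dgactBr _ _)) !raddfD !raddfN /= -!sgnD.
rewrite -en.
rewrite [sgn (n + n * (i + 1)) _](@sgn_parity _ n _ (n * i)); last by ring.
rewrite [X in _ = X - _](@sgn_parity _ 0 _ (n * i + i)); last by ring.
rewrite [X in _ = _ - X](@sgn_parity _ 0 _ (n + i + n * i)); last by ring.
by rewrite addrACA subrr add0r.
Qed.

Definition cdiff : chom n' := CHom cdiff_funB cdiff_funZ.

End Diff.

Lemma cdiffE n n' (en : n + 1 = n') (x : chom n) i j k l (e : i + n' = j)
    (e1 : i + n = k) (e2 : k + 1 = j) (e3 : i + 1 = l) (e4 : l + n = j) b :
  chom_fun (cdiff en x) e b =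
    diff e2 (chom_fun x e1 b) - sgn n (chom_fun x e4 (diff e3 b)).
Proof. exact: cdiff_funE. Qed.

Lemma cdiffB n n' (en : n + 1 = n') : zmod_morphism (cdiff en).
Proof.
move=> x y; apply: chom_ext => i j e b; rewrite chom_subE /= /cdiff_fun.
by rewrite !chom_subE diffB raddfB !opprD addrACA.
Qed.

Lemma cdiffK n n' n'' (e : n + 1 = n') (e' : n' + 1 = n'') x :
  cdiff e' (cdiff e x) = 0.
Proof.
apply: chom_ext => i j u b.
have v1 : (i + n') + 1 = j by rewrite -addrA e'.
have v2 : (i + 1) + n' = j by rewrite addrAC.
have v3 : (i + n) + 1 = i + n' by rewrite -addrA e.
have v4 : (i + 1) + n = i + n' by rewrite addrAC.
have v5 : (i + 1 + 1) + n = j by rewrite addrAC v4.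
rewrite (cdiffE e' _ _ (erefl _) v1 (erefl _) v2).
rewrite (cdiffE e _ _ (erefl _) v3 (erefl _) v4).
rewrite (cdiffE e _ _ v4 v1 (erefl _) v5) diffB !diffK.
rewrite (zmod_morph0 (chom_funB _ _)) raddf0 subr0 sub0r (sgn_morph (diffB _)).
have s (y : M j) : sgn n' y = - sgn n y by rewrite -e sgnS.
by rewrite s opprK addNr.
Qed.

Definition coind_complex : complex :=
  @Complex (fun n => chom n : zmodType) cdiff cdiffB cdiffK.

(* B acts through right multiplication on itself:
   (c phi)(b) = (-1)^(|c| (|phi| + |b|)) phi(b c). *)

Lemma chom_eq3 (p n k i j : int) : p + n = k -> i + k = j -> (i + p) + n = j.
Proof. by move=> <- <-; rewrite addrA. Qed.

Section Act.
Variables (p n k : int) (ek : p + n = k) (c : B p) (phi : chom n).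

Definition cact_fun (i j : int) (e : i + k = j) (b : B i) : M j :=
  sgn (p * (n + i)) (chom_fun phi (chom_eq3 ek e) (dgmul erefl b c)).

Lemma cact_funE i j l (e : i + k = j) (e1 : i + p = l) (e2 : l + n = j) b :
  cact_fun e b = sgn (p * (n + i)) (chom_fun phi e2 (dgmul e1 b c)).
Proof.
move: e2; case: _ / e1 => e2.
by rewrite /cact_fun (eq_irrelevance (chom_eq3 ek e) e2).
Qed.

Lemma cact_funB i j (e : i + k = j) : zmod_morphism (cact_fun e).
Proof. by move=> x y; rewrite /cact_fun dgmulBl chom_funB raddfB. Qed.

Lemma cact_funZ (i j r l m : int) (e1 : i + j = r) (e2 : r + k = l)
    (e3 : j + k = m) (e4 : i + m = l) (a : A i) (b : B j) :
  cact_fun e2 (dgmul e1 (f i a) b) = sgn (k * i) (dgact e4 a (cact_fun e3 b)).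
Proof.
have u1 : (r + p) + n = l by rewrite -addrA ek.
have u2 : (j + p) + n = m by rewrite -addrA ek.
have u3 : i + (j + p) = r + p by rewrite addrA e1.
rewrite (cact_funE _ (erefl _) u1) (cact_funE _ (erefl _) u2).
rewrite (dgmulA e1 (erefl _) (erefl _) u3) (chom_funZ phi u3 u1 u2 e4).
rewrite (sgn_morph (dgactBr _ _)) -!sgnD -e1 -ek.
by apply: (@sgn_parity _ 0); ring.
Qed.

Definition cact : chom k := CHom cact_funB cact_funZ.

End Act.

Lemma cactE p n k (ek : p + n = k) c (x : chom n) i j l (e : i + k = j)
    (e1 : i + p = l) (e2 : l + n = j) b :
  chom_fun (cact ek c x) e b =
  sgn (p * (n + i)) (chom_fun x e2 (dgmul e1 b c)).
Proof. exact: cact_funE. Qed.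

Lemma cactBl p n k (ek : p + n = k) x : zmod_morphism (fun c => cact ek c x).
Proof.
move=> c c'; apply: chom_ext => i j e b; rewrite chom_subE /= /cact_fun.
by rewrite dgmulBr chom_funB raddfB.
Qed.

Lemma cactBr p n k (ek : p + n = k) c : zmod_morphism (cact ek c).
Proof.
move=> x y; apply: chom_ext => i j e b; rewrite chom_subE /= /cact_fun.
by rewrite chom_subE raddfB.
Qed.

Lemma cactA (i j k ij jk ijk : int) (e1 : i + j = ij) (e2 : ij + k = ijk)
    (e3 : j + k = jk) (e4 : i + jk = ijk) a b x :
  cact e2 (dgmul e1 a b) x = cact e4 a (cact e3 b x).
Proof.
apply: chom_ext => p q e c.
have u1 : (p + ij) + k = q by rewrite -addrA e2.
have u2 : (p + i) + jk = q by rewrite -addrA e4.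
have u3 : (p + i) + j = p + ij by rewrite -addrA e1.
rewrite (cactE e2 _ _ _ (erefl _) u1) (cactE e4 _ _ _ (erefl _) u2).
rewrite (cactE e3 _ _ _ u3 u1) (dgmulA (erefl _) u3 e1 (erefl _)) -sgnD.
by apply: (@sgn_parity _ (- (i * j))); rewrite -e1 -e3; ring.
Qed.

Lemma cact1 i (e : 0 + i = i) x : cact e (dgone B) x = x.
Proof.
apply: chom_ext => p q u b.
by rewrite (cactE e _ _ _ (addr0 p) u) dgmul1r mul0r sgn0.
Qed.

Lemma cact_leibniz (i j k i' j' k' : int) (e : i + j = k)
    (ei : i + 1 = i') (ej : j + 1 = j') (ek : k + 1 = k')
    (el : i' + j = k') (er : i + j' = k') a x :
  cdiff ek (cact e a x) =
    cact el (diff ei a) x + sgn i (cact er a (cdiff ej x)).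
Proof.
apply: chom_ext => p q u b; rewrite chom_addE chom_sgnE.
have v1 : (p + k) + 1 = q by rewrite -addrA ek.
have v2 : (p + 1) + k = q by rewrite addrAC.
have v3 : (p + i) + j = p + k by rewrite -addrA e.
have v4 : (p + 1 + i) + j = q by rewrite -addrA e.
have v5 : (p + i') + j = q by rewrite -addrA el.
have v6 : (p + i) + j' = q by rewrite -addrA er.
have v7 : (p + i) + 1 = p + 1 + i by rewrite addrAC.
have v8 : p + i' = p + 1 + i by rewrite -ei addrA addrAC.
rewrite (cdiffE ek _ _ (erefl _) v1 (erefl _) v2).
rewrite (cactE e _ _ _ (erefl _) v3) (cactE e _ _ _ (erefl _) v4).
rewrite (cactE el _ _ _ v8 v4) (cactE er _ _ _ (erefl _) v6).
rewrite (cdiffE ej _ _ v3 v1 v7 v4).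
rewrite (dgleibniz (erefl _) (erefl _) ei v7 (erefl _) v8).
rewrite (zmod_morphD (chom_funB x _)) (sgn_morph (chom_funB x _)).
rewrite (sgn_morph (diffB _)) !raddfD !raddfN /= -!sgnD.
set X := diff _ _; set Y := chom_fun x v4 (dgmul erefl _ a).
set Z := chom_fun x v4 (dgmul v8 b _).
have h1 : sgn (k + i * (j + (p + 1))) Y = sgn (j + i * (j + p)) Y.
  by apply: (@sgn_parity _ i); rewrite -e; ring.
have h2 : sgn (i + i * (j' + p)) X = sgn (i * (j + p)) X.
  by apply: (@sgn_parity _ i); rewrite -ej; ring.
have h3 : sgn (i + i * (j' + p) + j) Y = sgn (j + i * (j + p)) Y.
  by apply: (@sgn_parity _ i); rewrite -ej; ring.
have h4 : sgn (i + i * (j' + p) + j + p) Z = sgn (i' * (j + p)) Z.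
  by apply: (@sgn_parity _ i); rewrite -ej -ei; ring.
by rewrite h1 h2 h3 h4 [RHS]addrC -[RHS]addrA subrK.
Qed.

Definition coind_dgmod : dgmod B :=
  @DGMod B coind_complex cact cactBl cactBr cactA cact1 cact_leibniz.

End Coinduction.

Section CoinductionFunctor.
Variables (A B : dgring) (f : dgring_hom A B).

Section Map.
Variables (M N : dgmod A) (g : dghom M N).

Section Fun.
Variables (n : int) (x : chom f M n).

Lemma coind_map_funB (i j : int) (e : i + n = j) :
  zmod_morphism (fun b => g j (chom_fun x e b)).
Proof. by move=> b c; rewrite chom_funB dgh_funB. Qed.

Lemma coind_map_funZ (i j k l m : int) (e1 : i + j = k) (e2 : k + n = l)
    (e3 : j + n = m) (e4 : i + m = l) (a : A i) (b : B j) :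
  g l (chom_fun x e2 (dgmul e1 (f i a) b)) =
  sgn (n * i) (dgact e4 a (g m (chom_fun x e3 b))).
Proof.
by rewrite (chom_funZ x e1 e2 e3 e4) (sgn_morph (dgh_funB g (n := _))) dgh_funZ.
Qed.

Definition coind_map : chom f N n := CHom coind_map_funB coind_map_funZ.
End Fun.

Lemma coind_mapB n : zmod_morphism (@coind_map n).
Proof.
by move=> x y; apply: chom_ext => i j e b; rewrite chom_subE /= -dgh_funB.
Qed.

Lemma coind_mapd (i j : int) (e : i + 1 = j) x :
  coind_map (cdiff e x) = cdiff e (coind_map x).
Proof.
apply: chom_ext => p q u b /=; rewrite /cdiff_fun dgh_funB dgh_fund.
by rewrite (sgn_morph (dgh_funB g (n := _))).
Qed.

Lemma coind_mapZ (i j k : int) (e : i + j = k) (c : B i) x :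
  coind_map (cact e c x) = cact e c (coind_map x).
Proof.
apply: chom_ext => p q u b /=; rewrite /cact_fun.
by rewrite (sgn_morph (dgh_funB g (n := _))).
Qed.

Definition coind_dghom : dghom (coind_dgmod f M) (coind_dgmod f N) :=
  @DGHom B (coind_dgmod f M) (coind_dgmod f N) coind_map coind_mapB
    coind_mapd coind_mapZ.

End Map.

Lemma coind_map_ext M N (g h : dghom M N) (n : int) (x : chom f M n) :
  dghom_eq g h -> coind_map g x = coind_map h x.
Proof. by move=> gh; apply: chom_ext => i j e b /=; rewrite gh. Qed.

Lemma coind_map_id M (n : int) (x : chom f M n) : coind_map (dghom_id M) x = x.
Proof. exact: chom_ext. Qed.

Lemma coind_map_comp M N P (h : dghom N P) (g : dghom M N) (n : int)
    (x : chom f M n) :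
  coind_map (dghom_comp h g) x = coind_map h (coind_map g x).
Proof. exact: chom_ext. Qed.

Definition coind_functor : functor (DGMod_cat A) (DGMod_cat B) :=
  @Functor (DGMod_cat A) (DGMod_cat B) (coind_dgmod f)
    (fun M N g => coind_dghom g)
    (fun M N g h gh n x => coind_map_ext x gh)
    (fun M n x => coind_map_id x)
    (fun M N P h g n x => coind_map_comp h g x).

End CoinductionFunctor.

(* Derived functors are unique up to unique isomorphism, so these predicates
   determine H^0(A) (x)^L_A - and RHom_A(H^0(A), -) up to isomorphism. *)

Definition is_reduction_functor (A : dgring)
    (L : functor (derived_cat A) (derived_cat (H0_dgring A))) : Prop :=
  exists eps, is_left_derived (F := tensor_functor (H0_proj A)) (L := L) eps.

Definition is_coreduction_functor (A : dgring)
    (R : functor (derived_cat A) (derived_cat (H0_dgring A))) : Prop :=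
  exists eta, is_right_derived (F := coind_functor (H0_proj A)) (R := R) eta.

(* Main.v *)
(* Take A = Z[t] with |t| = -2 and zero differential, so that H^0(A) = Z has the
   Koszul resolution K = (A e -> A), d e = t.  Hence both derived functors send M
   to the cone of t on M, up to a shift, and both kill Z[t,1/t], on which t is
   invertible.

   That M |-> K (x)_A M computes the left derived functor follows once every M
   has a functorial resolution on which t is injective, for then
   K (x)_A M -> H^0(A) (x)_A M is a quasi-isomorphism; dually, Hom_A(K, M)
   computes the right derived functor if every M has a functorial coresolution
   on which t is surjective.  These are B (x)_A M and Hom_A(B, M) for the
   A-bimodule resolution B = Z[t,u,e], d e = t - u, of A: as a DG-module over
   Z[u], B is contractible onto A, and multiplication by t on B has a
   Z[u]-linear left inverse. *)

From Stdlib Require Import RelationClasses Morphisms Setoid.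
From HB Require Import structures.
From mathcomp Require Import all_boot all_order all_algebra.
From mathcomp Require Import boolp generic_quotient ring_quotient.
From mathcomp Require Import ring zify.
Require Import Defs.

Set Implicit Arguments.
Unset Strict Implicit.
Unset Printing Implicit Defensive.

Import GRing.Theory Num.Theory.
Local Open Scope ring_scope.
Local Open Scope quotient_scope.

(** * Derived functors from functorial resolutions *)

(* In a commutative DG-ring an odd generator squares to zero, while a nonzero module on which t is
   invertible needs t to be non-nilpotent: hence the even degree -2, and hence cohomology in
   infinitely many degrees. Evenness also removes the signs from the action of t.

   The derived functors are known through their universal property, so no K-projective or
   K-injective objects are constructed: a functor preserving quasi-isomorphisms, a comparison map
   with the given functor, and natural resolutions on which that map is a quasi-isomorphism suffice.
   The Koszul model is a priori a DG-module over A only; it becomes one over H^0(A) by restriction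
   along the section Z -> Z[t] of the augmentation, and the comparison maps are H^0(A)-linear for
   this structure.

   Homogeneous elements are encoded by setting one variable to 1, which loses nothing once the
   degree is fixed. So all pieces of a DG-ring lie in one ring, and products need no transport
   between degrees. *)
#[local] Existing Instance heq_equiv.

#[local] Instance comp_proper (C : category) (X Y Z : C) :
  Proper (@heq C Y Z ==> @heq C X Y ==> @heq C X Z) (@comp C X Y Z).
Proof. by move=> g g' gg f f' ff; apply: comp_heq. Qed.

#[local] Instance fmap_proper (C D : category) (F : functor C D) (X Y : C) :
  Proper (@heq C X Y ==> @heq D (F X) (F Y)) (@fmap C D F X Y).
Proof. by move=> f g; apply: fmap_heq. Qed.

#[local] Hint Extern 0 (heq _ _) => reflexivity : core.

Lemma fmap_iso (C D : category) (F : functor C D) (X Y : C) (f : hom X Y) :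
  is_iso f -> is_iso (fmap F f).
Proof.
case=> g [gf fg]; exists (fmap F g).
by split; rewrite -fmap_comp ?gf ?fg fmap1.
Qed.

Lemma is_iso_epi (C : category) (X Y Z : C) (f : hom X Y) (g g' : hom Y Z) :
  is_iso f -> heq (comp g f) (comp g' f) -> heq g g'.
Proof.
case=> h [_ fh] gg; rewrite -(comp1r g) -(comp1r g') -fh !compA.
by rewrite gg.
Qed.

Lemma is_iso_mono (C : category) (X Y Z : C) (f : hom Y Z) (g g' : hom X Y) :
  is_iso f -> heq (comp f g) (comp f g') -> heq g g'.
Proof.
case=> h [hf _] gg; rewrite -(comp1l g) -(comp1l g') -hf -!compA.
by rewrite gg.
Qed.

Section LocalizationFunctors.
Variables (C : category) (W : forall X Y : C, hom X Y -> Prop).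

Lemma loc_functor_iso (X Y : C) (w : hom X Y) :
  W w -> is_iso (fmap (loc_functor W) w).
Proof.
move=> Ww; exists (ZBwd (ZNil W Y) Ww).
by split; [exact: ZFwdBwd | exact: ZBwdFwd].
Qed.

(** On a backward edge the formal inverse [v] of [w] can be moved across the naturality square of
    [w]. Hence a transformation on the localization may be checked on the morphisms of [C] alone. *)
Lemma loc_natural (E : category) (G H : functor (localization W) E)
    (t : forall X : C, hom (G X) (H X)) :
  (forall (X Y : C) (f : hom X Y),
     heq (comp (t Y) (fmap G (fmap (loc_functor W) f)))
         (comp (fmap H (fmap (loc_functor W) f)) (t X))) ->
  forall (X Y : localization W) (s : hom X Y),
    heq (comp (t Y) (fmap G s)) (comp (fmap H s) (t X)).
Proof.
move=> nt X Y; elim=> /= [|Y1 Z s IH f|Y1 Z s IH w Ww].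
- by rewrite (fmap1 G (X : localization W)) (fmap1 H (X : localization W)) comp1l comp1r.
- rewrite (fmap_comp G (fmap (loc_functor W) f) s).
  by rewrite (fmap_comp H (fmap (loc_functor W) f) s) compA nt -compA IH compA.
pose v : hom (Y1 : localization W) Z := ZBwd (ZNil W Y1) Ww.
have wv : heq (comp (fmap (loc_functor W) w) v) (idm (Y1 : localization W)).
  exact: ZBwdFwd.
have vw : heq (comp v (fmap (loc_functor W) w)) (idm (Z : localization W)).
  exact: ZFwdBwd.
rewrite (fmap_comp G v s) (fmap_comp H v s) -(compA (fmap H v)) -IH !compA.
apply: comp_heq; last by reflexivity.
rewrite -(comp1l (t Z)) -(fmap1 H (Z : localization W)) -vw fmap_comp -!compA.
apply: comp_heq; first by reflexivity.
rewrite compA -nt -compA -fmap_comp wv fmap1; exact: comp1r.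
Qed.

End LocalizationFunctors.

Section LocalizationLift.
Variables (C D : category) (F : functor C D).
Variables (W : forall X Y : C, hom X Y -> Prop).
Variables (W' : forall X Y : D, hom X Y -> Prop).
Hypothesis FW : forall (X Y : C) (w : hom X Y), W w -> W' (fmap F w).

Fixpoint zmap (X Y : C) (s : zigzag W X Y) : zigzag W' (F X) (F Y) :=
  match s with
  | ZNil => ZNil W' (F X)
  | ZFwd _ _ s f => ZFwd (zmap s) (fmap F f)
  | ZBwd _ _ s _ Ww => ZBwd (zmap s) (FW Ww)
  end.

Lemma zmap_zeq (X Y : C) (s t : zigzag W X Y) : zeq s t -> zeq (zmap s) (zmap t).
Proof.
elim=> /= {Y s t}.
- by move=> *; apply: ZRefl.
- by move=> *; apply: ZSym.
- by move=> Y s t u _ st _ tu; apply: ZTrans st tu.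
- by move=> Y Z s t f g _ st fg; apply: ZFwdCong => //; apply: fmap_heq.
- by move=> *; apply: ZBwdCong.
- move=> Y s; apply: ZTrans (ZId (zmap s)).
  by apply: ZFwdCong (ZRefl _) (fmap1 F Y).
- move=> Y Z T s f g; apply: ZTrans (ZComp _ _ _) _.
  by apply: ZFwdCong (ZRefl _) _; symmetry; apply: fmap_comp.
- by move=> *; apply: ZBwdFwd.
- by move=> *; apply: ZFwdBwd.
Qed.

Lemma zmap_cat (X Y Z : C) (s : zigzag W X Y) (t : zigzag W Y Z) :
  zmap (zcat s t) = zcat (zmap s) (zmap t).
Proof. by elim: t => //= [? ? ? -> ?|? ? ? -> *]. Qed.

Lemma zmap_comp (X Y Z : C) (t : zigzag W Y Z) (s : zigzag W X Y) :
  zeq (zmap (zcat s t)) (zcat (zmap s) (zmap t)).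
Proof. by rewrite zmap_cat; apply: ZRefl. Qed.

Definition loc_lift : functor (localization W) (localization W') :=
  @Functor (localization W) (localization W') (fun X => F X) zmap zmap_zeq
    (fun X => ZRefl _) zmap_comp.

Lemma loc_lift_not_conservative (X Y : C) (f : hom X Y) :
  W' (fmap F f) -> ~ is_iso (fmap (loc_functor W) f) -> ~ conservative loc_lift.
Proof.
move=> Wf nf cons; apply: nf; apply: (cons X Y).
exact: loc_functor_iso Wf.
Qed.

End LocalizationLift.

Section DerivedExistence.
Variables (C D : category) (F F' : functor C D).
Variables (W : forall X Y : C, hom X Y -> Prop).
Variables (W' : forall X Y : D, hom X Y -> Prop).
Hypothesis F'W : forall (X Y : C) (w : hom X Y), W w -> W' (fmap F' w).
Variables (P : C -> C) (Pmap : forall X Y : C, hom X Y -> hom (P X) (P Y)).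

Local Notation Q := (loc_functor W).
Local Notation Q' := (loc_functor W').

Section Left.
Variable e : nat_trans F' F.
Variable p : forall X : C, hom (P X) X.
Hypothesis p_nat : forall (X Y : C) (f : hom X Y),
  heq (comp (p Y) (Pmap f)) (comp f (p X)).
Hypothesis Wp : forall X, W (p X).
Hypothesis We : forall X, W' (e (P X)).

Lemma left_counit_nat (X Y : C) (f : hom X Y) :
  heq (comp (fmap Q' (e Y)) (fmap (comp_functor (loc_lift F'W) Q) f))
      (comp (fmap (comp_functor Q' F) f) (fmap Q' (e X))).
Proof.
change (heq (comp (fmap Q' (e Y)) (fmap Q' (fmap F' f)))
            (comp (fmap Q' (fmap F f)) (fmap Q' (e X)))).
by rewrite -!fmap_comp (ntc_nat e).
Qed.

Definition left_counit :
    nat_trans (comp_functor (loc_lift F'W) Q) (comp_functor Q' F) :=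
  @NatTrans _ _ (comp_functor (loc_lift F'W) Q) (comp_functor Q' F)
    (fun X => fmap Q' (e X)) left_counit_nat.

Lemma left_derived_of_resolution : is_left_derived left_counit.
Proof.
move=> G gam; set L := loc_lift F'W.
have pP X : is_iso (fmap Q (p X)) := loc_functor_iso (Wp X).
have eP X : is_iso (fmap Q' (e (P X))) := loc_functor_iso (We X).
have nat_e (X Y : C) (f : hom X Y) :
    heq (comp (fmap Q' (e Y)) (fmap L (fmap Q f)))
        (comp (fmap Q' (fmap F f)) (fmap Q' (e X))) by exact: left_counit_nat.
have nat_gam (X Y : C) (f : hom X Y) :
    heq (comp (gam Y) (fmap G (fmap Q f)))
        (comp (fmap Q' (fmap F f)) (gam X)) by exact: (ntc_nat gam).
have nat_Qp (X Y : C) (f : hom X Y) :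
    heq (comp (fmap Q (p Y)) (fmap Q (Pmap f)))
        (comp (fmap Q f) (fmap Q (p X))).
  by rewrite -!fmap_comp p_nat.
have GP X : is_iso (fmap G (fmap Q (p X))) by exact: fmap_iso.
pose q X := sval (cid (GP X)).
have [qp pq] : (forall X, heq (comp (q X) (fmap G (fmap Q (p X)))) (idm _)) /\
               (forall X, heq (comp (fmap G (fmap Q (p X))) (q X)) (idm _)).
  by split=> X; case: (svalP (cid (GP X))).
pose ei X := sval (cid (eP X)).
have [eie eei] : (forall X, heq (comp (ei X) (fmap Q' (e (P X)))) (idm _)) /\
                 (forall X, heq (comp (fmap Q' (e (P X))) (ei X)) (idm _)).
  by split=> X; case: (svalP (cid (eP X))).
split; last first.
  (* Naturality along [p X] reduces the equality to the object [P X], where the counit is invertible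
     and [ht], [ht'] determine the value. *)
  move=> t t' ht ht' X.
  apply: (is_iso_epi (GP X)).
  rewrite (ntc_nat t) (ntc_nat t').
  apply: comp_heq => //; apply: (is_iso_mono (eP X)).
  by rewrite (ht (P X)) (ht' (P X)).
(* The value forced by the uniqueness argument: go to [P X], invert the counit there, and come back
   along [p X]. *)
pose t (X : C) : hom (G X) (L X) :=
  comp (fmap L (fmap Q (p X))) (comp (ei X) (comp (gam (P X)) (q X))).
have nat_t (X Y : C) (f : hom X Y) :
    heq (comp (t Y) (fmap G (fmap Q f))) (comp (fmap L (fmap Q f)) (t X)).
  apply: (is_iso_epi (GP X)); rewrite /t -!compA qp comp1r.
  rewrite -fmap_comp -nat_Qp fmap_comp (compA (q Y)) qp comp1l nat_gam.
  rewrite [in X in heq _ X]compA -[in X in heq _ X]fmap_comp -nat_Qp.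
  rewrite [in X in heq _ X]fmap_comp -!compA; apply: comp_heq => //.
  apply: (is_iso_mono (eP Y)); rewrite !compA eei comp1l nat_e.
  by rewrite -(compA _ _ (ei X)) eei comp1r.
exists (@NatTrans _ _ G L t (loc_natural nat_t)) => X /=.
change (heq (comp (fmap Q' (e X)) (t X)) (gam X)).
rewrite /t !compA nat_e -(compA _ _ (ei X)) eei comp1r -nat_gam.
by rewrite -compA pq comp1r.
Qed.

End Left.

Section Right.
Variable e : nat_trans F F'.
Variable p : forall X : C, hom X (P X).
Hypothesis p_nat : forall (X Y : C) (f : hom X Y),
  heq (comp (p Y) f) (comp (Pmap f) (p X)).
Hypothesis Wp : forall X, W (p X).
Hypothesis We : forall X, W' (e (P X)).

Lemma right_unit_nat (X Y : C) (f : hom X Y) :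
  heq (comp (fmap Q' (e Y)) (fmap (comp_functor Q' F) f))
      (comp (fmap (comp_functor (loc_lift F'W) Q) f) (fmap Q' (e X))).
Proof.
change (heq (comp (fmap Q' (e Y)) (fmap Q' (fmap F f)))
            (comp (fmap Q' (fmap F' f)) (fmap Q' (e X)))).
by rewrite -!fmap_comp (ntc_nat e).
Qed.

Definition right_unit :
    nat_trans (comp_functor Q' F) (comp_functor (loc_lift F'W) Q) :=
  @NatTrans _ _ (comp_functor Q' F) (comp_functor (loc_lift F'W) Q)
    (fun X => fmap Q' (e X)) right_unit_nat.

Lemma right_derived_of_resolution : is_right_derived right_unit.
Proof.
move=> G gam; set R := loc_lift F'W.
have pP X : is_iso (fmap Q (p X)) := loc_functor_iso (Wp X).
have eP X : is_iso (fmap Q' (e (P X))) := loc_functor_iso (We X).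
have nat_e (X Y : C) (f : hom X Y) :
    heq (comp (fmap Q' (e Y)) (fmap Q' (fmap F f)))
        (comp (fmap R (fmap Q f)) (fmap Q' (e X))) by exact: right_unit_nat.
have nat_gam (X Y : C) (f : hom X Y) :
    heq (comp (gam Y) (fmap Q' (fmap F f)))
        (comp (fmap G (fmap Q f)) (gam X)) by exact: (ntc_nat gam).
have nat_Qp (X Y : C) (f : hom X Y) :
    heq (comp (fmap Q (p Y)) (fmap Q f))
        (comp (fmap Q (Pmap f)) (fmap Q (p X))).
  by rewrite -!fmap_comp p_nat.
have GP X : is_iso (fmap G (fmap Q (p X))) by exact: fmap_iso.
pose q X := sval (cid (GP X)).
have [qp pq] : (forall X, heq (comp (q X) (fmap G (fmap Q (p X)))) (idm _)) /\
               (forall X, heq (comp (fmap G (fmap Q (p X))) (q X)) (idm _)).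
  by split=> X; case: (svalP (cid (GP X))).
pose ei X := sval (cid (eP X)).
have [eie eei] : (forall X, heq (comp (ei X) (fmap Q' (e (P X)))) (idm _)) /\
                 (forall X, heq (comp (fmap Q' (e (P X))) (ei X)) (idm _)).
  by split=> X; case: (svalP (cid (eP X))).
split; last first.
  move=> t t' ht ht' X.
  apply: (is_iso_mono (GP X)).
  rewrite -(ntc_nat t) -(ntc_nat t').
  apply: comp_heq => //; apply: (is_iso_epi (eP X)).
  by rewrite (ht (P X)) (ht' (P X)).
pose t (X : C) : hom (R X) (G X) :=
  comp (q X) (comp (gam (P X)) (comp (ei X) (fmap R (fmap Q (p X))))).
have nat_t (X Y : C) (f : hom X Y) :
    heq (comp (t Y) (fmap R (fmap Q f))) (comp (fmap G (fmap Q f)) (t X)).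
  apply: (is_iso_mono (GP Y)); rewrite /t !compA pq comp1l.
  rewrite -[in X in heq _ X]fmap_comp nat_Qp [in X in heq _ X]fmap_comp.
  rewrite -(compA _ _ (q X)) pq comp1r -nat_gam.
  rewrite -(compA _ _ (fmap R (fmap Q f))) -fmap_comp nat_Qp fmap_comp.
  rewrite !compA; apply: comp_heq => //; rewrite -!compA; apply: comp_heq => //.
  apply: (is_iso_epi (eP X)); rewrite -!compA eie comp1r -nat_e.
  by rewrite compA eie comp1l.
exists (@NatTrans _ _ R G t (loc_natural nat_t)) => X /=.
change (heq (comp (t X) (fmap Q' (e X))) (gam X)).
rewrite /t -!compA -nat_e (compA (ei X)) eie comp1l nat_gam.
by rewrite compA qp comp1l.
Qed.

End Right.
End DerivedExistence.

(** * Quasi-isomorphisms *)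

(** Quantifying over the target degree lets closedness be used along any proof of [n + 1 = j], where
    [is_cocycle] fixes the target [n + 1]. *)
Definition closed (M : complex) (n : int) (x : M n) : Prop :=
  forall j (e : n + 1 = j), diff e x = 0.

Lemma closedP (M : complex) n (x : M n) : reflect (closed x) (is_cocycle x).
Proof. by apply: (iffP eqP) => [dx j e|]; [case: _ / e | exact]. Qed.

Lemma closed_at (M : complex) n (x : M n) j (e : n + 1 = j) :
  diff e x = 0 -> closed x.
Proof. by case: _ / e => dx k e'; case: _ / e'. Qed.

Lemma coboundary_at (M : complex) i n (e : i + 1 = n) (x : M n) :
  (exists (j : int) (e' : j + 1 = n) (y : M j), diff e' y = x) ->
  exists y : M i, diff e y = x.
Proof.
case=> j [e' [y <-]]; have ij : i = j by apply: (addIr 1); rewrite e e'.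
by subst j; exists y; rewrite (eq_irrelevance e' e).
Qed.

Section QuasiIso.
Variables (A : dgring) (M N : dgmod A) (f : dghom M N).

(** With the converses [quasi_iso_inj] and [quasi_iso_surj], this turns the later comparisons into
    chases on representatives, free of cohomology classes. *)
Lemma quasi_iso_intro :
  (forall i n (e : i + 1 = n) (x : M n) (y : N i), closed x -> diff e y = f n x ->
     exists z : M i, diff e z = x) ->
  (forall i n (e : i + 1 = n) (y : N n), closed y ->
     exists (x : M n) (z : N i), closed x /\ y = f n x + diff e z) ->
  quasi_iso f.
Proof.
move=> inj surj n.
have HB : zmod_morphism (@cohomology_map A M N f n).
  move=> x y; have [x' ->] := coh_class_surj x; have [y' ->] := coh_class_surj y.
  rewrite -coh_classB !cohomology_mapE -coh_classB; congr coh_class.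
  by apply: val_inj; rewrite /= dgh_funB.
have Hinj : injective (@cohomology_map A M N f n).
  move=> h1 h2 /eqP; rewrite -subr_eq0 -HB => /eqP.
  move=> hh; apply/eqP; rewrite -subr_eq0; apply/eqP.
  move: (h1 - h2) hh => h; have [x ->] := coh_class_surj h; rewrite cohomology_mapE.
  rewrite -[RHS](zmod_morph0 (@coh_classB N n)) => /coh_class_eq [i [e [a da]]].
  rewrite -(zmod_morph0 (@coh_classB M n)); apply/coh_class_eq.
  have [| |z dz] := inj i n e (cocycle_val x) a; last 1 first.
  - by exists i, e, z; rewrite dz subr0.
  - by apply/closedP; case: x {da}.
  - by rewrite da subr0.
have Hsurj (y : cohomology N n) : exists x, cohomology_map f x = y.
  have [[y' cy] ->] := coh_class_surj y.
  have [x [z [cx yx]]] := surj (n - 1) n (subrK _ _) y' (elimT (closedP _) cy).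
  exists (coh_class (Cocycle (introT (closedP x) cx))); rewrite cohomology_mapE.
  apply/coh_class_eq; exists (n - 1), (subrK _ _), (- z).
  by rewrite (zmod_morphN (diffB _)) /= yx opprD addrA subrr sub0r.
exists (fun y => sval (cid (Hsurj y))) => [x|y]; last exact: svalP (cid (Hsurj y)).
by apply: Hinj; apply: svalP (cid (Hsurj _)).
Qed.

Lemma quasi_iso_inj : quasi_iso f ->
  forall i n (e : i + 1 = n) (x : M n) (y : N i), closed x -> diff e y = f n x ->
     exists z : M i, diff e z = x.
Proof.
move=> qf i n e x y cx dy; have /bij_inj Hinj := qf n.
pose c : cocycle M n := Cocycle (introT (closedP x) cx).
have : coh_class c = coh_class (0 : cocycle M n).
  apply: Hinj; rewrite !cohomology_mapE; apply/coh_class_eq; exists i, e, y.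
  by rewrite dy /= (zmod_morph0 (dgh_funB f (n := _))) subr0.
move=> /coh_class_eq; rewrite subr0 => h.
exact: coboundary_at h.
Qed.

Lemma quasi_iso_surj : quasi_iso f ->
  forall i n (e : i + 1 = n) (y : N n), closed y ->
     exists (x : M n) (z : N i), closed x /\ y = f n x + diff e z.
Proof.
move=> qf i n e y cy; have [g _ gK] := qf n.
have [[x cx] gx] := coh_class_surj (g (coh_class (Cocycle (introT (closedP y) cy)))).
have := gK (coh_class (Cocycle (introT (closedP y) cy))).
rewrite gx cohomology_mapE => /coh_class_eq /(coboundary_at e) [z dz].
exists x, (- z); split; first exact/closedP.
by rewrite (zmod_morphN (diffB _)) dz /= opprB addrC subrK.
Qed.

End QuasiIso.

(** * Cohomology as an invariant of morphisms in the derived category *)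

Section ZigzagCohomology.
Variables (A : dgring) (n : int).
Local Notation zz := (@zigzag (DGMod_cat A) (@quasi_iso A)).

Lemma quasi_iso_preimage (M N : dgmod A) (w : dghom M N) (h : cohomology N n) :
  quasi_iso w -> exists h', cohomology_map w h' = h.
Proof. by move=> /(_ n) [g _ gK]; exists (g h). Qed.

(** A backward edge acts by the inverse of the bijection that [w] induces on cohomology, obtained by
    choosing preimages. *)
Fixpoint zigzag_coh (M N : dgmod A) (s : zz M N) : cohomology M n -> cohomology N n :=
  match s with
  | ZNil => id
  | ZFwd _ _ s f => fun h => cohomology_map f (zigzag_coh s h)
  | ZBwd _ _ s w Ww => fun h => sval (cid (quasi_iso_preimage (zigzag_coh s h) Ww))
  end.

Lemma zigzag_coh_zeq (M N : dgmod A) (s t : zz M N) :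
  zeq s t -> zigzag_coh s =1 zigzag_coh t.
Proof.
have hE (X Y : dgmod A) (f g : dghom X Y) : dghom_eq f g ->
    @cohomology_map A X Y f n =1 @cohomology_map A X Y g n.
  move=> fg h; have [z ->] := coh_class_surj h; rewrite !cohomology_mapE.
  by congr coh_class; apply: val_inj => /=; apply: fg.
elim=> /= {N s t}.
- by [].
- by move=> Y s t _ st h.
- by move=> Y s t u _ st _ tu h; rewrite st tu.
- by move=> Y Z s t f g _ st fg h; rewrite st; apply: hE.
- move=> Y Z s t w Ww Ww' _ st h.
  case: cid => x /= hx; case: cid => y /= hy.
  by apply: (bij_inj (Ww n)); rewrite hx hy st.
- move=> Y s h; have [z ->] := coh_class_surj (zigzag_coh s h).
  by rewrite cohomology_mapE; congr coh_class; apply: val_inj.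
- move=> Y Z T s f g h; have [z ->] := coh_class_surj (zigzag_coh s h).
  by rewrite !cohomology_mapE; congr coh_class; apply: val_inj.
- by move=> Y Z s w Ww h; case: cid.
- by move=> Y Z s w Ww h; case: cid => x /= hx; apply: (bij_inj (Ww n)).
Qed.

Lemma zigzag_coh_cat (M N P : dgmod A) (s : zz M N) (t : zz N P) :
  zigzag_coh (zcat s t) =1 zigzag_coh t \o zigzag_coh s.
Proof.
move=> h; elim: t => //= [Y Z t IH f|Y Z t IH w Ww]; first by rewrite IH.
by case: cid => x /= hx; case: cid => y /= hy; apply: (bij_inj (Ww n)); rewrite hx hy.
Qed.

(** An inverse [g] would factor the identity of the cohomology of [N] in degree [n] through that of
    [M], which is a single point. *)
Lemma not_iso_from_acyclic (M N : dgmod A) (f : dghom M N) :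
  (forall h h' : cohomology M n, h = h') -> (exists h : cohomology N n, h != 0) ->
  ~ is_iso (@fmap _ _ (@loc_functor (DGMod_cat A) (@quasi_iso A)) M N f).
Proof.
move=> M0 [h /eqP h0] [g [_ fg]]; apply: h0.
have /= E h' : cohomology_map f (zigzag_coh g h') = h'.
  by have := zigzag_coh_zeq fg h'; rewrite (zigzag_coh_cat g).
by rewrite -(E h) -(E 0); congr cohomology_map; apply: M0.
Qed.

End ZigzagCohomology.

(** * The DG-ring Z[t] *)

Section GradedSubring.
Variables (T : pzRingType) (S : int -> zmodClosed T) (d : {additive T -> T}).

(** The subgroups [S i] may overlap in [T]: the degree belongs to the type, not to the element. So
    one element of [T] can stand for homogeneous elements of many degrees. *)
Record gpiece (i : int) := GPiece { gval :> T; _ : gval \in S i }.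

HB.instance Definition _ i := [isSub for @gval i].
HB.instance Definition _ i := [Choice of gpiece i by <:].
HB.instance Definition _ i := [SubChoice_isSubZmodule of gpiece i by <:].

Lemma gpieceP i (x : gpiece i) : gval x \in S i. Proof. by case: x. Qed.

Hypothesis S1 : 1 \in S 0.
Hypothesis SM : forall i j x y, x \in S i -> y \in S j -> x * y \in S (i + j).
Hypothesis Sd : forall i x, x \in S i -> d x \in S (i + 1).
Hypothesis dd : forall x, d (d x) = 0.
Hypothesis dM : forall i x y, x \in S i -> d (x * y) = d x * y + sgn i (x * d y).
Hypothesis S_nonpos : forall i x, 0 < i -> x \in S i -> x = 0.

Lemma gdiff_subproof i j (e : i + 1 = j) (x : gpiece i) : d (gval x) \in S j.
Proof. by rewrite -e Sd ?gpieceP. Qed.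

Definition gdiff i j (e : i + 1 = j) (x : gpiece i) : gpiece j :=
  GPiece (gdiff_subproof e x).

Lemma gdiffB i j (e : i + 1 = j) : zmod_morphism (gdiff e).
Proof. by move=> x y; apply: val_inj; rewrite /= !raddfB. Qed.

Lemma gdiffK i j k (e : i + 1 = j) (e' : j + 1 = k) x : gdiff e' (gdiff e x) = 0.
Proof. by apply: val_inj; rewrite /= dd. Qed.

Definition gcomplex : complex :=
  @Complex (fun i => gpiece i : zmodType) gdiff gdiffB gdiffK.

Lemma gmul_subproof i j k (e : i + j = k) (x : gpiece i) (y : gpiece j) :
  gval x * gval y \in S k.
Proof. by rewrite -e SM ?gpieceP. Qed.

Definition gmul i j k (e : i + j = k) (x : gpiece i) (y : gpiece j) : gpiece k :=
  GPiece (gmul_subproof e x y).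

Lemma gmulBl i j k (e : i + j = k) y : zmod_morphism (fun x => gmul e x y).
Proof. by move=> x x'; apply: val_inj; rewrite /= mulrBl. Qed.

Lemma gmulBr i j k (e : i + j = k) x : zmod_morphism (fun y => gmul e x y).
Proof. by move=> y y'; apply: val_inj; rewrite /= mulrBr. Qed.

Lemma gmulA i j k ij jk ijk (e1 : i + j = ij) (e2 : ij + k = ijk)
    (e3 : j + k = jk) (e4 : i + jk = ijk) x y z :
  gmul e2 (gmul e1 x y) z = gmul e4 x (gmul e3 y z).
Proof. by apply: val_inj; rewrite /= mulrA. Qed.

Lemma gmul1l i (e : 0 + i = i) x : gmul e (GPiece S1) x = x.
Proof. by apply: val_inj; rewrite /= mul1r. Qed.

Lemma gmul1r i (e : i + 0 = i) x : gmul e x (GPiece S1) = x.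
Proof. by apply: val_inj; rewrite /= mulr1. Qed.

Lemma gval_sgn i k (x : gpiece i) : gval (sgn k x) = sgn k (gval x).
Proof. exact: (@sgn_morph _ T (@gval i)). Qed.

Lemma gmul_leibniz i j k i' j' k' (e : i + j = k)
    (ei : i + 1 = i') (ej : j + 1 = j') (ek : k + 1 = k')
    (el : i' + j = k') (er : i + j' = k') x y :
  gdiff ek (gmul e x y) =
    gmul el (gdiff ei x) y + sgn i (gmul er x (gdiff ej y)).
Proof.
apply: val_inj; rewrite raddfD /= gval_sgn /=; apply: dM; exact: gpieceP.
Qed.

Lemma gpiece_nonpos i (x : gpiece i) : 0 < i -> x = 0.
Proof. by move=> i0; apply: val_inj => /=; apply: S_nonpos i0 (gpieceP x). Qed.

Definition graded_subring : dgring :=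
  @DGRing gcomplex (GPiece S1) gmul gmulBl gmulBr gmulA gmul1l gmul1r
    gmul_leibniz gpiece_nonpos.

End GradedSubring.

(* [width n] is the rank of the degree n part of Z[t,u] with |t| = |u| = -2. *)
Definition width (n : int) : nat :=
  if (n <= 0) && ~~ odd `|n| then `|n|./2.+1 else 0.

Lemma widthP n : (0 < width n)%N -> n = - (2 * (width n).-1%:Z).
Proof. rewrite /width; case: ifP => //; lia. Qed.

Lemma widthE k : width (- (2 * k%:Z)) = k.+1.
Proof. rewrite /width; case: ifP; lia. Qed.

Lemma width_gt0_le0 n : (0 < width n)%N -> n <= 0.
Proof. by move=> /widthP ->; lia. Qed.

Lemma widthD m n : (0 < width m)%N -> (0 < width n)%N ->
  width (m + n) = (width m).-1 + width n :> nat.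
Proof.
move=> m0 n0; move: (widthP m0) (widthP n0).
case: (width m) m0 => // a _; case: (width n) n0 => // b _ /= -> ->.
by have -> : - (2 * a%:Z) + - (2 * b%:Z) = - (2 * (a + b)%N%:Z); [lia|rewrite widthE; lia].
Qed.

Lemma sgn_width (V : zmodType) m i (x : V) : (0 < width i)%N -> sgn (m * i) x = x.
Proof.
by move=> /widthP ->; apply: (@sgn_parity _ (- (m * (width i).-1%:Z)) _ 0); ring.
Qed.

Lemma sgn_width3 (V : zmodType) i (x : V) : (0 < width (i + 3))%N -> sgn i x = - x.
Proof.
move=> /widthP h; rewrite -sgn1.
by apply: (@sgn_parity _ (- (width (i + 3)).-1%:Z - 2)); rewrite -{1}[i](addrK 3) {1}h; ring.
Qed.

Definition zt_pred (i : int) : pred int := fun a => (a == 0) || (0 < width i)%N.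

Lemma zt_closed i : zmod_closed (zt_pred i).
Proof.
split=> [|a b]; rewrite !unfold_in /zt_pred ?eqxx //.
by case: (0 < width i)%N; rewrite ?orbT // !orbF => /eqP -> /eqP ->; rewrite subrr.
Qed.

HB.instance Definition _ i := GRing.isZmodClosed.Build int (zt_pred i) (zt_closed i).

Definition zt_piece (i : int) : zmodClosed int :=
  GRing.ZmodClosed.clone int (zt_pred i) _.

Lemma zt_1 : 1 \in zt_piece 0.
Proof. by []. Qed.

Lemma zt_M i j x y : x \in zt_piece i -> y \in zt_piece j -> x * y \in zt_piece (i + j).
Proof.
rewrite !unfold_in /= /zt_pred => /orP[/eqP->|wi]; first by rewrite mul0r eqxx.
move=> /orP[/eqP->|wj]; first by rewrite mulr0 eqxx.
by rewrite widthD // addn_gt0 wj !orbT.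
Qed.

Lemma zt_nonpos i x : 0 < i -> x \in zt_piece i -> x = 0.
Proof. by rewrite unfold_in /= /zt_pred => i0 /orP[/eqP//|/width_gt0_le0]; lia. Qed.

Lemma zt_d i (x : int) : x \in zt_piece i -> \0 x \in zt_piece (i + 1).
Proof. by rewrite rpred0. Qed.

Lemma zt_leibniz i (x y : int) : x \in zt_piece i ->
  \0 (x * y) = \0 x * y + sgn i (x * \0 y) :> int.
Proof. by move=> _ /=; rewrite mul0r mulr0 raddf0 addr0. Qed.

(* The DG-ring Z[t] with |t| = -2: the element c t^k is represented by c. *)
Definition Zt : dgring :=
  @graded_subring int zt_piece \0 zt_1 zt_M zt_d (fun=> erefl) zt_leibniz zt_nonpos.

Lemma Zt_diff i j (e : i + 1 = j) (a : Zt i) : diff e a = 0.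
Proof. exact: val_inj. Qed.

(** Nonzero elements live in even degrees; this removes the Koszul signs from the actions below. *)
Lemma Zt_sgn m i (a : Zt i) : sgn (m * i) a = a.
Proof.
case: (posnP (width i)) => [w0|]; last exact: sgn_width.
suff -> : a = 0 by rewrite raddf0.
apply: val_inj; case: a => a /=; rewrite unfold_in /= /zt_pred w0 orbF.
by move/eqP.
Qed.

Lemma Zt_commutative : dg_commutative Zt.
Proof.
split=> [i j k e e' a b|i k e a].
  have -> : dgmul e a b = dgmul e' b a by apply: val_inj; rewrite /= mulrC.
  by rewrite -(sgn_morph (dgmulBr e' b)) mulrC Zt_sgn.
have := Zt_sgn 1 a; rewrite mul1r => ha oi.
have : a = 0; last by move=> ->; apply: (zmod_morph0 (dgmulBl _ _)).
apply: val_inj; case: a {ha} => a /=; rewrite unfold_in /= /zt_pred.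
by rewrite /width oi andbF orbF => /eqP.
Qed.

Lemma width_M2 (k : nat) : (0 < width (- (2 * k%:Z)))%N.
Proof. by rewrite widthE. Qed.

Lemma zt_in i c : (0 < width i)%N -> c \in zt_piece i.
Proof. by rewrite unfold_in /= /zt_pred orbC => ->. Qed.

Definition zt_const i (c : int) (h : (0 < width i)%N) : Zt i := GPiece (zt_in c h).

Lemma Zt_unbounded : ~ bounded_cohomology Zt.
Proof.
(* The witness is t^k with k = |N| + 1: its degree -2k lies below N, and its class survives because
   the differential vanishes. *)
case=> N hN; pose i := - (2 * `|N|.+1%:Z).
have iN : i < N by rewrite /i; lia.
pose x := zt_const 1 (width_M2 `|N|.+1).
have cx : is_cocycle x by apply/closedP => j e; apply: Zt_diff.
have : coh_class (Cocycle cx) = coh_class 0 by rewrite !(hN _ iN (coh_class _)).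
by move=> /coh_class_eq [j [e [a]]]; rewrite Zt_diff subr0 => /(congr1 (@gval _ _ _)).
Qed.

Lemma H0_class_Zt_inj : injective (@H0_class Zt).
Proof.
move=> a b /H0_class_eq [i [e [u]]]; rewrite Zt_diff => /esym/eqP.
by rewrite subr_eq0 => /eqP.
Qed.

(** In degree 0 the chosen representative is the only one, as there are no nonzero boundaries; this
    makes the choice additive and multiplicative. *)
Definition H0_lift (i : int) : H0_dgring Zt i -> Zt i :=
  match i with Posz 0 => fun h : H0 Zt => cocycle_val (repr h) | _ => fun=> 0 end.

Lemma H0_lift0K (h : H0 Zt) : H0_class (@H0_lift 0 h) = h.
Proof.
by rewrite -[RHS]reprK /H0_class /coh_class /=; congr \pi; apply: val_inj.
Qed.

Lemma H0_liftK i : cancel (@H0_lift i) (@H0_proj_fun Zt i).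
Proof. by case: i => [[|i]|i] h /=; rewrite ?(@H0_lift0K h) //; case: h. Qed.

Lemma H0_proj0K (a : Zt 0) : @H0_lift 0 (@H0_proj_fun Zt 0 a) = a.
Proof. by apply: H0_class_Zt_inj; rewrite H0_lift0K. Qed.

Lemma H0_liftB i : zmod_morphism (@H0_lift i).
Proof.
case: i => [[|i]|i] x y; rewrite /= ?subr0 //.
by apply: H0_class_Zt_inj; rewrite H0_classB -!/(@H0_lift 0 _) !H0_lift0K.
Qed.

Lemma H0_lift_neq0 i (b : H0_dgring Zt i) : i <> 0 -> H0_lift b = 0.
Proof. by case: i b => [[|i]|i]. Qed.

Lemma H0_liftM i j k (e : i + j = k) (a : H0_dgring Zt i) (b : H0_dgring Zt j) :
  H0_lift (dgmul e a b) = dgmul e (H0_lift a) (H0_lift b).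
Proof.
case: (i =P 0) => [i0|i0]; last first.
  rewrite (H0_lift_neq0 a i0) (zmod_morph0 (dgmulBl _ _)).
  have -> : a = 0 by case: i i0 a {e} => [[|i]|i] // _ [].
  by rewrite (zmod_morph0 (dgmulBl _ _)) (zmod_morph0 (@H0_liftB _)).
case: (j =P 0) => [j0|j0]; last first.
  rewrite (H0_lift_neq0 b j0) (zmod_morph0 (dgmulBr _ _)).
  have -> : b = 0 by case: j j0 b {e} => [[|j]|j] // _ [].
  by rewrite (zmod_morph0 (dgmulBr _ _)) (zmod_morph0 (@H0_liftB _)).
subst i j; case: k / e.
apply: H0_class_Zt_inj; rewrite H0_lift0K.
have := @dgr_funM _ _ (H0_proj Zt) 0 0 0 erefl (H0_lift a) (H0_lift b).
by rewrite /= !H0_lift0K => ->.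
Qed.

(** The inclusion Z -> Z[t] as a section of the augmentation. Restriction along it puts the Koszul
    complexes into the category where the derived functors take their values. *)
Definition H0_section : dgring_hom (H0_dgring Zt) Zt.
Proof.
apply: (@DGRingHom _ _ H0_lift H0_liftB _ _ H0_liftM).
  by move=> i j e a; rewrite Zt_diff (zmod_morph0 (@H0_liftB _)).
exact: (@H0_proj0K (dgone Zt)).
Defined.

(** * Restriction of scalars along a DG-ring map *)

Section Restriction.
Variables (A B : dgring) (f : dgring_hom A B).

Section Module.
Variable M : dgmod B.

Definition ract i j k (e : i + j = k) (a : A i) (m : M j) : M k := dgact e (f i a) m.

Lemma ractBl i j k (e : i + j = k) m : zmod_morphism (fun a => ract e a m).
Proof. by move=> a b; rewrite /ract dgr_funB dgactBl. Qed.

Lemma ractA i j k ij jk ijk (e1 : i + j = ij) (e2 : ij + k = ijk)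
    (e3 : j + k = jk) (e4 : i + jk = ijk) a b m :
  ract e2 (dgmul e1 a b) m = ract e4 a (ract e3 b m).
Proof. by rewrite /ract dgr_funM; apply: dgactA. Qed.

Lemma ract1 i (e : 0 + i = i) m : ract e (dgone A) m = m.
Proof. by rewrite /ract dgr_fun1 dgact1. Qed.

Lemma ract_leibniz i j k i' j' k' (e : i + j = k)
    (ei : i + 1 = i') (ej : j + 1 = j') (ek : k + 1 = k')
    (el : i' + j = k') (er : i + j' = k') a m :
  diff ek (ract e a m) = ract el (diff ei a) m + sgn i (ract er a (diff ej m)).
Proof. by rewrite /ract dgr_fund; apply: dgact_leibniz. Qed.

Definition res_dgmod : dgmod A :=
  @DGMod A M ract ractBl (fun i j k e a => dgactBr e (f i a)) ractA ract1 ract_leibniz.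

End Module.

Definition res_dghom (M N : dgmod B) (g : dghom M N) :
    dghom (res_dgmod M) (res_dgmod N) :=
  @DGHom A (res_dgmod M) (res_dgmod N) g (@dgh_funB _ _ _ g) (@dgh_fund _ _ _ g)
    (fun i j k e a m => dgh_funZ g e (f i a) m).

End Restriction.

(** * The Koszul complex *)

Definition zt_t : Zt (-2) := @zt_const (-2) 1 erefl.

(** Degree -2k with k > 0 leaves room for t^(k-1), and the other nonzero degrees contain only 0. The
    form with t on the left serves images of t, the one with t on the right serves kernels of t. *)
Lemma Zt_divt i (a : Zt i) : i <> 0 ->
  exists a' : Zt (i + 2), forall (e : -2 + (i + 2) = i) (e' : (i + 2) + (-2) = i),
    a = dgmul e zt_t a' /\ a = dgmul e' a' zt_t.
Proof.
move=> i0; have ha : gval a \in zt_piece (i + 2).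
  have := gpieceP a; rewrite !unfold_in /= /zt_pred => /orP[->//|/widthP wi].
  move: wi i0; case: (width i) => [|[|k]] wi i0; try by exfalso; apply: i0; rewrite wi.
  have -> : i + 2 = - (2 * k%:Z) by rewrite wi; lia.
  by rewrite widthE orbT.
exists (GPiece ha) => e e'.
by split; apply: val_inj; rewrite /= ?mul1r ?mulr1.
Qed.

Lemma Zt_sgn1 i (a : Zt i) : sgn i a = a.
Proof. by have := Zt_sgn 1 a; rewrite mul1r. Qed.

Section Modules.
Variable M : dgmod Zt.

Lemma Zt_act_sgn m i j k (e : i + j = k) (a : Zt i) (x : M j) :
  sgn (m * i) (dgact e a x) = dgact e a x.
Proof. by rewrite -(sgn_morph (dgactBl e x)) Zt_sgn. Qed.

Lemma Zt_act_diff i j k j' k' (e : i + j = k) (ej : j + 1 = j') (ek : k + 1 = k')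
    (er : i + j' = k') (a : Zt i) (x : M j) :
  diff ek (dgact e a x) = dgact er a (diff ej x).
Proof.
have el : (i + 1) + j = k' by rewrite -ek -e addrAC.
rewrite (dgact_leibniz e erefl ej ek el er) Zt_diff.
by rewrite (zmod_morph0 (dgactBl _ _)) add0r -(sgn_morph (dgactBl _ _)) Zt_sgn1.
Qed.

Definition tau i j (e : -2 + i = j) : M i -> M j := dgact e zt_t.

Lemma tauB i j (e : -2 + i = j) : zmod_morphism (tau e).
Proof. exact: dgactBr. Qed.

Lemma tau_diff i j i' j' (e : -2 + i = j) (ei : i + 1 = i') (ej : j + 1 = j')
    (e' : -2 + i' = j') x : diff ej (tau e x) = tau e' (diff ei x).
Proof. exact: Zt_act_diff. Qed.

Lemma tau_act p i j k l (e1 : p + i = k) (e2 : -2 + k = l) (e3 : -2 + i = j)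
    (e4 : p + j = l) (a : Zt p) x :
  tau e2 (dgact e1 a x) = dgact e4 a (tau e3 x).
Proof.
have u : -2 + p + i = l by rewrite -addrA e1.
have v : p + -2 = -2 + p by rewrite addrC.
rewrite /tau -(dgactA erefl u) -(dgactA v u).
by congr dgact; apply: val_inj; rewrite /= mul1r mulr1.
Qed.

End Modules.

Lemma dgh_tau (M N : dgmod Zt) (f : dghom M N) i j (e : -2 + i = j) x :
  f j (tau e x) = tau e (f i x).
Proof. exact: dgh_funZ. Qed.

(* The DG-module K (x)_A M shifted by s, for the Koszul resolution K of
   H^0(A) = Z; it is also Hom_A(K, M) when s = -3. *)
Section Koszul.
Variables (s r : int) (sr : s + 3 = r).

Lemma koszul_eq1 (n n' p : int) : n + 1 = n' -> (n + p) + 1 = n' + p.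
Proof. by move=> <-; rewrite addrAC. Qed.

Lemma koszul_eq2 (n n' : int) : n + 1 = n' -> -2 + (n + r) = n' + s.
Proof. by move=> <-; rewrite -sr; lia. Qed.

Lemma koszul_eq3 (i j k p : int) : i + j = k -> i + (j + p) = k + p.
Proof. by move=> <-; rewrite addrA. Qed.

Section Module.
Variable M : dgmod Zt.

(** For s = 0, a pair (v, w) stands for 1 (x) v + e (x) w, where e has degree -3 since d e = t has
    degree -2. For s = -3 it stands, up to sign, for the values (phi(e), phi(1)) of phi in Hom_A(K,
    M). *)
Definition koszul_piece (n : int) : zmodType := (M (n + s)%R * M (n + r)%R)%type.

(** The factor [sgn s] is the sign of a shift by s. For s = -3 it turns the second component into
    +d, as the chain map phi |-> (0, phi(1)) requires. *)
Definition koszul_diff n n' (e : n + 1 = n') (z : koszul_piece n) : koszul_piece n' :=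
  (sgn s (diff (koszul_eq1 s e) z.1 + tau (koszul_eq2 e) z.2),
   - sgn s (diff (koszul_eq1 r e) z.2)).

Lemma koszul_diffB n n' (e : n + 1 = n') : zmod_morphism (koszul_diff e).
Proof.
move=> x y; rewrite /koszul_diff /= !diffB tauB; congr pair.
  by rewrite addrACA -opprD; apply: raddfB.
by rewrite [sgn s _]raddfB opprD.
Qed.

Lemma koszul_diffK n n' n'' (e : n + 1 = n') (e' : n' + 1 = n'') x :
  koszul_diff e' (koszul_diff e x) = 0.
Proof.
rewrite /koszul_diff /=; congr pair.
  rewrite (sgn_morph (diffB _)) (zmod_morphN (tauB _)) (sgn_morph (tauB _)).
  rewrite -raddfB (zmod_morphD (diffB _)) diffK add0r.
  rewrite (tau_diff _ (koszul_eq1 r e) _ (koszul_eq2 e')).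
  by rewrite subrr !raddf0.
by rewrite (zmod_morphN (diffB _)) (sgn_morph (diffB _)) diffK raddf0 oppr0 raddf0 oppr0.
Qed.

Definition koszul_complex : complex := Complex koszul_diffB koszul_diffK.

Definition koszul_act i j k (e : i + j = k) (a : Zt i) (z : koszul_piece j) :
    koszul_piece k :=
  (dgact (koszul_eq3 s e) a z.1, dgact (koszul_eq3 r e) a z.2).

Lemma koszul_actBl i j k (e : i + j = k) z : zmod_morphism (fun a => koszul_act e a z).
Proof. by move=> a b; rewrite /koszul_act !dgactBl. Qed.

Lemma koszul_actBr i j k (e : i + j = k) a : zmod_morphism (koszul_act e a).
Proof. by move=> x y; rewrite /koszul_act !dgactBr. Qed.

Lemma koszul_actA i j k ij jk ijk (e1 : i + j = ij) (e2 : ij + k = ijk)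
    (e3 : j + k = jk) (e4 : i + jk = ijk) a b z :
  koszul_act e2 (dgmul e1 a b) z = koszul_act e4 a (koszul_act e3 b z).
Proof. by congr pair; apply: dgactA. Qed.

Lemma koszul_act1 i (e : 0 + i = i) z : koszul_act e (dgone Zt) z = z.
Proof. by case: z => x y; rewrite /koszul_act !dgact1. Qed.

Lemma koszul_leibniz i j k i' j' k' (e : i + j = k)
    (ei : i + 1 = i') (ej : j + 1 = j') (ek : k + 1 = k')
    (el : i' + j = k') (er : i + j' = k') a z :
  koszul_diff ek (koszul_act e a z) =
    koszul_act el (diff ei a) z + sgn i (koszul_act er a (koszul_diff ej z)).
Proof.
rewrite Zt_diff (zmod_morph0 (koszul_actBl _ _)) add0r.
rewrite -(sgn_morph (koszul_actBl _ _)) Zt_sgn1.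
rewrite /koszul_diff /koszul_act /=; congr pair.
  rewrite (sgn_morph (dgactBr _ _)) (zmod_morphD (dgactBr _ _)); congr sgn.
  rewrite (Zt_act_diff _ (koszul_eq1 s ej) _ (koszul_eq3 s er)).
  by rewrite (tau_act _ _ (koszul_eq2 ej) (koszul_eq3 s er)).
rewrite (zmod_morphN (dgactBr _ _)) (sgn_morph (dgactBr _ _)).
by rewrite (Zt_act_diff _ (koszul_eq1 r ej) _ (koszul_eq3 r er)).
Qed.

Definition koszul : dgmod Zt :=
  @DGMod Zt koszul_complex koszul_act koszul_actBl koszul_actBr koszul_actA
    koszul_act1 koszul_leibniz.

End Module.

Section Map.
Variables (M N : dgmod Zt) (f : dghom M N).

Definition koszul_map_fun n (z : koszul M n) : koszul N n :=
  (f _ z.1, f _ z.2).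

Lemma koszul_mapB n : zmod_morphism (@koszul_map_fun n).
Proof. by move=> x y; rewrite /koszul_map_fun /= !dgh_funB. Qed.

Lemma koszul_mapd i j (e : i + 1 = j) z :
  koszul_map_fun (diff e z) = diff e (koszul_map_fun z).
Proof.
rewrite /koszul_map_fun /= /koszul_diff /=; congr pair.
  rewrite (sgn_morph (dgh_funB f (n := _))) (zmod_morphD (dgh_funB f (n := _))).
  by rewrite dgh_fund dgh_tau.
rewrite (zmod_morphN (dgh_funB f (n := _))) (sgn_morph (dgh_funB f (n := _))).
by rewrite dgh_fund.
Qed.

Lemma koszul_mapZ i j k (e : i + j = k) (a : Zt i) z :
  koszul_map_fun (dgact e a z) = dgact e a (koszul_map_fun z).
Proof. by congr pair; apply: dgh_funZ. Qed.

Definition koszul_dghom : dghom (koszul M) (koszul N) :=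
  @DGHom Zt (koszul M) (koszul N) koszul_map_fun koszul_mapB koszul_mapd koszul_mapZ.

End Map.

Definition koszul_functor : functor (DGMod_cat Zt) (DGMod_cat (H0_dgring Zt)).
Proof.
apply: (@Functor (DGMod_cat Zt) (DGMod_cat (H0_dgring Zt))
  (fun M => res_dgmod H0_section (koszul M))
  (fun M N f => res_dghom H0_section (koszul_dghom f))).
- by move=> M N f g fg n [x y] /=; congr pair; apply: fg.
- by move=> M n [x y].
- by [].
Defined.

End Koszul.

(** * Cycles, boundaries and acyclicity of the Koszul complex *)

Section KoszulHomology.
Variables (s r : int) (sr : s + 3 = r).

Lemma koszul_eq4 (n : int) : -2 + (n + r) = n + s + 1.
Proof. by rewrite -sr; lia. Qed.

Section Elements.
Variable M : dgmod Zt.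

Lemma koszul_fst_sgn n k (z : koszul sr M n) : (sgn k z).1 = sgn k z.1.
Proof. by apply: (@sgn_morph (koszul sr M n) (M (n + s)) (fun z => z.1)). Qed.

Lemma koszul_snd_sgn n k (z : koszul sr M n) : (sgn k z).2 = sgn k z.2.
Proof. by apply: (@sgn_morph (koszul sr M n) (M (n + r)) (fun z => z.2)). Qed.

Lemma koszul_closed n (z : koszul sr M n) :
  closed z <->
  closed z.2 /\ diff (erefl (n + s + 1)) z.1 = - tau (koszul_eq4 n) z.2.
Proof.
have e1 : n + 1 + s = n + s + 1 by rewrite addrAC.
have e3 : -2 + (n + r) = n + 1 + s by rewrite koszul_eq4 addrAC.
have H (e : n + s + 1 = n + 1 + s) :
    diff e z.1 + tau e3 z.2 = 0 <->
    diff (erefl (n + s + 1)) z.1 = - tau (koszul_eq4 n) z.2.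
  move: (koszul_eq4 n) e3; rewrite e1 in e *; move=> u v.
  rewrite (eq_irrelevance e erefl) (eq_irrelevance v u).
  by split=> [/eqP|->]; rewrite ?addNr // addr_eq0 => /eqP.
split=> [/(_ _ erefl)|[c2 c1]].
  case=> h1 h2; split.
    apply: (@closed_at _ _ _ _ (koszul_eq1 r erefl)); rewrite -[LHS](sgnK s).
    by rewrite -[sgn s (diff _ _)]opprK h2 oppr0 raddf0.
  apply/(H (koszul_eq1 s erefl)); rewrite -[LHS](sgnK s).
  by rewrite (eq_irrelevance e3 (koszul_eq2 sr erefl)) h1 raddf0.
apply: (closed_at (e := erefl)); rewrite /= /koszul_diff c2 raddf0 oppr0.
rewrite (eq_irrelevance (koszul_eq2 _ _) e3).
by move/(H (koszul_eq1 s erefl)): c1 => ->; rewrite raddf0.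
Qed.

Lemma koszul_boundary i n (e : i + 1 = n) (x : koszul sr M n) :
  (exists z : koszul sr M i, diff e z = x) <->
  exists (y : M (i + s)) (y' : M (i + r)),
    x.1 = diff (koszul_eq1 s e) y + tau (koszul_eq2 sr e) y' /\
    x.2 = - diff (koszul_eq1 r e) y'.
Proof.
split=> [[z <-]|[y [y' [h1 h2]]]].
  exists (sgn s z.1), (sgn s z.2); rewrite /= /koszul_diff /=.
  by rewrite !(sgn_morph (diffB _)) (sgn_morph (tauB _)) raddfD.
exists (sgn s (y, y')); rewrite /= /koszul_diff koszul_fst_sgn koszul_snd_sgn.
rewrite !(sgn_morph (diffB _)) (sgn_morph (tauB _)) -raddfD !sgnK.
by rewrite -h1 -h2; case: x {h1 h2}.
Qed.

End Elements.

(** The five lemma for the cone of t, carried out on elements: the second component is solved first,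
    then corrected so that the first can be solved too. *)
Lemma koszul_quasi_iso (M N : dgmod Zt) (f : dghom M N) : quasi_iso f ->
  quasi_iso (res_dghom H0_section (koszul_dghom sr f)).
Proof.
move=> qf; have fB n := dgh_funB f (n := n).
apply: quasi_iso_intro => [i n e [x x'] z|i n e [y y']].
  move=> /koszul_closed /= [cx' dx] dz.
  have /koszul_boundary [y [y' /= [fx fx']]] :
    exists z, @diff (koszul sr N) i n e z = (f _ x, f _ x') by exists z.
  have [|u du] := quasi_iso_inj qf (y := - y') cx' (e := koszul_eq1 r e).
    by rewrite (zmod_morphN (diffB _)) -fx'.
  have cyu : closed (y' + f _ u).
    apply: (@closed_at _ _ _ _ (koszul_eq1 r e)).
    by rewrite (zmod_morphD (diffB _)) -dgh_fund du fx' addrN.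
  have [v [w [cv yu]]] := quasi_iso_surj qf (subrK 1 (i + r)) cyu.
  have ew : -2 + (i + r - 1) = i + s by rewrite -sr; ring.
  (* The primitive u of x' is only good for the second component; subtracting the cycle v makes y' +
     f u' a boundary, which the first component needs. *)
  pose u' := u - v.
  have du' : diff (koszul_eq1 r e) u' = x' by rewrite diffB cv subr0.
  have yu' : y' = diff (subrK 1 (i + r)) w - f _ u'.
    by rewrite /u' fB opprB addrCA addrA -yu addrK.
  have cx : closed (x + tau (koszul_eq2 sr e) u').
    apply: (@closed_at _ _ _ _ erefl).
    rewrite (zmod_morphD (diffB _)) dx.
    by rewrite (tau_diff _ (koszul_eq1 r e) _ (koszul_eq4 n)) du' addNr.
  have [|a da] := quasi_iso_inj qf (e := koszul_eq1 s e)
    (y := y + tau ew w) cx.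
    rewrite (zmod_morphD (diffB _)) (zmod_morphD (fB _)) fx dgh_tau yu'.
    rewrite tauB (tau_diff _ (subrK 1 (i + r)) _ (koszul_eq2 sr e)).
    by rewrite addrA subrK.
  apply/koszul_boundary; exists a, (- u'); rewrite /= da.
  by rewrite (zmod_morphN (tauB _)) addrK (zmod_morphN (diffB _)) opprK du'.
move=> /koszul_closed /= [cy' dy].
have [x' [w [cx' yx']]] := quasi_iso_surj qf (koszul_eq1 r e) cy'.
(* The class of t x' dies in N, hence already in M. Its primitive [a] will make y + t w + f a a
   cycle. *)
have dyw : diff erefl (- (y + tau (koszul_eq2 sr e) w)) = f _ (tau (koszul_eq4 n) x').
  rewrite (zmod_morphN (diffB _)) (zmod_morphD (diffB _)) dy yx'.
  rewrite (tau_diff _ (koszul_eq1 r e) _ (koszul_eq4 n)) dgh_tau.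
  by rewrite (zmod_morphD (tauB _)) opprD opprK addrK.
have ctx : closed (tau (koszul_eq4 n) x').
  move=> j ej; have e2 : -2 + (n + r + 1) = j by rewrite addrA koszul_eq4.
  by rewrite (tau_diff _ erefl _ e2) cx' (zmod_morph0 (tauB _)).
have [a da] := quasi_iso_inj qf ctx dyw.
have cb : closed (y + tau (koszul_eq2 sr e) w + f _ a).
  apply: (@closed_at _ _ _ _ erefl).
  by rewrite (zmod_morphD (diffB _)) -dgh_fund da -dyw (zmod_morphN (diffB _)) addrN.
have [b [c [cb' yb]]] := quasi_iso_surj qf (koszul_eq1 s e) cb.
have [z dz] : exists z, @diff (koszul sr N) i n e z =
    (diff (koszul_eq1 s e) c - tau (koszul_eq2 sr e) w, diff (koszul_eq1 r e) w).
  apply/koszul_boundary; exists c, (- w); rewrite /=.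
  by rewrite (zmod_morphN (tauB _)) (zmod_morphN (diffB _)) opprK.
exists (b - a, x'), z; split.
  apply/koszul_closed; split=> //=.
  by rewrite diffB cb' da sub0r.
change ((y, y') = koszul_map_fun f (b - a, x') + @diff (koszul sr N) i n e z).
rewrite dz; congr pair => /=; last exact: yx'.
by rewrite fB addrA [_ - _ + diff _ c]addrAC -yb addrK addrK.
Qed.

(** Closedness gives t x' = 0, hence x' = 0; and x = t y is, up to sign, the first component of the
    boundary of (0, y). *)
Lemma koszul_acyclic (M : dgmod Zt) :
  (forall i j (e : i + 1 = j) (x : M i), diff e x = 0) ->
  (forall i j (e : -2 + i = j), bijective (@tau M i j e)) ->
  forall n (x : koszul sr M n), closed x ->
  forall i (e : i + 1 = n), exists z : koszul sr M i, diff e z = x.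
Proof.
move=> d0 tb n [x x'] /koszul_closed [_ /= h] i e.
have x'0 : x' = 0.
  apply: (bij_inj (tb _ _ (koszul_eq4 n))); rewrite (zmod_morph0 (tauB _)).
  by apply: oppr_inj; rewrite -h d0 oppr0.
have [g _ gK] := tb _ _ (koszul_eq2 sr e).
apply/koszul_boundary; exists 0, (g x) => /=.
by rewrite gK !d0 add0r x'0 oppr0.
Qed.

End KoszulHomology.

(** * Comparison with reduction and coreduction *)

Local Notation aug := (H0_proj Zt).

Lemma H0_proj_neq0 i (a : Zt i) : i <> 0 -> aug i a = 0.
Proof. by case: i a => [[|i]|i]. Qed.

(** [H0_lift (aug i a)] is the constant term of [a], so the two actions agree modulo t. This makes
    the map to M/tM in [tens_one_eq0] balanced. *)
Lemma act_mod_tau (M : dgmod Zt) i j k l (e : i + j = k) (a : Zt i) (x : M j)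
    (el : -2 + l = k) :
  exists y, dgact e (H0_lift (aug i a)) x - dgact e a x = tau el y.
Proof.
case: (i =P 0) => [i0|i0].
  by subst i; exists 0; rewrite [H0_lift _](H0_proj0K a) subrr (zmod_morph0 (tauB _)).
rewrite H0_proj_neq0 // (zmod_morph0 (@H0_liftB _)) (zmod_morph0 (dgactBl _ _)) sub0r.
have [a' ha] := Zt_divt a i0.
have e1 : -2 + (i + 2) = i by rewrite addrC addrK.
have e2 : i + 2 - 2 = i by rewrite addrK.
have e3 : i + 2 + j = l by apply: (addrI (-2)); rewrite addrA e1 e el.
have [-> _] := ha e1 e2.
exists (- dgact e3 a' x); rewrite (zmod_morphN (tauB _)); congr (- _).
exact: dgactA.
Qed.

(** An element killed by t sees only the constant term of [a]; the linearity of [chom_of] rests on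
    this. *)
Lemma act_ker_tau (M : dgmod Zt) i j k l (e : i + j = k) (a : Zt i) (x : M j)
    (el : -2 + j = l) : tau el x = 0 -> dgact e (H0_lift (aug i a)) x = dgact e a x.
Proof.
move=> tx; case: (i =P 0) => [i0|i0]; first by subst i; rewrite [H0_lift _](H0_proj0K a).
rewrite H0_proj_neq0 // (zmod_morph0 (@H0_liftB _)) (zmod_morph0 (dgactBl _ _)).
have [a' ha] := Zt_divt a i0.
have e1 : -2 + (i + 2) = i by rewrite addrC addrK.
have e2 : i + 2 - 2 = i by rewrite addrK.
have [_ ->] := ha e1 e2.
have e3 : i + 2 + l = k by rewrite -el addrA e2 e.
by rewrite (dgactA e2 e el e3) -/(tau el x) tx (zmod_morph0 (dgactBr _ _)).
Qed.

(** * Reduction as the cokernel of t *)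

Section Reduction.
Variable M : dgmod Zt.
Local Notation tensM := (tens aug (M := M)).
Local Notation one := (dgone (H0_dgring Zt)).

Lemma tens_one i j k n (e : i + j = n) (e0 : 0 + k = n) (e1 : i + j = k)
    (b : H0_dgring Zt i) (m : M j) :
  tensM e b m = tensM e0 one (dgact e1 (H0_lift b) m).
Proof.
rewrite -(tens_bal aug (add0r i) e e1 e0) dgmul1l.
exact: (congr1 (fun b => tensM e b m) (esym (H0_liftK b))).
Qed.

Lemma tens_one_tau j k n (e0 : 0 + k = n) (e : -2 + j = k) (m : M j) :
  tensM e0 one (tau e m) = 0.
Proof.
have e1 : -2 + j = n by rewrite e -e0 add0r.
rewrite -(tens_bal aug (add0r (-2)) e1 e e0) H0_proj_neq0 //.
by rewrite (zmod_morph0 (dgmulBr _ _)) (zmod_morph0 (tensBl _ _ _)).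
Qed.

Lemma tens_one_surj k n (e0 : 0 + k = n) (x : tensor aug M n) :
  exists m, x = tensM e0 one m.
Proof.
apply: (@tensor_ind _ _ aug M n (fun x => exists m, x = tensM e0 one m))
  => [|_ _ [m ->] [m' ->]|i j e b m].
- by exists 0; rewrite (zmod_morph0 (tensBr _ _ _)).
- by exists (m - m'); rewrite tensBr.
have e1 : i + j = k by rewrite e -e0 add0r.
by exists (dgact e1 (H0_lift b) m); apply: tens_one.
Qed.

Section Cokernel.
Variables (k l : int) (el : -2 + l = k).

Definition in_tau : pred (M k) := fun x => `[< exists y, x = tau el y >].

Lemma in_tau_closed : zmod_closed in_tau.
Proof.
split=> [|x y]; rewrite !unfold_in.
  by apply/asboolP; exists 0; rewrite (zmod_morph0 (tauB _)).
move=> /asboolP [a ->] /asboolP [b ->].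
by apply/asboolP; exists (a - b); rewrite tauB.
Qed.

HB.instance Definition _ := GRing.isZmodClosed.Build (M k) in_tau in_tau_closed.

Definition coker_tau : zmodType :=
  Quotient.quot (GRing.ZmodClosed.clone (M k) in_tau _).

Lemma coker_tau_eq (x y : M k) :
  \pi_coker_tau x = \pi_coker_tau y <-> exists z, x - y = tau el z.
Proof.
split=> [/eqP|h].
  by rewrite -Quotient.idealrBE unfold_in => /asboolP.
by apply/eqP; rewrite -Quotient.idealrBE unfold_in; apply/asboolP.
Qed.

(** A tensor can be shown to be nonzero only by mapping out of the tensor product: b (x) m |-> class
    of b m in M/tM is balanced and sends 1 (x) m to the class of m. *)
Lemma tens_one_eq0 n (e0 : 0 + k = n) (m : M k) :
  tensM e0 one m = 0 -> exists z, m = tau el z.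
Proof.
have e1 i j : i + j = n -> i + j = k by rewrite -e0 add0r.
pose g i j (e : i + j = n) (b : H0_dgring Zt i) (m : M j) : coker_tau :=
  \pi_coker_tau (dgact (e1 i j e) (H0_lift b) m).
have gbal : balanced aug g.
  split=> [i j e x b b'|i j e b x y|i j p ij jp f1 f2 f3 f4 b a x]; rewrite /g.
  - by rewrite H0_liftB dgactBl raddfB.
  - by rewrite dgactBr raddfB.
  apply/coker_tau_eq; rewrite H0_liftM.
  have f5 : i + jp = k := e1 _ _ f4.
  rewrite (dgactA f1 (e1 _ _ f2) f3 (e1 _ _ f4)) -dgactBr.
  have el' : -2 + (jp + 2) = jp by rewrite addrC addrK.
  have [y ->] := act_mod_tau f3 a x el'.
  have f6 : i + (jp + 2) = l by apply: (addrI (-2)); rewrite el -f5; ring.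
  by exists (dgact f6 (H0_lift b) y); rewrite -(tau_act f6).
move=> /(congr1 (tlift g)); rewrite (tliftE gbal) (zmod_morph0 (tliftB gbal)).
rewrite /g -(raddf0 (\pi_coker_tau)) => /coker_tau_eq [z]; rewrite subr0.
have -> : H0_lift one = dgone Zt by apply: dgr_fun1 H0_section.
move=> h; exists z; rewrite -h.
by rewrite (eq_irrelevance (e1 _ _ e0) (add0r k)) dgact1.
Qed.

End Cokernel.

Lemma red_eq (n : int) : 0 + (n + 0) = n.
Proof. by rewrite addr0 add0r. Qed.

Definition red_fun n (z : koszul (add0r 3) M n) : tensor aug M n :=
  tensM (red_eq n) one z.1.

Lemma red_funB n : zmod_morphism (@red_fun n).
Proof. by move=> x y; rewrite /red_fun raddfB tensBr. Qed.

Lemma tdiff_aug_one i n (e : i + 1 = n) (m : M (i + 0)) :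
  tdiff e (tensM (red_eq i) one m) = tensM (red_eq n) one (diff (koszul_eq1 0 e) m).
Proof.
have e1 : 0 + 1 + (i + 0) = n by rewrite addr0 add0r addrC.
rewrite (tdiffE _ _ _ erefl (koszul_eq1 0 e) e1 (red_eq n)).
by rewrite (zmod_morph0 (tensBl _ _ _)) add0r.
Qed.

Lemma red_fund i j (e : i + 1 = j) z : red_fun (diff e z) = tdiff e (red_fun z).
Proof.
by rewrite /red_fun /= (zmod_morphD (tensBr _ _ _)) tens_one_tau tdiff_aug_one [LHS]addr0.
Qed.

Lemma red_funZ i j k (e : i + j = k) (b : H0_dgring Zt i) z :
  red_fun (koszul_act e (H0_lift b) z) = tact e b (red_fun z).
Proof.
have e1 : i + (j + 0) = k by rewrite addr0.
rewrite /red_fun /= (tactE _ _ _ _ (addr0 i) e1) dgmul1r.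
by symmetry; apply: tens_one.
Qed.

Definition red_dghom :
    dghom (res_dgmod H0_section (koszul (add0r 3) M)) (tensor_dgmod aug M) :=
  @DGHom _ (res_dgmod H0_section (koszul (add0r 3) M)) (tensor_dgmod aug M)
    red_fun red_funB red_fund red_funZ.

(** For t injective, the cone of t maps quasi-isomorphically onto M/tM; injectivity is used to
    cancel t in equations on the second component. *)
Lemma red_quasi_iso :
  (forall i j (e : -2 + i = j), injective (@tau M i j e)) -> quasi_iso red_dghom.
Proof.
move=> tinj.
apply: quasi_iso_intro => [i n e [x x'] y cz|i n e y cy] /=.
  have [m ->] := tens_one_surj (red_eq i) y.
  rewrite tdiff_aug_one /red_fun /= => /eqP; rewrite -subr_eq0 -tensBr => /eqP.
  move/(tens_one_eq0 (koszul_eq2 (add0r 3) e)) => [z hz].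
  have hx : x = diff (koszul_eq1 0 e) m + tau (koszul_eq2 (add0r 3) e) (- z).
    by rewrite (zmod_morphN (tauB _)) -hz opprB [RHS]addrC subrK.
  apply/koszul_boundary; exists m, (- z); split=> //=.
  apply/eqP; rewrite -subr_eq0 opprK; apply/eqP.
  have /koszul_closed [_ /= h] := cz.
  apply: (tinj _ _ (koszul_eq4 (add0r 3) n)).
  rewrite (zmod_morph0 (tauB _)) (zmod_morphD (tauB _)).
  rewrite -[tau _ x']opprK -h hx (zmod_morphD (diffB _)) diffK add0r.
  by rewrite (tau_diff _ (koszul_eq1 3 e) _ (koszul_eq4 (add0r 3) n)) addNr.
have [m hm] := tens_one_surj (red_eq n) y.
have := cy _ erefl; rewrite hm /= tdiff_aug_one.
have e4 : -2 + (n + 3) = n + 1 + 0 by ring.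
move/(tens_one_eq0 e4) => [z hz].
have hz' : diff erefl m = tau (koszul_eq4 (add0r 3) n) z.
  move: (koszul_eq1 _ _) e4 hz; rewrite (addrAC n 1 0) => u v.
  by rewrite (eq_irrelevance u erefl) (eq_irrelevance v (koszul_eq4 (add0r 3) n)) => ->.
(* From d m = t z, the pair (m, -z) is a cycle as soon as d z = 0, and this follows by cancelling t
   in t d z = d d m = 0. *)
exists (m, - z), 0; split; last by rewrite (zmod_morph0 (tdiffB _)) [RHS]addr0.
apply/koszul_closed; split=> /=; last by rewrite (zmod_morphN (tauB _)) opprK.
apply: (@closed_at _ _ _ _ erefl); rewrite (zmod_morphN (diffB _)).
have e5 : -2 + (n + 3 + 1) = n + 0 + 1 + 1 by ring.
apply/eqP; rewrite oppr_eq0; apply/eqP; apply: (tinj _ _ e5).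
rewrite (zmod_morph0 (tauB _)) -(tau_diff (koszul_eq4 (add0r 3) n) erefl erefl e5).
by rewrite -hz' diffK.
Qed.

End Reduction.

Lemma sgnN3 (V : zmodType) (x : V) : sgn (-3) x = - x.
Proof. by rewrite -sgn1; apply: (@sgn_parity _ (-2)). Qed.

(** * Coreduction as the kernel of t *)

Section Coreduction.
Variable M : dgmod Zt.
Local Notation one := (dgone (H0_dgring Zt)).
Local Notation K := (koszul (addNr 3) M).

Lemma cored_eq (n : int) : 0 + n = n + 0.
Proof. by rewrite addr0 add0r. Qed.

Lemma chom_aug_one n i j k (x : chom aug M n) (e : i + n = j) (e0 : 0 + n = k)
    (e1 : i + k = j) (b : H0_dgring Zt i) :
  chom_fun x e b = dgact e1 (H0_lift b) (chom_fun x e0 one).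
Proof.
have := chom_funZ x (addr0 i) e e0 e1 (H0_lift b) one.
rewrite dgmul1r Zt_act_sgn => <-.
exact: (congr1 (chom_fun x e) (esym (H0_liftK b))).
Qed.

Lemma tau_chom_aug_one n j k (x : chom aug M n) (e0 : 0 + n = j) (e1 : -2 + j = k) :
  tau e1 (chom_fun x e0 one) = 0.
Proof.
have e : -2 + n = k by rewrite -e1 -e0 add0r.
have := chom_funZ x (addr0 (-2)) e e0 e1 zt_t one.
rewrite (H0_proj_neq0 zt_t) // (zmod_morph0 (dgmulBl _ _)).
by rewrite (zmod_morph0 (chom_funB x _)) Zt_act_sgn.
Qed.

Lemma chom_of_subproof n m (i j k l p : int) (e1 : i + j = k) (e2 : k + n = l)
    (e3 : j + n = p) (e4 : i + p = l)
    (f1 : k + (n + 0) = l) (f2 : j + (n + 0) = p) (a : Zt i) (b : H0_dgring Zt j) :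
  (forall q (e : -2 + (n + 0) = q), tau (M := M) e m = 0) ->
  dgact f1 (H0_lift (dgmul e1 (aug i a) b)) m =
  sgn (n * i) (dgact e4 a (dgact f2 (H0_lift b) m)).
Proof.
move=> tm; rewrite H0_liftM Zt_act_sgn (dgactA e1 f1 f2 e4).
apply: (act_ker_tau e4 a (el := erefl)).
have u : j + (-2 + (n + 0)) = -2 + p by rewrite -f2; ring.
by rewrite (tau_act f2 erefl erefl u) tm (zmod_morph0 (dgactBr _ _)).
Qed.

Lemma add_addr0 (i n j : int) : i + n = j -> i + (n + 0) = j.
Proof. by rewrite addr0. Qed.

(** The inverse of evaluation at 1, which identifies Hom_A(H^0(A), M) with the kernel of t. *)
Definition chom_of n (m : M (n + 0))
    (tm : forall q (e : -2 + (n + 0) = q), tau e m = 0) : chom aug M n :=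
  @CHom _ _ aug M n (fun i j e b => dgact (add_addr0 e) (H0_lift b) m)
    (fun i j e b c => etrans (congr1 (fun x => dgact (add_addr0 e) x m)
      (@H0_liftB i b c)) (dgactBl (add_addr0 e) m (H0_lift b) (H0_lift c)))
    (fun i j k l p e1 e2 e3 e4 a b =>
       chom_of_subproof e1 e2 e3 e4 (add_addr0 e2) (add_addr0 e3) a b tm).

Lemma chom_of_one n m tm : chom_fun (@chom_of n m tm) (cored_eq n) one = m.
Proof.
rewrite -[LHS]/(dgact _ (H0_lift one) m).
have -> : H0_lift one = dgone Zt by apply: dgr_fun1 H0_section.
by rewrite (eq_irrelevance (add_addr0 _) (add0r (n + 0))) dgact1.
Qed.

Definition cored_fun n (x : chom aug M n) : K n := (0, chom_fun x (cored_eq n) one).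

Lemma cored_funB n : zmod_morphism (@cored_fun n).
Proof. by move=> x y; rewrite /cored_fun chom_subE; congr pair; rewrite subr0. Qed.

Lemma cdiff_aug_one i j (e : i + 1 = j) (x : chom aug M i) :
  chom_fun (cdiff e x) (cored_eq j) one =
  diff (koszul_eq1 0 e) (chom_fun x (cored_eq i) one).
Proof.
have e4 : 0 + 1 + i = j + 0 by rewrite addr0 add0r addrC.
rewrite (cdiffE e _ _ (cored_eq i) (koszul_eq1 0 e) erefl e4).
by rewrite (zmod_morph0 (chom_funB x _)) raddf0 [LHS]subr0.
Qed.

Lemma cored_fund i j (e : i + 1 = j) x : cored_fun (cdiff e x) = diff e (cored_fun x).
Proof.
rewrite /cored_fun cdiff_aug_one /= /koszul_diff /= (zmod_morph0 (diffB _)) add0r.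
by rewrite tau_chom_aug_one raddf0 sgnN3 opprK.
Qed.

Lemma cored_funZ i j k (e : i + j = k) (b : H0_dgring Zt i) x :
  cored_fun (cact e b x) = koszul_act e (H0_lift b) (cored_fun x).
Proof.
have h : chom_fun (cact e b x) (cored_eq k) one =
    dgact (koszul_eq3 0 e) (H0_lift b) (chom_fun x (cored_eq j) one).
  have e2 : i + j = k + 0 by rewrite addr0.
  rewrite (cactE e _ _ _ (add0r i) e2) dgmul1l.
  by rewrite (chom_aug_one x e2 (cored_eq j) (koszul_eq3 0 e)) mulrC Zt_act_sgn.
by rewrite /cored_fun h /koszul_act /= (zmod_morph0 (dgactBr _ _)).
Qed.

Definition cored_dghom : dghom (coind_dgmod aug M) (res_dgmod H0_section K) :=
  @DGHom _ (coind_dgmod aug M) (res_dgmod H0_section K)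
    cored_fun cored_funB cored_fund cored_funZ.

Lemma cored_inj n (x y : chom aug M n) : cored_fun x = cored_fun y -> x = y.
Proof.
move=> [xy]; apply: chom_ext => i j e b.
by rewrite !(chom_aug_one _ e (cored_eq n) (add_addr0 e)) xy.
Qed.

(** For t surjective, the kernel of t includes quasi-isomorphically into the shifted cone of t. *)
Lemma cored_quasi_iso :
  (forall i j (e : -2 + i = j) (y : M j), exists x, tau e x = y) ->
  quasi_iso cored_dghom.
Proof.
move=> tsurj; apply: quasi_iso_intro => [i n e x z cx|i n e [y y'] cy] /=.
  move=> dz; have /koszul_boundary [y [y' /= [h1 h2]]] :
    exists z, @diff K i n e z = (0, chom_fun x (cored_eq n) one) by exists z.
  have ew : -2 + (i - 1 + 0) = i + -3 by ring.
  have [w hw] := tsurj _ _ ew y.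
  have ew' : i - 1 + 0 + 1 = i + 0 by ring.
  (* Adding d w with t w = y moves y' into the kernel of t, because t d w = d y cancels t y'. The
     surjectivity half uses the same correction. *)
  pose m := diff ew' w + y'.
  have tm q (u : -2 + (i + 0) = q) : tau u m = 0.
    have qE : q = n + -3 by rewrite -u -e; ring.
    rewrite qE in u *; rewrite (eq_irrelevance u (koszul_eq2 (addNr 3) e)).
    rewrite (zmod_morphD (tauB _)).
    rewrite -(tau_diff ew _ (koszul_eq1 (-3) e)) hw.
    by rewrite -h1.
  exists (- chom_of tm); apply: cored_inj.
  rewrite -[cdiff e _]/(@diff (coind_complex aug M) _ _ e _).
  rewrite [cored_fun _](@dgh_fund _ _ _ cored_dghom _ _ e) /=.
  rewrite (zmod_morphN (cored_funB (n := _))) /cored_fun chom_of_one /koszul_diff /=.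
  rewrite sgnN3 opprK oppr0 (zmod_morph0 (diffB _)) add0r.
  rewrite (zmod_morphN (tauB _)) tm oppr0 raddf0 (zmod_morphN (diffB _)); congr pair.
  by rewrite /m (zmod_morphD (diffB _)) diffK add0r h2.
have /koszul_closed [/= cy' dy] := cy.
have [w hw] := tsurj _ _ (koszul_eq2 (addNr 3) e) y.
pose m := y' + diff (koszul_eq1 0 e) w.
have tm q (u : -2 + (n + 0) = q) : tau u m = 0.
  have qE : q = n + -3 + 1 by rewrite -u; ring.
  rewrite qE in u *; rewrite (zmod_morphD (tauB _)).
  rewrite -(tau_diff (koszul_eq2 (addNr 3) e) _ erefl) hw dy (eq_irrelevance u (koszul_eq4 (addNr 3) n)).
  by rewrite addrN.
exists (chom_of tm), (0, - w); split.
  apply: (closed_at (e := erefl)); apply: cored_inj.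
  rewrite [cored_fun _](@dgh_fund _ _ _ cored_dghom _ _ erefl) /=.
  rewrite (zmod_morph0 (cored_funB (n := _))) /cored_fun chom_of_one /koszul_diff /=.
  rewrite (zmod_morph0 (diffB _)) add0r tm raddf0; congr pair.
  have -> : diff (koszul_eq1 0 erefl) m = 0.
    by rewrite /m (zmod_morphD (diffB _)) diffK cy' [LHS]addr0.
  by rewrite raddf0 oppr0.
rewrite -[RHS]/(cored_fun (chom_of tm) + koszul_diff (addNr 3) e (0, - w)).
rewrite /cored_fun chom_of_one /koszul_diff /= (zmod_morph0 (diffB _)) add0r.
rewrite sgnN3 (zmod_morphN (tauB _)) hw opprK sgnN3 opprK (zmod_morphN (diffB _)).
by congr pair; rewrite /= ?add0r // /m addrK.
Qed.

End Coreduction.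

(** * The bimodule resolution *)

(** The dual numbers over Z[x], with (p, q) for p + q e. The product needs no sign, as x is even and
    e squares to zero. *)
Definition dual : Type := ({poly int} * {poly int})%type.
HB.instance Definition _ := GRing.Zmodule.on dual.

Definition dual_mul (x y : dual) : dual := (x.1 * y.1, x.1 * y.2 + x.2 * y.1).

Lemma dual_mulA : associative dual_mul.
Proof. by move=> x y z; rewrite /dual_mul /=; congr pair; ring. Qed.
Lemma dual_mul1l : left_id ((1, 0) : dual) dual_mul.
Proof. by case=> x y; rewrite /dual_mul /=; congr pair; ring. Qed.
Lemma dual_mul1r : right_id ((1, 0) : dual) dual_mul.
Proof. by case=> x y; rewrite /dual_mul /=; congr pair; ring. Qed.
Lemma dual_mulDl : left_distributive dual_mul +%R.
Proof. by move=> x y z; rewrite /dual_mul /=; congr pair; rewrite /=; ring. Qed.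
Lemma dual_mulDr : right_distributive dual_mul +%R.
Proof. by move=> x y z; rewrite /dual_mul /=; congr pair; rewrite /=; ring. Qed.

HB.instance Definition _ := GRing.Zmodule_isPzRing.Build dual
  dual_mulA dual_mul1l dual_mul1r dual_mulDl dual_mulDr.

Definition dual_pred (i : int) : pred dual :=
  fun z => (size z.1 <= width i)%N && (size z.2 <= width (i + 3)%R)%N.

Lemma dual_closed i : zmod_closed (dual_pred i).
Proof.
split=> [|x y]; rewrite !unfold_in /dual_pred /= ?size_poly0 //.
move=> /andP[x1 x2] /andP[y1 y2]; apply/andP; split.
  by apply: leq_trans (size_polyD _ _) _; rewrite size_polyN geq_max x1.
by apply: leq_trans (size_polyD _ _) _; rewrite size_polyN geq_max x2.
Qed.

HB.instance Definition _ i := GRing.isZmodClosed.Build dual (dual_pred i) (dual_closed i).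

Definition dual_piece (i : int) : zmodClosed dual :=
  GRing.ZmodClosed.clone dual (dual_pred i) _.

Definition dual_d (z : dual) : dual := (('X - 1%:P) * z.2, 0).

Lemma dual_dB : zmod_morphism dual_d.
Proof. by move=> x y; rewrite /dual_d; congr pair; rewrite /= ?subr0 //; ring. Qed.

HB.instance Definition _ := GRing.isZmodMorphism.Build dual dual dual_d dual_dB.

Lemma dual_1 : 1 \in dual_piece 0.
Proof. by rewrite unfold_in /= /dual_pred /= size_poly1 size_poly0. Qed.

Lemma size_mul_width (p q : {poly int}) i j : (size p <= width i)%N ->
  (size q <= width j)%N -> (size (p * q)%R <= width (i + j)%R)%N.
Proof.
have [->|p0] := eqVneq p 0; first by rewrite mul0r size_poly0.
have [->|q0] := eqVneq q 0; first by rewrite mulr0 size_poly0.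
rewrite -size_poly_gt0 in p0; rewrite -size_poly_gt0 in q0 => hp hq.
rewrite (widthD (leq_trans p0 hp) (leq_trans q0 hq)).
apply: leq_trans (size_polyMleq _ _) _; move: p0 q0 hp hq; lia.
Qed.

Lemma dual_M i j x y : x \in dual_piece i -> y \in dual_piece j ->
  x * y \in dual_piece (i + j).
Proof.
rewrite !unfold_in /= /dual_pred /= => /andP[x1 x2] /andP[y1 y2].
rewrite size_mul_width //=; apply: leq_trans (size_polyD _ _) _; rewrite geq_max.
have -> : i + j + 3 = i + (j + 3) by ring.
rewrite size_mul_width //=.
by have -> : i + (j + 3) = (i + 3) + j; [ring|rewrite size_mul_width].
Qed.

Lemma dual_dS i x : x \in dual_piece i -> dual_d x \in dual_piece (i + 1).
Proof.
rewrite !unfold_in /= /dual_pred /= size_poly0 andbT => /andP[_ x2].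
have -> : i + 1 = -2 + (i + 3) by ring.
by rewrite size_mul_width // size_XsubC.
Qed.

Lemma dual_dd x : dual_d (dual_d x) = 0.
Proof. by rewrite /dual_d /= mulr0. Qed.

(** A nonzero p forces i to be even and a nonzero q forces i to be odd. The sign thus no longer
    mentions i, and the Leibniz rule becomes a ring identity. *)
Lemma dual_sgn i (x : dual) : x \in dual_piece i -> sgn i x = (x.1, - x.2).
Proof.
have -> : sgn i x = (sgn i x.1, sgn i x.2).
  rewrite -(sgn_morph (f := fun x : dual => x.1)) // -(sgn_morph (f := fun x : dual => x.2)) //.
  by case: (sgn i x).
rewrite unfold_in /= /dual_pred => /andP[x1 x2]; congr pair.
  have [->|p0] := eqVneq x.1 0; first by rewrite raddf0.
  rewrite -size_poly_gt0 in p0.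
  by rewrite -{1}[i]mul1r sgn_width // (leq_trans p0).
have [->|p0] := eqVneq x.2 0; first by rewrite raddf0 oppr0.
rewrite -size_poly_gt0 in p0.
by rewrite sgn_width3 // (leq_trans p0).
Qed.

Lemma dual_dM i x y : x \in dual_piece i ->
  dual_d (x * y) = dual_d x * y + sgn i (x * dual_d y).
Proof.
move=> xi; rewrite -(sgn_morph (f := fun x => x * dual_d y)) => [|z w].
  rewrite (dual_sgn xi) /dual_d; congr pair => /=; ring.
exact: mulrBl.
Qed.

Lemma dual_nonpos i x : 0 < i -> x \in dual_piece i -> x = 0.
Proof.
have w0 j : 0 < j -> width j = 0.
  by move=> j0; case: (posnP (width j)) => // /width_gt0_le0; lia.
rewrite unfold_in /= /dual_pred => i0; rewrite !w0 ?leqn0 ?size_poly_eq0; last 2 first.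
- lia.
- by [].
by case: x => p q /= /andP[/eqP-> /eqP->].
Qed.

(* The Koszul resolution Z[t,u,e] of Z[t] over Z[t] (x) Z[t], with d e = t - u
   and x = t/u: p(x) + q(x) e in degree n stands for the homogeneous element
   u^k p(t/u) + u^l q(t/u) e, where n = -2k = -3-2l. *)
Definition Zbar : dgring :=
  @graded_subring dual dual_piece dual_d dual_1 dual_M dual_dS dual_dd
    dual_dM dual_nonpos.

Lemma Zt_size i (a : Zt i) : (size (gval a)%:P <= width i)%N.
Proof.
rewrite size_polyC; have := gpieceP a; rewrite unfold_in /= /zt_pred.
by case: eqP.
Qed.

Lemma left_subproof i (a : Zt i) :
  ((gval a)%:P * 'X^((width i).-1), 0) \in dual_piece i.
Proof.
rewrite unfold_in /= /dual_pred /= size_poly0 andbT.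
have := Zt_size a; rewrite size_polyC.
have [->|_] := eqVneq (gval a) 0; first by rewrite mul0r size_poly0.
move=> h; apply: leq_trans (size_polyMleq _ _) _; rewrite size_polyXn.
by move: (leq_b1 (gval a != 0)); rewrite size_polyC; case: (width i) h => //=; lia.
Qed.

(** The inclusion t |-> t: in degree -2k the exponent [(width i).-1] is k, and x^k stands for
    t^k. *)
Definition left_fun i (a : Zt i) : Zbar i := @GPiece dual dual_piece i _ (left_subproof a).

Definition left_hom : dgring_hom Zt Zbar.
Proof.
apply: (@DGRingHom Zt Zbar left_fun).
- move=> i a b; apply: val_inj; rewrite /=; congr pair; rewrite /= ?subr0 //.
  by rewrite polyCB; ring.
- move=> i j e a; apply: val_inj; rewrite /= /dual_d /=; congr pair; rewrite /=.
  by rewrite mulr0 mul0r.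
- by apply: val_inj; rewrite /= mulr1.
- move=> i j k e a b; apply: val_inj; rewrite /=; congr pair; rewrite /=; last first.
    by rewrite mulr0 mul0r addr0.
  (* Zero coefficients are set aside because [(width i).-1] is additive only in degrees of positive
     width. *)
  case: (posnP (size (gval a)%:P)) => [/eqP|a0].
    by rewrite size_poly_eq0 polyC_eq0 => /eqP->; rewrite !mul0r.
  case: (posnP (size (gval b)%:P)) => [/eqP|b0].
    by rewrite size_poly_eq0 polyC_eq0 => /eqP->; rewrite !(mul0r, mulr0).
  have wa := leq_trans a0 (Zt_size a); have wb := leq_trans b0 (Zt_size b).
  rewrite -e widthD // mulrACA -polyCM -exprD; congr (_ * 'X^_).
  by move: wa wb; lia.
Defined.

Lemma right_subproof i (a : Zt i) : ((gval a)%:P, 0) \in dual_piece i.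
Proof. by rewrite unfold_in /= /dual_pred /= size_poly0 andbT Zt_size. Qed.

(** The inclusion t |-> u: the constant 1 in degree -2k stands for u^k. *)
Definition right_fun i (a : Zt i) : Zbar i := @GPiece dual dual_piece i _ (right_subproof a).

Definition right_hom : dgring_hom Zt Zbar.
Proof.
apply: (@DGRingHom Zt Zbar right_fun).
- move=> i a b; apply: val_inj; rewrite /=; congr pair; rewrite /= ?subr0 //.
  by rewrite polyCB.
- move=> i j e a; apply: val_inj; rewrite /= /dual_d /=; congr pair; rewrite /=.
  by rewrite mulr0.
- exact: val_inj.
- move=> i j k e a b; apply: val_inj; rewrite /=; congr pair; rewrite /=.
    by rewrite polyCM.
  by rewrite mulr0 mul0r addr0.
Defined.

Lemma mult_subproof i (b : Zbar i) : (gval b).1.[1] \in zt_piece i.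
Proof.
have := gpieceP b; rewrite !unfold_in /= /dual_pred /zt_pred => /andP[h _].
case: (posnP (width i)) h => [->|]; last by rewrite orbT.
by rewrite leqn0 size_poly_eq0 => /eqP ->; rewrite horner0.
Qed.

(** The multiplication map with t, u |-> t and e |-> 0; in terms of x = t/u it is evaluation at
    1. *)
Definition mult_fun i (b : Zbar i) : Zt i := GPiece (mult_subproof b).

Definition mult_hom : dgring_hom Zbar Zt.
Proof.
apply: (@DGRingHom Zbar Zt mult_fun).
- by move=> i a b; apply: val_inj; rewrite /= hornerD hornerN.
- move=> i j e a; apply: val_inj; rewrite /= hornerM hornerXsubC.
  by rewrite subrr mul0r.
- by apply: val_inj; rewrite /= hornerC.
- by move=> i j k e a b; apply: val_inj; rewrite /= hornerM.
Defined.

Lemma mult_leftK i (a : Zt i) : mult_hom i (left_hom i a) = a.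
Proof. by apply: val_inj; rewrite /= hornerM hornerC hornerXn expr1n mulr1. Qed.

Lemma mult_rightK i (a : Zt i) : mult_hom i (right_hom i a) = a.
Proof. by apply: val_inj; rewrite /= hornerC. Qed.

Definition dual_const (c : int) : dual := (c%:P, 0).

Lemma dual_constC c x : dual_const c * x = x * dual_const c.
Proof. by rewrite /dual_const; congr pair; rewrite /=; ring. Qed.

Lemma width_pred i : ((width i).-1 <= width (i + 2))%N.
Proof.
case: (posnP (width i)) => [->//|/widthP].
case: (width i) => // -[|k] // ->.
by have -> : - (2 * k.+2.-1%:Z) + 2 = - (2 * k%:Z); [lia|rewrite widthE].
Qed.

(** * Operators on the tensor and coinduced modules from Z[u]-linear maps *)

Section Operator.
Variables (delta : int) (H : dual -> dual).
Hypothesis HB : zmod_morphism H.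
Hypothesis HS : forall i x, x \in dual_piece i -> H x \in dual_piece (i + delta).
Hypothesis Hr : forall c x, H (x * dual_const c) = H x * dual_const c.

Lemma op_subproof i j (e : i + delta = j) (b : Zbar i) : H (gval b) \in dual_piece j.
Proof. by rewrite -e HS ?gpieceP. Qed.

(** Constants encode multiples of powers of u, so [Hr] says that [H] is Z[u]-linear. Such an [H] can
    act on the left factor of b (x) m and on the argument of a homomorphism; division by t and the
    contracting homotopy are both used in this way. *)
Definition op i j (e : i + delta = j) (b : Zbar i) : Zbar j :=
  @GPiece dual dual_piece j _ (op_subproof e b).

Lemma opB i j (e : i + delta = j) : zmod_morphism (op e).
Proof. by move=> a b; apply: val_inj; rewrite /= HB. Qed.

Lemma op_right i j k k' l (e1 : i + j = k) (e2 : k + delta = l)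
    (e3 : i + delta = k') (e4 : k' + j = l) (b : Zbar i) (a : Zt j) :
  op e2 (dgmul e1 b (right_hom j a)) = dgmul e4 (op e3 b) (right_hom j a).
Proof. by apply: val_inj => /=; apply: Hr. Qed.

Lemma op_left i j k k' l (e1 : j + i = k) (e2 : k + delta = l)
    (e3 : i + delta = k') (e4 : j + k' = l) (b : Zbar i) (a : Zt j) :
  op e2 (dgmul e1 (right_hom j a) b) = dgmul e4 (right_hom j a) (op e3 b).
Proof.
apply: val_inj => /=; rewrite -/(dual_const _) !dual_constC; exact: Hr.
Qed.

Section Tensor.
Variable M : dgmod Zt.
Local Notation tens := (tens right_hom (M := M)).

Lemma op_eq (i j n n' : int) : i + j = n -> n + delta = n' -> i + delta + j = n'.
Proof. by move=> <- <-; rewrite addrAC. Qed.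

Definition tens_op_fun n n' (en : n + delta = n') i j (e : i + j = n)
    (b : Zbar i) (m : M j) := tens (op_eq e en) (op erefl b) m.

Lemma tens_op_balanced n n' (en : n + delta = n') :
  balanced right_hom (tens_op_fun en).
Proof.
split=> [i j e m x y|i j e b x y|i j k ij jk e1 e2 e3 e4 b a m]; rewrite /tens_op_fun.
- by rewrite opB tensBl.
- by rewrite tensBr.
have e5 : i + delta + j = ij + delta by rewrite addrAC e1.
by rewrite (op_right e1 erefl erefl e5) (tens_bal _ e5 (op_eq e2 en) e3 (op_eq e4 en)).
Qed.

Definition tens_op n n' (en : n + delta = n') :
  tensor right_hom M n -> tensor right_hom M n' := tlift (tens_op_fun en).

Lemma tens_opB n n' (en : n + delta = n') : zmod_morphism (tens_op en).
Proof. exact: tliftB (tens_op_balanced en). Qed.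

Lemma tens_opE n n' (en : n + delta = n') i j i' (e : i + j = n) (e' : i + delta = i')
    (e2 : i' + j = n') b m :
  tens_op en (tens e b m) = tens e2 (op e' b) m.
Proof.
rewrite /tens_op (tliftE (tens_op_balanced en)) /tens_op_fun.
by move: e2; case: _ / e' => e2; rewrite (eq_irrelevance e2 (op_eq e en)).
Qed.

End Tensor.

Section Chom.
Variables (M : dgmod Zt) (n n' : int) (en : n' = delta + n) (x : chom right_hom M n).

Lemma chom_op_eq (i j : int) : i + n' = j -> i + delta + n = j.
Proof. by move=> <-; rewrite en addrA. Qed.

Lemma chom_op_subproofB i j (e : i + n' = j) :
  zmod_morphism (fun b : Zbar i => chom_fun x (chom_op_eq e) (op erefl b)).
Proof. by move=> a b; rewrite opB chom_funB. Qed.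

Lemma chom_op_subproofZ (i j k l m : int) (e1 : i + j = k) (e2 : k + n' = l)
    (e3 : j + n' = m) (e4 : i + m = l) (a : Zt i) (b : Zbar j) :
  chom_fun x (chom_op_eq e2) (op erefl (dgmul e1 (right_hom i a) b)) =
  sgn (n' * i) (dgact e4 a (chom_fun x (chom_op_eq e3) (op erefl b))).
Proof.
have e5 : i + (j + delta) = k + delta by rewrite addrA e1.
rewrite (op_left e1 erefl erefl e5) (chom_funZ x e5 _ (chom_op_eq e3) e4).
by rewrite !Zt_act_sgn.
Qed.

Definition chom_op : chom right_hom M n' := CHom chom_op_subproofB chom_op_subproofZ.

Lemma chom_opE i j k (e : i + n' = j) (e1 : i + delta = k) (e2 : k + n = j) b :
  chom_fun chom_op e b = chom_fun x e2 (op e1 b).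
Proof.
by move: e2; case: _ / e1 => e2; rewrite (eq_irrelevance e2 (chom_op_eq e)).
Qed.

End Chom.
End Operator.

(** Division by x that forgets constant coefficients: a left inverse of multiplication by t on
    [Zbar], linear over Z[u] but not over Z[t]. *)
Definition divx (z : dual) : dual := (drop_poly 1 z.1, drop_poly 1 z.2).

Lemma divxB : zmod_morphism divx.
Proof. by move=> x y; rewrite /divx /= !raddfB. Qed.

Lemma divxS i x : x \in dual_piece i -> divx x \in dual_piece (i + 2).
Proof.
rewrite !unfold_in /= /dual_pred /= !size_drop_poly !subn1 => /andP[x1 x2].
have -> : i + 2 + 3 = i + 3 + 2 by ring.
by rewrite !(leq_trans _ (width_pred _)) // -!subn1 leq_sub2r.
Qed.

Lemma divx_right c x : divx (x * dual_const c) = divx x * dual_const c.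
Proof.
have E (p : {poly int}) : drop_poly 1 (p * c%:P) = drop_poly 1 p * c%:P.
  by rewrite mulrC mul_polyC linearZ /= -mul_polyC mulrC.
by rewrite /divx /dual_const; congr pair; rewrite /= ?mulr0 ?add0r E.
Qed.

Definition dualX : dual := ('X, 0).

Lemma divxK x : divx (x * dualX) = x.
Proof.
case: x => p q; rewrite /divx; congr pair; rewrite /= ?mulr0 ?add0r.
  exact: (drop_polyMXn_id 1).
exact: (drop_polyMXn_id 1).
Qed.

Lemma divxKl x : divx (dualX * x) = x.
Proof.
suff -> : dualX * x = x * dualX by apply: divxK.
by congr pair; rewrite /=; ring.
Qed.

Lemma divX1_subproof (p : {poly int}) : exists q, p - p.[1]%:P = q * ('X - 1%:P).
Proof. by apply/factor_theorem; rewrite /root !hornerE subrr. Qed.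

Definition divX1 (p : {poly int}) : {poly int} := sval (cid (divX1_subproof p)).

Lemma divX1E p : divX1 p * ('X - 1%:P) = p - p.[1]%:P.
Proof. by rewrite -(svalP (cid (divX1_subproof p))). Qed.

Lemma X1_neq0 : 'X - 1%:P != 0 :> {poly int}.
Proof. exact: monic_neq0 (monicXsubC 1). Qed.

Lemma divX1_uniq p q : q * ('X - 1%:P) = p - p.[1]%:P -> divX1 p = q.
Proof. by rewrite -divX1E => /(mulIf X1_neq0). Qed.

(** Since d e = x - 1, dividing p - p(1) by x - 1 inverts d up to the constant p(1). This homotopy
    contracts [Zbar] onto the image of [right_hom]. *)
Definition contract (z : dual) : dual := (0, divX1 z.1).

Lemma contractB : zmod_morphism contract.
Proof.
move=> x y; rewrite /contract; congr pair; rewrite /= ?subr0 //.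
apply: divX1_uniq; rewrite mulrBl !divX1E hornerD hornerN polyCB; ring.
Qed.

Lemma contractS i x : x \in dual_piece i -> contract x \in dual_piece (i + -1).
Proof.
rewrite !unfold_in /= /dual_pred /= size_poly0 /= => /andP[x1 _].
have -> : i - 1 + 3 = i + 2 by ring.
apply: leq_trans (width_pred _).
have [->|q0] := eqVneq (divX1 x.1) 0; first by rewrite size_poly0.
have := size_mul q0 X1_neq0; rewrite divX1E size_XsubC.
rewrite addn2 /= => hs.
(* The 1 in the maximum accounts for the constant p(1); it is harmless because a nonzero quotient
   makes the left side at least 2. *)
have : ((size (divX1 x.1)).+1 <= maxn (size x.1) 1)%N.
  rewrite -hs; apply: leq_trans (size_polyD _ _) _; rewrite size_polyN.
  by rewrite geq_max leq_maxl /= (leq_trans (size_polyC_leq1 _)) ?leq_maxr.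
rewrite -size_poly_gt0 in q0; move: q0 x1 {hs}.
move: (size (divX1 x.1)) (size x.1) (width i) => a b c; lia.
Qed.

Lemma contract_right c x : contract (x * dual_const c) = contract x * dual_const c.
Proof.
rewrite /contract /dual_const; congr pair; rewrite /= ?mul0r ?add0r //.
apply: divX1_uniq; rewrite hornerM hornerC polyCM mulrAC divX1E; ring.
Qed.

Lemma dual_d_contract (x : dual) :
  dual_d (contract x) + contract (dual_d x) = x - dual_const x.1.[1].
Proof.
case: x => p q; rewrite /dual_d /contract /dual_const; congr pair; rewrite /=.
  by rewrite addr0 mulrC divX1E.
rewrite add0r subr0; apply: divX1_uniq.
by rewrite hornerM hornerXsubC subrr mul0r subr0 mulrC.
Qed.

Lemma sgnN1 (V : zmodType) (x : V) : sgn (-1) x = - x.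
Proof. by rewrite -sgn1; apply: (@sgn_parity _ (-1)). Qed.

Local Notation rho := right_hom.
Local Notation lam := left_hom.
Local Notation mu := mult_hom.

Lemma mult_left_right i (b : Zbar i) (h1 : i + -1 + 1 = i) (h2 : i + 1 + -1 = i) :
  b = rho i (mu i b) + diff h1 (op contractS erefl b) + op contractS h2 (diff erefl b).
Proof.
apply: val_inj; rewrite /= -addrA dual_d_contract addrC subrK //.
Qed.

(** * The resolution by the tensor product, with t injective *)

Section TensorResolution.
Variable M : dgmod Zt.
Local Notation P := (tensor_dgmod rho M).
Local Notation tens := (tens rho (M := M)).
Local Notation one := (dgone Zbar).

Definition tres_fun n i j (e : i + j = n) (b : Zbar i) (m : M j) : M n :=
  dgact e (mu i b) m.

Lemma tres_balanced n : balanced rho (@tres_fun n).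
Proof.
split=> [i j e m x y|i j e b x y|i j k ij jk e1 e2 e3 e4 b a m]; rewrite /tres_fun.
- by rewrite dgr_funB dgactBl.
- by rewrite dgactBr.
by rewrite dgr_funM mult_rightK; apply: dgactA.
Qed.

Definition tres n (x : tensor rho M n) : M n := tlift (@tres_fun n) x.

Lemma tresE n i j (e : i + j = n) (b : Zbar i) (m : M j) :
  tres (tens e b m) = dgact e (mu i b) m.
Proof. exact: (tliftE (@tres_balanced n)). Qed.

Lemma tresB n : zmod_morphism (@tres n).
Proof. exact: tliftB (@tres_balanced n). Qed.

Lemma tresd i j (e : i + 1 = j) x : tres (tdiff e x) = diff e (tres x).
Proof.
apply: (@tensor_ind _ _ rho M i (fun x => tres (tdiff e x) = diff e (tres x)))
  => [|y z hy hz|p q e' b m].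
- by rewrite !(zmod_morph0 (@tresB _), zmod_morph0 (tdiffB _), zmod_morph0 (diffB _)).
- by rewrite !(tresB, tdiffB, diffB) hy hz.
have u1 : p + 1 + q = j by rewrite addrAC e'.
have u2 : p + (q + 1) = j by rewrite addrA e'.
rewrite (tdiffE _ _ _ erefl erefl u1 u2) (zmod_morphD (@tresB _)).
rewrite (sgn_morph (@tresB _)) !tresE.
by rewrite (dgact_leibniz e' erefl erefl e u1 u2) dgr_fund.
Qed.

Lemma tresZ i j k (e : i + j = k) (a : Zt i) x :
  tres (tact e (lam i a) x) = dgact e a (tres x).
Proof.
apply: (@tensor_ind _ _ rho M j (fun x => tres (tact e (lam i a) x) = dgact e a (tres x)))
  => [|y z hy hz|p q e' b m].
- by rewrite !(zmod_morph0 (@tresB _), zmod_morph0 (tactBr _ _), zmod_morph0 (dgactBr _ _)).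
- by rewrite !(tresB, tactBr, dgactBr) hy hz.
have u : i + p + q = k by rewrite -addrA e'.
rewrite (tactE _ _ _ _ erefl u) !tresE dgr_funM mult_leftK.
exact: dgactA.
Qed.

Definition tres_dghom : dghom (res_dgmod lam P) M :=
  @DGHom _ (res_dgmod lam P) M tres tresB tresd tresZ.

Lemma tdiff_one i n (e : i + 1 = n) (m : M i) :
  tdiff e (tens (add0r i) one m) = tens (add0r n) one (diff e m).
Proof.
have e1 : 0 + 1 + i = n by rewrite add0r addrC.
rewrite (tdiffE _ _ _ erefl e e1 (add0r n)).
have -> : diff (erefl (0 + 1)) one = 0 by apply: val_inj; rewrite /= /dual_d /= mulr0.
by rewrite (zmod_morph0 (tensBl _ _ _)) add0r.
Qed.

Local Notation H e := (@tens_op _ _ contractS M _ _ e).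

(** Write h for the homotopy of [Zbar]. In the two homotopy terms, h(b) (x) d m occurs with opposite
    signs, as h has degree -1; the rest is [mult_left_right] in the left factor, followed by
    balancing. *)
Lemma tensor_contract n n0 n1 (e0 : n + -1 = n0) (e0' : n0 + 1 = n)
    (e1 : n + 1 = n1) (e1' : n1 + -1 = n) (x : tensor rho M n) :
  x = tens (add0r n) one (tres x) + (tdiff e0' (H e0 x) + H e1' (tdiff e1 x)).
Proof.
have hB k l (e : k + -1 = l) : zmod_morphism (H e).
  exact: (tens_opB contractB contractS contract_right).
apply: (@tensor_ind _ _ rho M n (fun x => x = tens (add0r n) one (tres x) +
  (tdiff e0' (H e0 x) + H e1' (tdiff e1 x)))) => [|y z hy hz|i j e b m].
- rewrite (zmod_morph0 (@tresB _)) (zmod_morph0 (hB _ _ e0)) !(zmod_morph0 (tdiffB _)).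
  by rewrite (zmod_morph0 (hB _ _ e1')) (zmod_morph0 (tensBr _ _ _)) !addr0.
- rewrite [LHS](congr2 (fun u v => u - v) hy hz).
  rewrite (@tresB n) (hB _ _ e0) !tdiffB (hB _ _ e1') tensBr.
  by rewrite opprD addrACA; congr (_ + _); rewrite opprD addrACA.
have hE := tens_opE contractB contractS contract_right.
have f1 : i + -1 + j = n0 by rewrite addrAC e.
have f2 : i + -1 + 1 + j = n by rewrite subrK.
have f3 : i + -1 + (j + 1) = n by rewrite addrA f1.
have f4 : i + 1 + j = n1 by rewrite addrAC e.
have f5 : i + (j + 1) = n1 by rewrite addrA e.
have f6 : i + 1 + -1 + j = n by rewrite addrK.
rewrite (hE _ _ _ e0 _ _ _ e erefl f1) (tdiffE _ _ _ (subrK 1 i) erefl e f3).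
rewrite (tdiffE _ _ _ erefl erefl f4 f5) (zmod_morphD (hB _ _ e1')).
rewrite (sgn_morph (hB _ _ e1')) (hE _ _ _ e1' _ _ _ f4 (addrK 1 i) e).
rewrite (hE _ _ _ e1' _ _ _ f5 erefl f3) sgnD.
have -> : sgn i (sgn (-1) (tens f3 (op contractS erefl b) (diff erefl m))) =
  - sgn i (tens f3 (op contractS erefl b) (diff erefl m)).
  by rewrite sgnN1 raddfN.
rewrite addrACA [- _ + _]addrC addrN [X in _ + X]addr0.
rewrite tresE -(tens_bal rho (add0r i) e e (add0r n)) dgmul1l addrA.
rewrite -!(zmod_morphD (tensBl _ _ _)); congr tens.
exact: mult_left_right.
Qed.

Lemma tres_quasi_iso : quasi_iso tres_dghom.
Proof.
apply: quasi_iso_intro => [i n e x y cx /= dy|i n e y cy].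
  have e0 : n + -1 = i by rewrite -e addrK.
  exists (tens (add0r i) one y + H e0 x).
  rewrite [LHS](zmod_morphD (tdiffB _)) tdiff_one dy [RHS](tensor_contract e0 e erefl (addrK 1 n)).
  have -> : tdiff erefl x = 0 by apply: cx.
  rewrite (zmod_morph0 (tens_opB contractB contractS contract_right (addrK 1 n))).
  by rewrite addr0.
exists (tens (add0r n) one y), 0; split.
  by move=> j e'; rewrite /= tdiff_one cy (zmod_morph0 (tensBr _ _ _)).
rewrite (zmod_morph0 (diffB _)) addr0 /= tresE.
by rewrite (dgr_fun1 mu) dgact1.
Qed.

(** The tensor product is formed over the right variable while t acts through the left one, so
    t-torsion in [M] does no harm: [divx] on the left factor undoes t. *)
Lemma tres_tau_inj i j (e : -2 + i = j) : injective (@tau (res_dgmod lam P) i j e).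
Proof.
have e' : j + 2 = i by rewrite -e addrC addrA subrr add0r.
apply: (can_inj (g := @tens_op _ _ divxS M _ _ e')) => x.
have hB := @tens_opB _ _ divxB divxS divx_right M _ _ e'.
rewrite -[@tau (res_dgmod lam P) _ _ e x]/(tact e (lam _ zt_t) x).
apply: (@tensor_ind _ _ rho M i (fun x => tens_op divxS e' (tact e (lam _ zt_t) x) = x))
  => [|y z hy hz|p q f b m].
- by rewrite (zmod_morph0 (tactBr _ _)) (zmod_morph0 hB).
- by rewrite tactBr hB hy hz.
have f1 : -2 + p + q = j by rewrite -addrA f.
have f2 : -2 + p + 2 = p by ring.
rewrite (tactE _ _ _ _ erefl f1) (tens_opE divxB divxS divx_right e' f1 f2 f).
congr tens; apply: val_inj => /=.
rewrite mul1r; exact: divxKl.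
Qed.

End TensorResolution.

(** * The coresolution by coinduction, with t surjective *)

Section CoindResolution.
Variable M : dgmod Zt.
Local Notation I := (coind_dgmod rho M).
Local Notation one := (dgone Zbar).

Section Fun.
Variables (n : int) (m : M n).

Lemma cres_funB i j (e : i + n = j) : zmod_morphism (fun b => dgact e (mu i b) m).
Proof. by move=> a b; rewrite dgr_funB dgactBl. Qed.

Lemma cres_funZ (i j k l p : int) (e1 : i + j = k) (e2 : k + n = l)
    (e3 : j + n = p) (e4 : i + p = l) (a : Zt i) (b : Zbar j) :
  dgact e2 (mu k (dgmul e1 (rho i a) b)) m =
  sgn (n * i) (dgact e4 a (dgact e3 (mu j b) m)).
Proof. by rewrite dgr_funM mult_rightK Zt_act_sgn; apply: dgactA. Qed.

Definition cres : chom rho M n :=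
  @CHom _ _ rho M n (fun i j e b => dgact e (mu i b) m) cres_funB cres_funZ.
End Fun.

Lemma cresE n (m : M n) i j (e : i + n = j) b : chom_fun (cres m) e b = dgact e (mu i b) m.
Proof. by []. Qed.

Lemma cresB n : zmod_morphism (@cres n).
Proof. by move=> x y; apply: chom_ext => i j e b; rewrite chom_subE !cresE dgactBr. Qed.

Lemma cresd i j (e : i + 1 = j) m : cres (diff e m) = cdiff e (cres m).
Proof.
apply: chom_ext => p q u b.
have u1 : p + i + 1 = q by rewrite -addrA e.
have u2 : p + 1 + i = q by rewrite addrAC.
rewrite (cdiffE e _ _ erefl u1 erefl u2) !cresE dgr_fund Zt_diff.
by rewrite (zmod_morph0 (dgactBl _ _)) raddf0 [RHS]subr0 (Zt_act_diff _ e _ u).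
Qed.

Lemma cresZ i j k (e : i + j = k) (a : Zt i) m :
  cres (dgact e a m) = cact e (lam i a) (cres m).
Proof.
apply: chom_ext => p q u b; have v : p + i + j = q by rewrite -addrA e.
rewrite (cactE e _ _ _ erefl v) !cresE dgr_funM mult_leftK.
by rewrite (dgactA erefl v e u) -(sgn_morph (dgactBr _ _)) mulrC Zt_act_sgn.
Qed.

Definition cres_dghom : dghom M (res_dgmod lam I) :=
  @DGHom _ M (res_dgmod lam I) cres cresB cresd cresZ.

Lemma cdiff_one i n (e : i + 1 = n) (x : chom rho M i) :
  chom_fun (cdiff e x) (add0r n) one = diff e (chom_fun x (add0r i) one).
Proof.
have e1 : 0 + 1 + i = n by rewrite add0r addrC.
rewrite (cdiffE e _ _ (add0r i) e erefl e1).
have -> : diff (erefl (0 + 1)) one = 0 by apply: val_inj; rewrite /= /dual_d /= mulr0.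
by rewrite (zmod_morph0 (chom_funB x _)) raddf0 [LHS]subr0.
Qed.

Lemma cres_one n (m : M n) : chom_fun (cres m) (add0r n) one = m.
Proof. by rewrite cresE (dgr_fun1 mu) dgact1. Qed.

Local Notation H := (chom_op contractB contractS contract_right).

(** Closedness of x, evaluated at h(b) for the homotopy h of [Zbar], trades d(x(h(b))) for (-1)^n
    x(d h(b)), after which [mult_left_right] applies; the factor [sgn n] compensates this sign. *)
Lemma coind_contract n n0 (e0 : n0 = -1 + n) (e0' : n0 + 1 = n) (x : chom rho M n) :
  closed (x : I n) ->
  x = cres (chom_fun x (add0r n) one) + cdiff e0' (sgn n (H e0 x)).
Proof.
move=> cx; apply: chom_ext => i j e b.
rewrite chom_addE (sgn_morph (cdiffB _)) chom_sgnE cresE.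
have f1 : i + -1 + n = j - 1 by rewrite addrAC e.
have f2 : i + n0 = j - 1 by rewrite e0 addrA f1.
have f3 : i + 1 + n0 = j by rewrite addrAC f2 subrK.
rewrite (cdiffE e0' _ _ f2 (subrK 1 j) erefl f3).
rewrite (chom_opE _ _ _ _ _ _ erefl f1) (chom_opE _ _ _ _ _ _ (addrK 1 i) e).
have f4 : i + -1 + (n + 1) = j by rewrite addrA f1 subrK.
have := congr1 (fun y => chom_fun y f4 (op contractS erefl b)) (cx _ (erefl (n + 1))).
rewrite /= -[LHS]/(chom_fun (cdiff erefl x) f4 (op contractS erefl b)).
rewrite (cdiffE _ _ _ f1 (subrK 1 j) (subrK 1 i) e) => /eqP.
rewrite subr_eq0 => /eqP ->.
have -> (y : M j) : sgn n0 y = - sgn n y by rewrite e0 addrC sgnD sgnN1 raddfN.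
rewrite opprK raddfD /= !sgnK -(zmod_morphD (chom_funB x e)).
have {1}-> : b = rho i (mu i b) + (diff (subrK 1 i) (op contractS erefl b) +
    op contractS (addrK 1 i) (diff erefl b)).
  by rewrite addrA; apply: mult_left_right.
rewrite (zmod_morphD (chom_funB x e)); congr (_ + _).
have := chom_funZ x (addr0 i) e (add0r n) e (mu i b) one.
by rewrite dgmul1r Zt_act_sgn.
Qed.

Lemma cres_quasi_iso : quasi_iso cres_dghom.
Proof.
apply: quasi_iso_intro => [i n e m x cm /= dx|i n e x cx].
  exists (chom_fun x (add0r i) one); rewrite -cdiff_one.
  by rewrite (dx : cdiff e x = cres m) cres_one.
have e0 : i = -1 + n by rewrite -e; ring.
exists (chom_fun (x : chom rho M n) (add0r n) one), (sgn n (H e0 x)); split.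
  move=> j e'; rewrite -cdiff_one.
  by rewrite (cx j e' : cdiff e' (x : chom rho M n) = 0).
exact: coind_contract.
Qed.

(** The action of t multiplies the argument of a homomorphism by t, so precomposing y with [divx]
    gives a preimage of y. *)
Lemma cres_tau_surj i j (e : -2 + i = j) (y : res_dgmod lam I j) :
  exists x : res_dgmod lam I i, tau e x = y.
Proof.
have e' : i = 2 + j by rewrite -e; ring.
exists (chom_op divxB divxS divx_right e' (y : chom rho M j)).
apply: chom_ext => p q u b.
rewrite -[tau e _]/(cact e (lam _ zt_t) _).
have f1 : p + -2 + i = q by rewrite -addrA e.
have f2 : p + -2 + 2 = p by rewrite subrK.
rewrite (cactE e _ _ _ erefl f1) (chom_opE _ _ _ _ _ _ f2 u).
have -> : op divxS f2 (dgmul erefl b (lam _ zt_t)) = b.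
  by apply: val_inj; rewrite /= mul1r; apply: divxK.
by apply: (@sgn_parity _ (- (i + p)) _ 0); ring.
Qed.

End CoindResolution.

(** * Non-conservativity *)

(** Odd degrees are filled as well, so that t can be the identity of one group everywhere and no
    parity condition enters. *)
Definition laurent_complex : complex.
Proof.
apply: (@Complex (fun=> int : zmodType) (fun _ _ _ _ => 0)) => //.
Defined.

(* Z[t,1/t] + Z[t,1/t][1]: a copy of Z in each degree, on which t acts as the
   identity. *)
Definition laurent : dgmod Zt.
Proof.
apply: (@DGMod Zt laurent_complex (fun i j k e a m => gval a * m)).
- by move=> i j k e m a b; rewrite mulrBl.
- by move=> i j k e a m m'; rewrite mulrBr.
- by move=> i j k ij jk ijk e1 e2 e3 e4 a b m /=; rewrite mulrA.
- by move=> i e m; rewrite mul1r.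
- by move=> i j k i' j' k' e ei ej ek el er a m /=; rewrite mul0r mulr0 raddf0.
Defined.

Lemma laurent_tau_bij i j (e : -2 + i = j) : bijective (@tau laurent i j e).
Proof. by exists id => x; apply: mul1r. Qed.

Lemma laurent_coh : exists h : cohomology laurent 0, h != 0.
Proof.
have c1 : is_cocycle (1 : laurent 0) by [].
exists (coh_class (Cocycle c1)); apply/eqP => h.
have /coh_class_eq [i [e [y]]] : coh_class (Cocycle c1) = coh_class 0.
  by rewrite h (zmod_morph0 (@coh_classB laurent 0)).
by [].
Qed.

Section ZeroModule.
Variable A : dgring.

Definition zero_complex : complex :=
  @Complex (fun=> unit : zmodType) (fun _ _ _ _ => 0) (fun _ _ _ _ _ => erefl)
    (fun _ _ _ _ _ _ => erefl).

Definition zero_dgmod : dgmod A.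
Proof. by apply: (@DGMod A zero_complex (fun _ _ _ _ _ _ => tt)) => // i _ []. Defined.

Definition from_zero (M : dgmod A) : dghom zero_dgmod M.
Proof.
apply: (@DGHom A zero_dgmod M (fun _ _ => 0)).
- by move=> n x y; rewrite subr0.
- by move=> i j e m; rewrite (zmod_morph0 (diffB _)).
- by move=> i j k e a m; rewrite (zmod_morph0 (dgactBr _ _)).
Defined.

Lemma zero_coh n (h h' : cohomology zero_dgmod n) : h = h'.
Proof.
have [x ->] := coh_class_surj h; have [y ->] := coh_class_surj h'.
by congr coh_class; apply: val_inj; case: (val x) (val y) => -[].
Qed.

End ZeroModule.

Lemma from_zero_not_iso :
  ~ is_iso (fmap (loc_functor (C := DGMod_cat Zt) (@quasi_iso Zt))
             (from_zero laurent : @hom (DGMod_cat Zt) _ _)).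
Proof.
exact: not_iso_from_acyclic (@zero_coh Zt 0) laurent_coh.
Qed.

(** The morphism 0 -> [laurent] refutes conservativity: it becomes invertible because the Koszul
    complex of [laurent] is acyclic, for either shift. *)
Lemma koszul_from_zero s r (sr : s + 3 = r) :
  quasi_iso (fmap (koszul_functor sr) (from_zero laurent : @hom (DGMod_cat Zt) _ _)).
Proof.
apply: quasi_iso_intro => [i n e x y _ _|i n e y cy].
  exists 0; have U (a b : koszul sr (zero_dgmod Zt) n) : a = b.
    by case: a b => [[] []] [[] []].
  exact: U.
have [z dz] := koszul_acyclic (sr := sr) (M := laurent) (fun _ _ _ _ => erefl) laurent_tau_bij cy e.
exists 0, z; split; first by move=> j e'; rewrite (zmod_morph0 (diffB _)).
by rewrite (zmod_morph0 (dgh_funB _ (n := _))) add0r; symmetry.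
Qed.

Lemma koszul_functor_quasi_iso s r (sr : s + 3 = r) (M N : DGMod_cat Zt) (f : hom M N) :
  quasi_iso f -> quasi_iso (fmap (koszul_functor sr) f).
Proof. exact: koszul_quasi_iso. Qed.

Definition red_trans :
  nat_trans (koszul_functor (add0r 3)) (tensor_functor (H0_proj Zt)).
Proof.
exists (fun M : DGMod_cat Zt => red_dghom M) => M N f n z /=.
by rewrite /red_fun (tensor_mapE _ f).
Defined.

Definition cored_trans :
  nat_trans (coind_functor (H0_proj Zt)) (koszul_functor (addNr 3)).
Proof.
exists (fun M : DGMod_cat Zt => cored_dghom M) => M N f n x /=.
by rewrite /cored_fun /koszul_map_fun /= (zmod_morph0 (dgh_funB f (n := _))).
Defined.

(** [Zbar] is used as a bimodule: [M] is tensored along [right_hom], and [Zt] acts on the result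
    through [left_hom]. *)
Definition tensor_resolution (M : DGMod_cat Zt) : DGMod_cat Zt :=
  res_dgmod left_hom (tensor_dgmod right_hom M).

Definition tensor_resolution_map (M N : DGMod_cat Zt) (f : hom M N) :
    hom (tensor_resolution M) (tensor_resolution N) :=
  res_dghom left_hom (tensor_dghom right_hom f).

Lemma tres_nat (M N : DGMod_cat Zt) (f : hom M N) :
  heq (comp (tres_dghom N : @hom (DGMod_cat Zt) _ _) (tensor_resolution_map f))
      (comp f (tres_dghom M : @hom (DGMod_cat Zt) _ _)).
Proof.
move=> n; apply: (@tensor_ind _ _ right_hom M n (fun x =>
  tres (tensor_map f x) = f n (tres x))) => [|y z hy hz|i j e b m].
- by rewrite (zmod_morph0 (@tensor_mapB _ _ right_hom M N f n)) !(zmod_morph0 (@tresB _ n))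
    (zmod_morph0 (dgh_funB f (n := _))).
- by rewrite (tensor_mapB f) !tresB dgh_funB hy hz.
by rewrite (tensor_mapE _ f) !tresE dgh_funZ.
Qed.

Definition coind_resolution (M : DGMod_cat Zt) : DGMod_cat Zt :=
  res_dgmod left_hom (coind_dgmod right_hom M).

Definition coind_resolution_map (M N : DGMod_cat Zt) (f : hom M N) :
    hom (coind_resolution M) (coind_resolution N) :=
  res_dghom left_hom (coind_dghom right_hom f).

Lemma cres_nat (M N : DGMod_cat Zt) (f : hom M N) :
  heq (comp (cres_dghom N : @hom (DGMod_cat Zt) _ _) f)
      (comp (coind_resolution_map f) (cres_dghom M : @hom (DGMod_cat Zt) _ _)).
Proof. by move=> n x; apply: chom_ext => i j e b /=; rewrite dgh_funZ. Qed.

Theorem theorem2p3 :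
  exists A : dgring,
    dg_commutative A /\
    ~ bounded_cohomology A /\
    (exists L : functor (derived_cat A) (derived_cat (H0_dgring A)),
       is_reduction_functor L /\ ~ conservative L) /\
    (exists R : functor (derived_cat A) (derived_cat (H0_dgring A)),
       is_coreduction_functor R /\ ~ conservative R).
Proof.
exists Zt; split; first exact: Zt_commutative.
split; first exact: Zt_unbounded.
split.
  exists (loc_lift (@koszul_functor_quasi_iso _ _ (add0r 3))); split; last first.
    exact: loc_lift_not_conservative (koszul_from_zero _) from_zero_not_iso.
  exists (left_counit _ red_trans).
  apply: (@left_derived_of_resolution _ _ _ _ _ _ _ tensor_resolution
    tensor_resolution_map _ (fun M => tres_dghom M)) => [M N f|M|M].
  - exact: tres_nat.
  - exact: tres_quasi_iso.
  - exact: red_quasi_iso (@tres_tau_inj M).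
exists (loc_lift (@koszul_functor_quasi_iso _ _ (addNr 3))); split; last first.
  exact: loc_lift_not_conservative (koszul_from_zero _) from_zero_not_iso.
exists (right_unit _ cored_trans).
apply: (@right_derived_of_resolution _ _ _ _ _ _ _ coind_resolution
  coind_resolution_map _ (fun M => cres_dghom M)) => [M N f|M|M].
- exact: cres_nat.
- exact: cres_quasi_iso.
- exact: cored_quasi_iso (@cres_tau_surj M).
Qed.
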